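(* Let $(A,\mathfrak{m})$ be a Cohen–Macaulay local ring with $\dim A\ge3$. Let $I\subseteq J$ be $\mathfrak{m}$-primary ideals of $A$ with $I$ a reduction of $J$. Suppose $Gr_I(A)$ is Cohen–Macaulay and $J$ is asymptotically normal. Then $e_3^J(A)\ge e_3^I(A)$.
   Context: $Gr_I(A)=\bigoplus_{n\ge0}I^n/I^{n+1}$. $J$ is asymptotically normal if $J^n$ is integrally closed for all $n\gg0$. For an $\mathfrak{m}$-primary ideal $K$ and $d=\dim A$, the Hilbert coefficients $e_i^K(A)$ are the integers with $\lambda(A/K^{n+1})=\sum_{i=0}^d(-1)^ie_i^K(A)\binom{n+d-i}{d-i}$ for $n\gg0$. A reduction: $I J^n=J^{n+1}$ for large $n$. *)

(* Defs.v *)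
From HB Require Import structures.
From mathcomp Require Import all_boot all_order all_algebra.
From mathcomp Require Import mpoly.
Set Implicit Arguments. Unset Strict Implicit. Unset Printing Implicit Defensive.
Import Order.TTheory GRing.Theory Num.Theory.
Local Open Scope ring_scope.

Section CommAlg.
Variable R : comNzRingType.

Definition sset (I J : R -> Prop) := forall x, I x -> J x.
Definition seqv (I J : R -> Prop) := forall x, I x <-> J x.
Definition sstrict (I J : R -> Prop) := sset I J /\ ~ sset J I.
Definition whole : R -> Prop := fun _ => True.
Definition zero_ideal : R -> Prop := fun x => x = 0.

Definition is_ideal (I : R -> Prop) :=
  [/\ I 0, (forall x y, I x -> I y -> I (x + y)) & (forall a x, I x -> I (a * x))].

Definition gen_ideal (k : nat) (x : nat -> R) : R -> Prop :=
  fun y => exists c : nat -> R, y = \sum_(i < k) c i * x i.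

Definition ideal_add (I J : R -> Prop) : R -> Prop :=
  fun z => exists x y, [/\ I x, J y & z = x + y].

Definition ideal_mul (I J : R -> Prop) : R -> Prop :=
  fun z => exists (k : nat) (x y : nat -> R),
    (forall i, (i < k)%N -> I (x i) /\ J (y i)) /\ z = \sum_(i < k) x i * y i.

Fixpoint ideal_pow (I : R -> Prop) (n : nat) : R -> Prop :=
  if n is n'.+1 then ideal_mul I (ideal_pow I n') else whole.

Definition is_prime (P : R -> Prop) :=
  [/\ is_ideal P, ~ P 1 & forall x y, P (x * y) -> P x \/ P y].

Definition is_maximal (P : R -> Prop) :=
  [/\ is_ideal P, ~ P 1 &
      forall Q, is_ideal Q -> sset P Q -> Q 1 \/ sset Q P].

Definition noetherian :=
  forall C : nat -> R -> Prop, (forall n, is_ideal (C n)) ->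
    (forall n, sset (C n) (C n.+1)) -> exists N, forall n, (N <= n)%N -> sset (C n) (C N).

Definition local_ring (m : R -> Prop) :=
  is_maximal m /\ forall P, is_maximal P -> seqv P m.

(* Notions in the quotient ring R/N, expressed through ideals of R
   containing N (N = zero_ideal gives R itself). *)

Definition prime_chain (N : R -> Prop) (P : nat -> R -> Prop) (l : nat) :=
  sset N (P 0%N) /\ (forall i, (i <= l)%N -> is_prime (P i)) /\
  (forall i, (i < l)%N -> sstrict (P i) (P i.+1)).

Definition krull_dim (N : R -> Prop) (d : nat) :=
  (exists P, prime_chain N P d) /\ (forall P l, prime_chain N P l -> (l <= d)%N).

Definition height (N Q : R -> Prop) (h : nat) :=
  (exists P, prime_chain N P h /\ seqv (P h) Q) /\
  (forall P l, prime_chain N P l -> seqv (P l) Q -> (l <= h)%N).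

Definition regular_seq (N Q : R -> Prop) (x : nat -> R) (k : nat) :=
  [/\ forall i, (i < k)%N -> Q (x i),
      forall i, (i < k)%N -> forall y,
        ideal_add N (gen_ideal i x) (x i * y) -> ideal_add N (gen_ideal i x) y
    & ~ ideal_add N (gen_ideal k x) 1].

Definition grade (N Q : R -> Prop) (g : nat) :=
  (exists x, regular_seq N Q x g) /\ (forall x k, regular_seq N Q x k -> (k <= g)%N).

Definition CM_local (m : R -> Prop) (d : nat) :=
  krull_dim zero_ideal d /\ grade zero_ideal m d.

(* R/N is Cohen-Macaulay: for every maximal ideal Q/N of R/N,
   depth (R/N)_Q = grade Q/N equals dim (R/N)_Q = height Q/N *)
Definition CM_quot (N : R -> Prop) :=
  forall Q, is_maximal Q -> sset N Q -> exists h, height N Q h /\ grade N Q h.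

(* length of the R-module R/K equals l (maximal length of a strict chain of
   ideals from K to R, i.e. of submodules of R/K) *)
Definition ideal_chain (K : R -> Prop) (C : nat -> R -> Prop) (l : nat) :=
  seqv (C 0%N) K /\ seqv (C l) whole /\ (forall i, (i <= l)%N -> is_ideal (C i)) /\
  (forall i, (i < l)%N -> sstrict (C i) (C i.+1)).

Definition length_eq (K : R -> Prop) (l : nat) :=
  (exists C, ideal_chain K C l) /\ (forall C k, ideal_chain K C k -> (k <= l)%N).

Definition m_primary (m I : R -> Prop) :=
  is_ideal I /\ forall x, m x <-> exists n, I (x ^+ n).

Definition hilb_coeffs (K : R -> Prop) (d : nat) (e : nat -> int) :=
  exists N, forall n, (N <= n)%N -> exists l, length_eq (ideal_pow K n.+1) l /\
    (l%:Z = \sum_(i < d.+1) (-1) ^+ i * e i * ('C(n + d - i, d - i))%:Z)%R.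

Definition reduction (I J : R -> Prop) :=
  sset I J /\ exists N, forall n, (N <= n)%N ->
    seqv (ideal_mul I (ideal_pow J n)) (ideal_pow J n.+1).

Definition integral_over_ideal (K : R -> Prop) (x : R) :=
  exists (k : nat) (c : nat -> R), (0 < k)%N /\
    (forall i, (1 <= i <= k)%N -> ideal_pow K i (c i)) /\
    x ^+ k + \sum_(1 <= i < k.+1) c i * x ^+ (k - i) = 0.

Definition integrally_closed (K : R -> Prop) := sset (integral_over_ideal K) K.

Definition asymptotically_normal (J : R -> Prop) :=
  exists N, forall n, (N <= n)%N -> integrally_closed (ideal_pow J n).

End CommAlg.

(* Associated graded ring Gr_I(A), presented as A[X_0..X_{r-1}]/N where
   a : 'I_r -> A generates I and N = {F | for all k, F_k(a) in I^{k+1}}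
   (F_k the degree-k homogeneous component of F); X_i |-> a_i^* in degree 1. *)
Definition gr_kernel (A : comNzRingType) (I : A -> Prop) (r : nat) (a : 'I_r -> A)
  : {mpoly A[r]} -> Prop :=
  fun F => forall k : nat, ideal_pow I k.+1 (pihomog mdeg k F).@[a].

Definition generates (A : comNzRingType) (I : A -> Prop) (r : nat) (a : 'I_r -> A) :=
  forall x, I x <-> exists c : 'I_r -> A, x = \sum_(i < r) c i * a i.

Definition Gr_CM (A : comNzRingType) (I : A -> Prop) :=
  exists (r : nat) (a : 'I_r -> A), generates I a /\ CM_quot (gr_kernel I a).

(* Main.v *)
(* In dimension 3 one has lambda(A/J^n) = P(n) for n large with P(0) = - e_3.
   For elements t_1, t_2, t_3 of I and k large, the Koszul complex of the t_i^k
   on the modules A/J^(nk) compares k^3 e_0 - e_3 = P(3k) - 3P(2k) + 3P(k) with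
   the length of A/(J^(3k) + (t_1^k, t_2^k, t_3^k)).  If Gr_I(A) is
   Cohen-Macaulay and the t_i are generic, the two agree for I; if J^n is
   integrally closed for n large, the second homology vanishes for J, because
   t_1^k a_1 + t_2^k a_2 in J^(2k) forces a_1, a_2 in J^k (a Huneke-Itoh type
   statement, proved by improving the order of a_i in J step by step from
   k q/(q+1) to k (q+1)/(q+2)).  Since I^(3k) is contained in J^(3k) and I, J
   have the same e_0, this gives e_3^I <= e_3^J.

   In dimension d one first kills d - 3 generic elements x = sum_i z_i a_i of
   I = (a_1, ..., a_r), passing from (R, N) to (R[z], N R[z] + (x)) and taking
   lengths at the extension of the maximal ideal.  This replaces the Hilbert
   polynomials by their differences and preserves asymptotic normality: for f
   homogeneous in z of degree D, the substitution z_l -> - sum_(i <> l) a_i z_i,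
   z_i -> a_l z_i kills x and is congruent to multiplication by a_l^D modulo x,
   so normality of R gives a_l^D f in J^(n+D) modulo x for every l, and a
   Ratliff-Rush argument removes the powers of the a_l.

   The grade of Gr_I(A) at its irrelevant maximal ideal is at least d, since
   otherwise lambda(A/I^n) would grow too slowly for d generic elements of I to
   be a regular sequence; an exchange argument turns any regular sequence of
   Gr_I(A) into one given by generic elements of degree one. *)

Require Import Defs.
From HB Require Import structures.
From mathcomp Require Import all_boot all_order all_algebra.
From mathcomp Require Import ring zify.
From mathcomp Require Import mpoly.
From Stdlib Require Import Classical IndefiniteDescription FunctionalExtensionality.
From Stdlib Require Import PropExtensionality.
Set Implicit Arguments. Unset Strict Implicit. Unset Printing Implicit Defensive.
Import GRing.Theory.
Local Open Scope ring_scope.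

(** Nothing is assumed on the residue field, so A itself may contain no sufficiently general
    elements of I; this is why generic elements carry indeterminate coefficients. The price is that
    A[z] is not local. Rather than localizing, lengths are counted at a prime p by allowing
    multipliers outside p, and all ideals stay ideals of a polynomial ring. Integral closedness is
    replaced by closedness under almost integrality with a multiplier from a fixed power J^c. This
    notion passes to coefficients of polynomials, and it absorbs the bounded losses of the order
    argument: the reduction number and the rounding of exponents. Regularity on Gr_I(A) has to
    follow every change of ring, so a second ring V, which presents the graded ring through a map to
    the Rees algebra, is extended in parallel with U. Each new generic element uses up one member of
    a regular sequence of A and one of Gr_I(A): d - 3 are spent on cutting down the dimension and
    three on t_1, t_2, t_3. Of the equality of the e_0 only e_0^I <= e_0^J enters, and it follows
    from J^(n+c) being contained in I^n. *)

(** * Ideals, adjunction of elements, regular sequences and powers *)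

Section Ideals.
Variable R : comNzRingType.
Implicit Types (K L M N p : R -> Prop) (x y z g : R).

Lemma sset_eq K L : sset K L -> sset L K -> K = L.
Proof.
move=> KL LK; apply: functional_extensionality => x.
by apply: propositional_extensionality; split; [apply: KL | apply: LK].
Qed.

Lemma id0 K : is_ideal K -> K 0. Proof. by case. Qed.

Lemma idD K : is_ideal K -> forall x y, K x -> K y -> K (x + y).
Proof. by case. Qed.

Lemma idM K : is_ideal K -> forall a x, K x -> K (a * x).
Proof. by case. Qed.

Lemma idMr K : is_ideal K -> forall a x, K x -> K (x * a).
Proof. by move=> iK a x Kx; rewrite mulrC; apply: idM. Qed.

Lemma idN K : is_ideal K -> forall x, K x -> K (- x).
Proof. by move=> iK x Kx; rewrite -mulN1r; apply: idM. Qed.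

Lemma idB K : is_ideal K -> forall x y, K x -> K y -> K (x - y).
Proof. by move=> iK x y Kx Ky; apply: idD => //; apply: idN. Qed.

Lemma idDl K : is_ideal K -> forall x y, K x -> K (x + y) -> K y.
Proof.
by move=> iK x y Kx Kxy; rewrite -[y](addKr x) addrC; apply: idB.
Qed.

Lemma idBl K : is_ideal K -> forall x y, K x -> K (y - x) -> K y.
Proof. by move=> iK x y Kx Kxy; rewrite -[y](subrK x); apply: idD. Qed.

Lemma id_sum K : is_ideal K -> forall (T : Type) (s : seq T) (P : pred T) F,
  (forall i, P i -> K (F i)) -> K (\sum_(i <- s | P i) F i).
Proof. by move=> iK T s P F; apply: big_ind; [apply: id0 | apply: idD]. Qed.

Lemma whole_ideal : is_ideal (@whole R). Proof. by split. Qed.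

Lemma zero_ideal_ideal : is_ideal (@zero_ideal R).
Proof.
split=> // [x y -> ->|a x ->]; first by rewrite /zero_ideal addr0.
by rewrite /zero_ideal mulr0.
Qed.

Lemma ideal_addP K L : is_ideal K -> is_ideal L -> is_ideal (ideal_add K L).
Proof.
move=> iK iL; split.
- by exists 0, 0; rewrite addr0; split=> //; apply: id0.
- move=> _ _ [x [y [Kx Ly ->]]] [x' [y' [Kx' Ly' ->]]].
  by exists (x + x'), (y + y'); split; [apply: idD|apply: idD|rewrite addrACA].
- move=> a _ [x [y [Kx Ly ->]]].
  by exists (a * x), (a * y); split; [apply: idM|apply: idM|rewrite mulrDr].
Qed.

Lemma ideal_addl K L : is_ideal L -> sset K (ideal_add K L).
Proof. by move=> iL x Kx; exists x, 0; rewrite addr0; split=> //; apply: id0. Qed.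

Lemma ideal_addr K L : is_ideal K -> sset L (ideal_add K L).
Proof. by move=> iK x Lx; exists 0, x; rewrite add0r; split=> //; apply: id0. Qed.

Lemma ideal_add_le K L K' L' : sset K K' -> sset L L' ->
  sset (ideal_add K L) (ideal_add K' L').
Proof.
by move=> KK LL _ [x [y [Kx Ly ->]]]; exists x, y; split=> //; [apply: KK|apply: LL].
Qed.

Lemma ideal_add_sub K L M : is_ideal M -> sset K M -> sset L M ->
  sset (ideal_add K L) M.
Proof.
by move=> iM KM LM _ [x [y [Kx Ly ->]]]; apply: idD => //; [apply: KM|apply: LM].
Qed.

Definition adj K x : R -> Prop := fun z => exists c, K (z - c * x).

Definition colon K y : R -> Prop := fun z => K (y * z).

Lemma adjP K x : is_ideal K -> is_ideal (adj K x).
Proof.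
move=> iK; split.
- by exists 0; rewrite mul0r subr0; apply: id0.
- move=> u v [c Kc] [c' Kc']; exists (c + c').
  by rewrite mulrDl opprD addrACA; apply: idD.
- by move=> a u [c Kc]; exists (a * c); rewrite -mulrA -mulrBr; apply: idM.
Qed.

Lemma colonP K y : is_ideal K -> is_ideal (colon K y).
Proof.
move=> iK; rewrite /colon; split.
- by rewrite mulr0; apply: id0.
- by move=> u v Ku Kv; rewrite mulrDr; apply: idD.
- by move=> a u Ku; rewrite mulrCA; apply: idM.
Qed.

Lemma sub_adj K x : sset K (adj K x).
Proof. by move=> z Kz; exists 0; rewrite mul0r subr0. Qed.

Lemma adj_mem K x : is_ideal K -> adj K x x.
Proof. by move=> iK; exists 1; rewrite mul1r subrr; apply: id0. Qed.

Lemma adj_min K L x : is_ideal L -> sset K L -> L x -> sset (adj K x) L.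
Proof.
by move=> iL KL Lx z [c /KL Lc]; rewrite -[z](subrK (c * x)); apply: idD => //;
  apply: idM.
Qed.

Lemma adj_le K L x : sset K L -> sset (adj K x) (adj L x).
Proof. by move=> KL z [c Kc]; exists c; apply: KL. Qed.

Lemma adjC K x y : adj (adj K x) y = adj (adj K y) x.
Proof.
have sub u v : sset (adj (adj K u) v) (adj (adj K v) u).
  by move=> z [c [c' Kz]]; exists c', c; rewrite addrAC.
by apply: sset_eq.
Qed.

Lemma adj_add K L x : adj (ideal_add K L) x = ideal_add K (adj L x).
Proof.
apply: sset_eq => z.
  move=> [c [k [l [Kk Ll e]]]]; exists k, (l + c * x); split=> //.
    by exists c; rewrite addrK.
  by rewrite addrA -e subrK.
move=> [k [l [Kk [c Lc] ->]]]; exists c, k, (l - c * x); split=> //.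
by rewrite addrA.
Qed.

Fixpoint adjl K (s : seq R) : R -> Prop :=
  if s is x :: s' then adjl (adj K x) s' else K.

Lemma adjlP s K : is_ideal K -> is_ideal (adjl K s).
Proof. by elim: s K => //= x s IH K iK; apply: IH; apply: adjP. Qed.

Lemma adjl_cat s t K : adjl K (s ++ t) = adjl (adjl K s) t.
Proof. by elim: s K => /=. Qed.

Lemma adjl_rcons s x K : adjl K (rcons s x) = adj (adjl K s) x.
Proof. by rewrite -cats1 adjl_cat. Qed.

Lemma adjl_adj s x K : adjl (adj K x) s = adj (adjl K s) x.
Proof. by elim: s K => //= y s IH K; rewrite adjC IH. Qed.

Lemma sub_adjl s K : sset K (adjl K s).
Proof.
by elim: s K => [|x s IH] K z Kz //=; apply: IH; apply: sub_adj.
Qed.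

Lemma adjl_le s K L : sset K L -> sset (adjl K s) (adjl L s).
Proof. by elim: s K L => //= x s IH K L KL; apply: IH; apply: adj_le. Qed.

Lemma adjl_min s K L : is_ideal L -> sset K L -> (forall x, x \in s -> L x) ->
  sset (adjl K s) L.
Proof.
move=> iL; elim: s K => //= x s IH K KL Ls.
apply: IH => [|y ys]; last by apply: Ls; rewrite inE ys orbT.
by apply: adj_min => //; apply: Ls; rewrite inE eqxx.
Qed.

Lemma adjl_mem s K x : is_ideal K -> x \in s -> adjl K s x.
Proof.
elim: s K => //= y s IH K iK; rewrite inE => /predU1P[->|]; last first.
  by apply: IH; apply: adjP.
by apply: sub_adjl; apply: adj_mem.
Qed.

Lemma adjl_add s K L : adjl (ideal_add K L) s = ideal_add K (adjl L s).
Proof. by elim: s L => //= x s IH L; rewrite adj_add IH. Qed.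

Definition nzd K x := forall y, K (x * y) -> K y.

Fixpoint regl K (s : seq R) : Prop :=
  if s is x :: s' then nzd K x /\ regl (adj K x) s' else True.

Lemma regl_cat s t K : regl K (s ++ t) <-> regl K s /\ regl (adjl K s) t.
Proof. by elim: s K => [|x s IH] K /=; [tauto|rewrite IH; tauto]. Qed.

Lemma regl_rcons s x K : regl K (rcons s x) <-> regl K s /\ nzd (adjl K s) x.
Proof. by rewrite -cats1 regl_cat /=; tauto. Qed.

Lemma nzdX K x n : nzd K x -> nzd K (x ^+ n).
Proof.
move=> xK; elim: n => [|n IH] y; first by rewrite expr0 mul1r.
by rewrite exprS -mulrA => /xK /IH.
Qed.

(* This moves x in front of f in a regular sequence. *)
Lemma nzd_swap K f x : is_ideal K -> nzd K f -> nzd (adj K f) x ->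
  nzd (adj K x) f.
Proof.
move=> iK fK xf y [v Kv].
have [w Kw] : adj K f v.
  apply: xf; exists y.
  by rewrite -opprB; apply: idN => //; rewrite [x * v]mulrC [y * f]mulrC.
exists w; apply: fK.
rewrite mulrBr; apply: (@idBl K) (x * (v - w * f)) _ _ _ => //.
  by apply: idM.
by rewrite (_ : _ - _ = f * y - v * x) //; ring.
Qed.

Fixpoint regat K (s : seq R) x : Prop :=
  nzd K x /\ (if s is f :: s' then regat (adj K f) s' x else True).

(** [nzd_swap] carries x past one element at a time; each exchange needs x regular modulo the
    segment before it, which is what [regat] records. *)
Lemma regl_swap s K x : is_ideal K -> regat K s x -> regl K s ->
  regl (adj K x) s.
Proof.
elim: s K => //= f s IH K iK [xK xs] [fK fs]; split.
  by apply: nzd_swap => //; case: (s) xs => /= [|? ?] [].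
by rewrite adjC; apply: IH => //; apply: adjP.
Qed.

Definition isum r (a : 'I_r -> R) K : R -> Prop :=
  fun z => exists2 g : 'I_r -> R, forall i, K (g i) & z = \sum_i g i * a i.

Lemma isumP r (a : 'I_r -> R) K : is_ideal K -> is_ideal (isum a K).
Proof.
move=> iK; split.
- exists (fun=> 0) => [i|]; first exact: id0.
  by rewrite big1 // => i _; rewrite mul0r.
- move=> _ _ [g Kg ->] [h Kh ->]; exists (fun i => g i + h i) => [i|].
    exact: idD.
  by rewrite -big_split; apply: eq_bigr => i _; rewrite mulrDl.
- move=> c _ [g Kg ->]; exists (fun i => c * g i) => [i|]; first exact: idM.
  by rewrite mulr_sumr; apply: eq_bigr => i _; rewrite mulrA.
Qed.

Lemma isum_mem r (a : 'I_r -> R) K i z : is_ideal K -> K z -> isum a K (z * a i).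
Proof.
move=> iK Kz; exists (fun j => if j == i then z else 0) => [j|].
  by case: ifP => _ //; apply: id0.
rewrite (bigD1 i) //= eqxx big1 ?addr0 // => j /negPf ->.
by rewrite mul0r.
Qed.

Lemma isum_min r (a : 'I_r -> R) K L : is_ideal L ->
  (forall i z, K z -> L (z * a i)) -> sset (isum a K) L.
Proof. by move=> iL KL _ [g Kg ->]; apply: id_sum => // i _; apply: KL. Qed.

Lemma isum_le r (a : 'I_r -> R) K L : sset K L -> sset (isum a K) (isum a L).
Proof. by move=> KL _ [g Kg ->]; exists g => // i; apply: KL. Qed.

(** Powers are built from a fixed list of generators because in this form they commute with
    extension to polynomial rings, coefficient by coefficient. *)
Fixpoint gpow r (a : 'I_r -> R) n : R -> Prop :=
  if n is n'.+1 then isum a (gpow a n') else @whole R.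

Lemma gpowP r (a : 'I_r -> R) n : is_ideal (gpow a n).
Proof. by elim: n => [|n IH]; [apply: whole_ideal|apply: isumP]. Qed.

Lemma gpow1 r (a : 'I_r -> R) i : gpow a 1 (a i).
Proof. by rewrite -[a i]mul1r; apply: isum_mem => //; apply: whole_ideal. Qed.

Lemma gpowM r (a : 'I_r -> R) n k x y :
  gpow a n x -> gpow a k y -> gpow a (n + k) (x * y).
Proof.
elim: n x => [|n IH] x /=; first by move=> _; apply: idM; apply: gpowP.
move=> [g Kg ->] Ky; exists (fun i => g i * y) => [i|]; first exact: IH.
by rewrite mulr_suml; apply: eq_bigr => i _; rewrite mulrAC.
Qed.

Lemma gpowX r (a : 'I_r -> R) n k x : gpow a n x -> gpow a (n * k) (x ^+ k).
Proof.
move=> ax; elim: k => [|k IH]; first by rewrite muln0.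
by rewrite exprS mulnS; apply: gpowM.
Qed.

Lemma gpowS_le r (a : 'I_r -> R) n : sset (gpow a n.+1) (gpow a n).
Proof.
by apply: isum_min => [|i z az]; [apply: gpowP|apply: idMr => //; apply: gpowP].
Qed.

Lemma gpow_le r (a : 'I_r -> R) n k : (n <= k)%N -> sset (gpow a k) (gpow a n).
Proof.
move=> /subnK <-; elim: (k - n)%N => [|j IH] x //.
by rewrite addSn => /gpowS_le/IH.
Qed.

Lemma gpow_sub r (a : 'I_r -> R) s (b : 'I_s -> R) :
  (forall i, gpow b 1 (a i)) -> forall n, sset (gpow a n) (gpow b n).
Proof.
move=> ab; elim=> [|n IH] //; apply: isum_min => [|i z az]; first exact: gpowP.
by rewrite -addn1; apply: gpowM => //; apply: IH.
Qed.

(** Peeling off one generator a_i replaces the target L by L : a_i, hence the induction over all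
    ideals L. The same device returns in the other induction principles for powers. *)
Lemma gpow_add_ind r (a : 'I_r -> R) n k x L : is_ideal L ->
  (forall u v, gpow a n u -> gpow a k v -> L (u * v)) ->
  gpow a (n + k) x -> L x.
Proof.
elim: n x L => [|n IH] x L iL ukL /= ax; first by rewrite -[x]mul1r; apply: ukL.
have [g ag ->] := ax; apply: id_sum => // i _.
suff : colon L (a i) (g i) by rewrite /colon mulrC.
apply: IH (ag i); first exact: colonP.
move=> u v au av; rewrite /colon mulrA; apply: ukL => //.
by rewrite mulrC; apply: isum_mem => //; apply: gpowP.
Qed.

End Ideals.

(** * Lengths at a prime *)

Section Lengths.
Variables (R : comNzRingType) (p : R -> Prop).
Hypothesis pP : is_prime p.
Implicit Types (K L : R -> Prop) (x y z g : R).

(* The localization of R/K at p has length at least n: only strict inclusions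
   that persist after localizing are counted. *)
Fixpoint lenge n K : Prop :=
  if n is n'.+1 then
    exists2 g, (forall s, ~ p s -> ~ K (s * g)) & lenge n' (adj K g)
  else True.

Definition lenle n K := forall k, lenge k K -> (k <= n)%N.

Definition haslen n K := lenge n K /\ lenle n K.

Lemma prime_mul_notin s t : ~ p s -> ~ p t -> ~ p (s * t).
Proof. by case: pP => _ _ pM ps pt /pM[]. Qed.

Lemma lenge_sub n K L : sset K L -> lenge n L -> lenge n K.
Proof.
elim: n K L => //= n IH K L KL [g gL gn]; exists g.
  by move=> s ps /KL; apply: gL.
by apply: IH gn; apply: adj_le.
Qed.

Lemma lenle_sub n K L : sset K L -> lenle n K -> lenle n L.
Proof. by move=> KL Kn k /(lenge_sub KL); apply: Kn. Qed.

(** Lower half of additivity along 0 -> R/(K : y) -> R/K -> R/(K + (y)) -> 0: a chain over K : y is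
    multiplied by y and then continued by a chain over K + (y). *)
Lemma lenge_add a b K y : is_ideal K -> lenge a (colon K y) ->
  lenge b (adj K y) -> lenge (a + b) K.
Proof.
move=> iK; elim: a K iK => [|a IH] K iK /=.
  by move=> _; apply: lenge_sub; apply: sub_adj.
move=> [g gK ga] yb; exists (y * g).
  by move=> s ps Ks; apply: (gK s ps); rewrite /colon mulrCA.
apply: IH; first exact: adjP.
  apply: lenge_sub ga => z [c]; rewrite /colon /adj => Kz; exists c.
  by rewrite mulrBr mulrCA.
apply: lenge_sub yb; apply: adj_min; [exact: adjP| |exact: adj_mem].
apply: adj_min; [exact: adjP|exact: sub_adj|].
by apply: idMr; [apply: adjP|apply: adj_mem].
Qed.

(** Upper half of additivity. Each step g of a chain is charged to one side: if g survives modulo K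
    + (y) it counts there; otherwise s g = h y modulo K for some s outside p, and h is a strict step
    over K : y. *)
Lemma lenge_split l K y : is_ideal K -> lenge l K ->
  exists a b, [/\ (l <= a + b)%N, lenge a (colon K y) & lenge b (adj K y)].
Proof.
elim: l K => [|l IH] K iK /=; first by exists 0%N, 0%N.
move=> [g gK gl]; have [a [b [lab ca cb]]] := IH _ (adjP g iK) gl.
have [gy|] := classic (forall s, ~ p s -> ~ adj K y (s * g)).
  exists a, b.+1; split; first by rewrite addnS.
    by apply: lenge_sub ca => z Kz; apply: sub_adj.
  by exists g => //; rewrite adjC.
move=> gy; have [s sg] := not_all_ex_not _ _ gy.
have [ps gs] := imply_to_and _ _ sg.
have [h Kh] := NNPP _ gs.
exists a.+1, b; split=> //; last first.
  by apply: lenge_sub cb; apply: adj_le; apply: sub_adj.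
exists h.
  move=> t pt; rewrite /colon => Kt; apply: (gK (t * s)).
    exact: prime_mul_notin.
  rewrite -mulrA -[s * g](subrK (h * y)) mulrDr; apply: idD => //.
    exact: idM.
  by rewrite (_ : t * (h * y) = y * (t * h)) //; ring.
apply: lenge_sub ca; apply: adj_min; first by apply: colonP; apply: adjP.
  by move=> z Kz; apply: sub_adj.
by exists s; rewrite -opprB [y * h]mulrC; apply: idN.
Qed.

Lemma lenle_add a b K y : is_ideal K -> lenle a (colon K y) ->
  lenle b (adj K y) -> lenle (a + b) K.
Proof.
move=> iK ca cb k /(lenge_split y iK)[a' [b' [kab /ca aa /cb bb]]].
by apply: leq_trans kab _; apply: leq_add.
Qed.

Lemma haslen_inj n k K : haslen n K -> haslen k K -> n = k.
Proof.
by move=> [n1 n2] [k1 k2]; apply/eqP; rewrite eqn_leq k2 // n2.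
Qed.

Lemma haslen_leq n k K L : sset K L -> haslen n K -> haslen k L -> (k <= n)%N.
Proof. by move=> KL [_ nK] [kL _]; apply: nK; apply: lenge_sub kL. Qed.

Lemma lenle_haslen n K : lenle n K -> exists2 k, haslen k K & (k <= n)%N.
Proof.
elim: n => [|n IH] Kn.
  by exists 0%N => //; split.
have [Kn'|Kn'] := classic (lenge n.+1 K); first by exists n.+1.
have [|k kK kn] := IH; last by exists k => //; apply: leqW.
move=> k kK; have := Kn k kK; rewrite leq_eqVlt => /predU1P[kE|] //.
by case: Kn'; rewrite -kE.
Qed.

Lemma haslen_adj n K y : is_ideal K -> haslen n K ->
  exists a b, [/\ haslen a (colon K y), haslen b (adj K y) & n = (a + b)%N].
Proof.
move=> iK [nK Kn].
have [a aH _] : exists2 k, haslen k (colon K y) & (k <= n)%N.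
  apply: lenle_haslen; apply: lenle_sub Kn => z; exact: (idM iK).
have [b bH _] : exists2 k, haslen k (adj K y) & (k <= n)%N.
  by apply: lenle_haslen; apply: lenle_sub Kn; apply: sub_adj.
exists a, b; split=> //; apply/eqP; rewrite eqn_leq.
have [[aC Ca] [bC Cb]] := (aH, bH).
by rewrite (lenle_add iK Ca Cb nK) (Kn _ (lenge_add iK aC bC)).
Qed.

Lemma lenle_unit K s : is_ideal K -> ~ p s -> K s -> lenle 0 K.
Proof. by move=> iK ps Ks [|k] //= [g /(_ s ps)[]]; apply: idMr. Qed.

Lemma lenge1 K : sset K p -> lenge 1 K.
Proof. by move=> Kp; exists 1 => // s ps; rewrite mulr1 => /Kp. Qed.

Lemma lenle1 K : is_ideal K ->
  (forall g, p g -> exists2 s, ~ p s & K (s * g)) -> lenle 1 K.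
Proof.
move=> iK pK [|[|k]] //= [g gK [h /(_ g)]].
have pg : ~ p g by move=> /pK[s ps]; apply: gK.
by case=> //; exists h; rewrite mulrC subrr; apply: id0.
Qed.

(** The quotients g^i R / g^(i+1) R modulo K are images of R/(K + (g)), so each contributes at most
    c. *)
Lemma lenle_adjX n c K g : is_ideal K -> lenle c (adj K g) ->
  lenle (n * c) (adj K (g ^+ n)).
Proof.
move=> iK Kc; elim: n => [|n IH].
  apply: (@lenle_unit _ 1); first exact: adjP; first by case: pP.
  by exists 1; rewrite expr0 mulr1 subrr; apply: id0.
rewrite mulSn; apply: (@lenle_add _ _ _ (g ^+ n)); first exact: adjP.
  apply: lenle_sub Kc; apply: adj_min.
  - by apply: colonP; apply: adjP.
  - by move=> z Kz; apply: sub_adj; apply: idM.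
  - by rewrite /colon mulrC -exprS; apply: adj_mem.
by apply: lenle_sub IH; apply: adj_le; apply: sub_adj.
Qed.

Lemma lenle_adjlX n c K s : is_ideal K -> lenle c (adjl K s) ->
  lenle (n ^ size s * c) (adjl K [seq g ^+ n | g <- s]).
Proof.
elim: s c K => [|g s IH] c K iK /=; first by rewrite mul1n.
move=> Kc; rewrite adjl_adj expnS -mulnA.
apply: lenle_adjX; first exact: adjlP.
rewrite -adjl_adj; apply: IH Kc; exact: adjP.
Qed.

End Lengths.

(** * Extension of ideals and lengths to polynomial rings *)

Section Extension.
Variables (R : comNzRingType) (n : nat).
Local Notation T := {mpoly R[n]}.
Implicit Types (K L N : R -> Prop) (F G : T).

Definition ext K : T -> Prop := fun F => forall m, K F@_m.

Lemma mcoeff_sumX (s : seq 'X_{1..n}) (h : 'X_{1..n} -> R) k : uniq s ->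
  (\sum_(m <- s) h m *: 'X_[m] : T)@_k = if k \in s then h k else 0.
Proof.
move=> us; rewrite raddf_sum /=; case: ifP => ks.
  rewrite (bigD1_seq k) //= mcoeffZ mcoeffX eqxx mulr1 big1 ?addr0 //.
  by move=> m /negPf mk; rewrite mcoeffZ mcoeffX mk mulr0.
rewrite big_seq big1 // => m ms; rewrite mcoeffZ mcoeffX.
by case: eqP => [mk|_]; [rewrite -mk ms in ks|rewrite mulr0].
Qed.

Lemma extP K : is_ideal K -> is_ideal (ext K).
Proof.
move=> iK; split.
- by move=> m; rewrite mcoeff0; apply: id0.
- by move=> F G KF KG m; rewrite mcoeffD; apply: idD.
- by move=> F G KG m; rewrite mcoeffM; apply: id_sum => // k _; apply: idM.
Qed.

Lemma ext_le K L : sset K L -> sset (ext K) (ext L).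
Proof. by move=> KL F KF m; apply: KL. Qed.

Lemma extC K c : is_ideal K -> ext K c%:MP <-> K c.
Proof.
move=> iK; split=> [/(_ 0%MM)|Kc m].
  by rewrite mcoeffC eqxx mulr1.
by rewrite mcoeffC; apply: idMr.
Qed.

Lemma ext_zero : ext (@zero_ideal R) = @zero_ideal T.
Proof.
apply: sset_eq => F.
  by move=> F0; apply/mpolyP => m; rewrite mcoeff0 F0.
by move=> -> m; rewrite /zero_ideal mcoeff0.
Qed.

Lemma ext_whole : ext (@whole R) = @whole T.
Proof. by apply: sset_eq. Qed.

Lemma ext_colon K c : ext (colon K c) = colon (ext K) c%:MP.
Proof.
by apply: sset_eq => F KF m; move: (KF m); rewrite /colon mcoeffCM.
Qed.

Lemma ext_adj K c : is_ideal K -> ext (adj K c) = adj (ext K) c%:MP.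
Proof.
move=> iK; apply: sset_eq => F.
  move=> /functional_choice[h Kh].
  exists (\sum_(m <- msupp F) h m *: 'X_[m]) => m.
  rewrite mcoeffB mulrC mcoeffCM mcoeff_sumX ?msupp_uniq // mulrC.
  case: ifP => // /negbT mF; rewrite (memN_msupp_eq0 mF) mul0r subr0.
  exact: id0.
move=> [H KH] m; exists H@_m.
by have := KH m; rewrite mcoeffB [H * _]mulrC mcoeffCM mulrC.
Qed.

Lemma ext_adjl s K : is_ideal K -> ext (adjl K s) = adjl (ext K) [seq c%:MP | c <- s].
Proof.
by elim: s K => //= c s IH K iK; rewrite IH ?ext_adj //; apply: adjP.
Qed.

Lemma ext_add K L : is_ideal K -> is_ideal L ->
  ext (ideal_add K L) = ideal_add (ext K) (ext L).
Proof.
move=> iK iL; apply: sset_eq => F.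
  move=> FKL; have {}FKL m : exists x, K x /\ L (F@_m - x).
    by have [x [y [Kx Ly ->]]] := FKL m; exists x; rewrite addrC addKr.
  have [h Fh] := functional_choice _ FKL.
  pose G : T := \sum_(m <- msupp F) h m *: 'X_[m].
  exists G, (F - G); split; last by rewrite addrC subrK.
    move=> m; rewrite mcoeff_sumX ?msupp_uniq //; case: ifP => _.
      by case: (Fh m).
    exact: id0.
  move=> m; rewrite mcoeffB mcoeff_sumX ?msupp_uniq //; case: ifP => mF.
    by case: (Fh m).
  by rewrite (memN_msupp_eq0 (negbT mF)) subr0; apply: id0.
move=> [G [H [KG LH ->]]] m; exists G@_m, H@_m.
by rewrite mcoeffD.
Qed.

Lemma ext_isum r (a : 'I_r -> R) K : is_ideal K ->
  ext (isum a K) = isum (fun i => (a i)%:MP) (ext K).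
Proof.
move=> iK; apply: sset_eq => F.
  move=> FK.
  have {}FK m : exists g : 'I_r -> R,
      (forall i, K (g i)) /\ F@_m = \sum_i g i * a i.
    by have [g Kg e] := FK m; exists g.
  have [h Fh] := functional_choice _ FK.
  exists (fun i => \sum_(m <- msupp F) h m i *: 'X_[m]).
    move=> i m; rewrite mcoeff_sumX ?msupp_uniq //.
    by case: ifP => _; [case: (Fh m)|apply: id0].
  apply/mpolyP => m; rewrite raddf_sum /=.
  case mF: (m \in msupp F).
    rewrite (proj2 (Fh m)); apply: eq_bigr => i _.
    by rewrite [_ * _%:MP]mulrC mcoeffCM mulrC mcoeff_sumX ?msupp_uniq // mF.
  rewrite (memN_msupp_eq0 (negbT mF)) big1 // => i _.
  by rewrite [_ * _%:MP]mulrC mcoeffCM mcoeff_sumX ?msupp_uniq // mF mulr0.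
move=> [G KG ->] m; exists (fun i => (G i)@_m) => [i|]; first exact: KG.
rewrite raddf_sum /=; apply: eq_bigr => i _.
by rewrite [_ * _%:MP]mulrC mcoeffCM mulrC.
Qed.

Lemma ext_gpow r (a : 'I_r -> R) k :
  ext (gpow a k) = gpow (fun i => (a i)%:MP) k.
Proof.
elim: k => [|k IH] /=; first exact: ext_whole.
by rewrite ext_isum ?IH //; apply: gpowP.
Qed.

Lemma ext_nzd K c : nzd K c -> nzd (ext K) c%:MP.
Proof. by move=> Kc F KF m; apply: Kc; have := KF m; rewrite mcoeffCM. Qed.

Lemma ext_regl s K : is_ideal K -> regl K s -> regl (ext K) [seq c%:MP | c <- s].
Proof.
elim: s K => //= c s IH K iK [cK sK]; split; first exact: ext_nzd.
by rewrite -ext_adj //; apply: IH => //; apply: adjP.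
Qed.

(** Deleting the coefficients that lie in K changes F only by an element of the extended ideal and
    exposes a leading coefficient outside K; primality then reduces to leading coefficients. *)
Lemma ext_nontriv K F : is_ideal K -> ~ ext K F ->
  exists G, [/\ ext K (F - G), ~ K (mleadc G) & G != 0].
Proof.
move=> iK nF.
have [h Fh] : exists h : 'X_{1..n} -> R, forall m,
    K F@_m /\ h m = 0 \/ ~ K F@_m /\ h m = F@_m.
  apply: (functional_choice (fun m v => K F@_m /\ v = 0 \/ ~ K F@_m /\ v = F@_m)).
  by move=> m; case: (classic (K F@_m)) => Km; [exists 0; left|exists F@_m; right].
pose G : T := \sum_(m <- msupp F) h m *: 'X_[m].
have FG m : K (F - G)@_m.
  rewrite mcoeffB mcoeff_sumX ?msupp_uniq //.
  case: ifP => mF.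
    by case: (Fh m) => [[KF ->]|[_ ->]]; rewrite ?subr0 ?subrr //; apply: id0.
  by rewrite (memN_msupp_eq0 (negbT mF)) subr0; apply: id0.
have nG : G != 0 by apply/eqP => G0; apply: nF => m; have := FG m; rewrite G0 subr0.
exists G; split=> //.
have := mlead_supp nG; rewrite mcoeff_msupp.
rewrite mcoeff_sumX ?msupp_uniq //; case: ifP; last by rewrite eqxx.
by case: (Fh (mlead G)) => [[_ ->]|[KF ->]] //; rewrite eqxx.
Qed.

Lemma ext_prime p : is_prime p -> is_prime (ext p).
Proof.
move=> [ip p1 pM]; have iP := extP ip; split=> //.
  by rewrite -mpolyC1 extC.
move=> F F' FF'; apply: NNPP => /not_or_and[nF nF'].
have [G [FG nG _]] := ext_nontriv ip nF.
have [G' [FG' nG' _]] := ext_nontriv ip nF'.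
suff GG : ext p (G * G').
  by have := GG (mlead G + mlead G')%MM; rewrite mleadcM => /pM[].
apply: (idBl iP FF').
rewrite (_ : _ - _ = - (G' * (F - G) + F * (F' - G'))); last by ring.
by apply: (idN iP); apply: (idD iP); apply: (idM iP).
Qed.

End Extension.

Section ExtensionLength.
Variables (R : comNzRingType) (n : nat) (p : R -> Prop).
Hypothesis pP : is_prime p.
Local Notation T := {mpoly R[n]}.
Implicit Types (K L : R -> Prop).

Lemma ext_lenge k K : is_ideal K -> lenge p k K -> lenge (@ext R n p) k (ext K).
Proof.
elim: k K => //= k IH K iK [g gK gk]; exists g%:MP; last first.
  by rewrite -ext_adj //; apply: IH => //; apply: adjP.
move=> S pS KS; apply: pS => m; apply: NNPP => pm; apply: (gK _ pm).
by have := KS m; rewrite mulrC mcoeffCM mulrC.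
Qed.

(** Strong induction on k. If some g in p is not killed modulo K by a multiplier outside p, both K :
    g and K + (g) have smaller length and additivity applies. Otherwise K and p agree after
    localizing, and the finitely many coefficients of a polynomial are cleared by one common
    multiplier. *)
Lemma ext_lenle k K : is_ideal K -> lenle p k K -> lenle (@ext R n p) k (ext K).
Proof.
have ePr := ext_prime n pP; have ip : is_ideal p by case: pP.
elim/ltn_ind: k K => k IH K iK Kk.
have [[s ps Ks]|sK] := classic (exists2 s, ~ p s & K s).
  have : lenle (@ext R n p) 0 (ext K).
    apply: (@lenle_unit _ _ _ s%:MP); first exact: extP.
      by rewrite extC.
    exact/extC.
  by move=> K0 j /K0; rewrite leqn0 => /eqP->.
have Kp : sset K p by move=> s Ks; apply: NNPP => ps; apply: sK; exists s.
have [[g pg gK]|gK] := classic (exists2 g, p g & forall s, ~ p s -> ~ K (s * g)).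
  have [c KC] := lenle_haslen Kk.
  have [a [b [aH bH cE]]] := haslen_adj pP g iK KC.
  have a0 : (0 < a)%N.
    apply: (proj2 aH); apply: lenge1 => s; rewrite /colon => Kgs.
    by apply: NNPP => ps; apply: (gK s ps); rewrite mulrC.
  have b0 : (0 < b)%N by apply: (proj2 bH); apply: lenge1; apply: adj_min.
  move=> ck j Kj.
  have abk : (a + b <= k)%N by rewrite -cE.
  have ak : (a < k)%N by rewrite (leq_trans _ abk) // -addn1 leq_add2l.
  have bk : (b < k)%N by rewrite (leq_trans _ abk) // -add1n leq_add2r.
  apply: leq_trans abk.
  suff : lenle (@ext R n p) (a + b) (ext K) by apply.
  apply: (@lenle_add _ _ ePr _ _ _ g%:MP (extP n iK)).
    rewrite -ext_colon; apply: IH => //; first exact: colonP.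
    by case: aH.
  rewrite -ext_adj //; apply: IH => //; first exact: adjP.
  by case: bH.
have k1 : (0 < k)%N by apply: Kk; apply: lenge1.
suff K1 : lenle (@ext R n p) 1 (ext K) by move=> j /K1 j1; apply: leq_trans k1.
apply: lenle1; first exact: extP.
move=> G pG.
have [s ps sG] : exists2 s, ~ p s & forall m, m \in msupp G -> K (s * G@_m).
  elim: (msupp G) => [|m l [s ps sl]]; first by exists 1; case: pP.
  have [t pt tm] : exists2 t, ~ p t & K (t * G@_m).
    apply: NNPP => nt; apply: gK; exists G@_m => // t pt Kt.
    by apply: nt; exists t.
  exists (t * s); first exact: prime_mul_notin.
  move=> m'; rewrite inE => /predU1P[->|/sl Km']; last by rewrite -mulrA; apply: idM.
  by rewrite mulrAC; apply: idMr.
exists s%:MP; first by rewrite extC.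
move=> m; rewrite mcoeffCM; have [|mG] := boolP (m \in msupp G); first exact: sG.
by rewrite (memN_msupp_eq0 mG) mulr0; apply: id0.
Qed.

Lemma ext_haslen k K : is_ideal K -> haslen p k K -> haslen (@ext R n p) k (ext K).
Proof. by move=> iK [Kk kK]; split; [apply: ext_lenge|apply: ext_lenle]. Qed.

End ExtensionLength.

(** * Noetherian rings *)

Lemma noetherian_poly (R : comNzRingType) : noetherian R -> noetherian {poly R}.
Proof.
move=> nR C iC leC.
have leCn n k : (n <= k)%N -> sset (C n) (C k).
  move=> /subnK <-; elim: (k - n)%N => [|j IH] F CF //.
  by rewrite addSn; apply: leC; apply: IH.
pose L n i : R -> Prop := fun c => exists f : {poly R},
  [/\ C n f, (size f <= i.+1)%N & f`_i = c].
have iL n i : is_ideal (L n i).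
  split.
  - by exists 0; rewrite size_poly0 coef0; split=> //; apply: id0.
  - move=> _ _ [f [Cf sf <-]] [g [Cg sg <-]]; exists (f + g); split.
    + exact: idD.
    + by apply: leq_trans (size_polyD _ _) _; rewrite geq_max sf.
    + by rewrite coefD.
  - move=> a _ [f [Cf sf <-]]; exists (a%:P * f); split.
    + exact: idM.
    + by rewrite mul_polyC; apply: leq_trans (size_scale_leq _ _) sf.
    + by rewrite coefCM.
have leL n k i j : (n <= k)%N -> (i <= j)%N -> sset (L n i) (L k j).
  move=> nk ij _ [f [Cf sf <-]]; exists (f * 'X^(j - i)); split.
  - by apply: idMr => //; apply: leCn Cf.
  - have [->|f0] := eqVneq f 0; first by rewrite mul0r size_poly0.
    by rewrite size_mulXn //; lia.
  - by rewrite coefMXn ltnNge leq_subr subKn.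
(* The diagonal chain settles all degrees i >= N at once, since [L n i] lies in [L j j] for j =
   [maxn n i]; only the finitely many degrees below N remain. *)
have [N stabN] : exists N, forall n, (N <= n)%N -> sset (L n n) (L N N).
  by apply: nR => // n; apply: leL.
have [M NM stabM] : exists2 M, (N <= M)%N & forall n i, (i < N)%N -> (M <= n)%N ->
    sset (L n i) (L M i).
  have : forall j, exists2 M, (N <= M)%N & forall n i, (i < j)%N -> (M <= n)%N ->
      sset (L n i) (L M i).
    elim=> [|j [M NM stabM]]; first by exists N.
    have [M' stabM'] : exists M', forall n, (M' <= n)%N -> sset (L n j) (L M' j).
      by apply: nR => // n; apply: leL.
    exists (maxn M M') => [|n i]; first by rewrite leq_max NM.
    rewrite ltnS geq_max leq_eqVlt => ij /andP[Mn M'n] c.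
    case/predU1P: ij => [->|ij].
      by move=> /(stabM' _ M'n); apply: leL => //; rewrite leq_maxr.
    by move=> /(stabM _ _ ij Mn); apply: leL => //; rewrite leq_maxl.
  by move=> /(_ N).
exists M => n Mn f Cf.
have stab i : sset (L n i) (L M i).
  have [iN|Ni] := ltnP i N; first exact: stabM.
  move=> c Lc; apply: (leL N M N i) => //; apply: (stabN (maxn n i)).
    by rewrite leq_max (leq_trans NM Mn).
  by apply: leL Lc; rewrite ?leq_maxl ?leq_maxr.
have : exists k, (size f <= k)%N by exists (size f).
case=> k; elim: k f Cf => [|k IH] f Cf sf.
  by move: sf; rewrite leqn0 size_poly_eq0 => /eqP->; apply: id0.
have [g [Cg sg gk]] : L M k f`_k by apply: stab; exists f.
apply: (idBl (iC M) Cg); apply: IH.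
  by apply: idB => //; apply: leCn Cg.
apply/leq_sizeP => j; rewrite leq_eqVlt => /predU1P[<-|kj].
  by rewrite coefB gk subrr.
by rewrite coefB (leq_sizeP _ _ sf) // (leq_sizeP _ _ sg) // subrr.
Qed.

Lemma noetherian_surj (R S : comNzRingType) (f : {rmorphism R -> S}) :
  (forall y, exists x, f x = y) -> noetherian R -> noetherian S.
Proof.
move=> fS nR C iC leC.
have [n|n x|N CN] := nR (fun n x => C n (f x)).
- split=> [|x y Cx Cy|a x Cx].
  + by rewrite rmorph0; apply: id0.
  + by rewrite rmorphD; apply: idD.
  + by rewrite rmorphM; apply: idM.
- exact: leC.
- exists N => n Nn y; have [x <-] := fS y; exact: CN.
Qed.

Lemma noetherian_mpoly (R : comNzRingType) n : noetherian R -> noetherian {mpoly R[n]}.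
Proof.
move=> nR; elim: n => [|n IH].
  apply: (@noetherian_surj _ _ (@mpolyC 0 R : {rmorphism R -> {mpoly R[0]}})) nR.
  by move=> y; exists (y@_0%MM); symmetry; apply: nvar0_mpolyC.
pose f : {rmorphism {poly {mpoly R[n]}} -> {mpoly R[n.+1]}} :=
  horner_eval 'X_ord_max \o map_poly (@mwiden n R).
apply: (noetherian_surj (f := f)) (noetherian_poly IH).
have fC c : f (c%:MP)%:P = c%:MP.
  by rewrite /f /= map_polyC /= /horner_eval hornerC mwidenC.
have fX i : exists P, f P = 'X_i.
  case: (unliftP ord_max i) => [j ->|->].
    exists ('X_j)%:P; rewrite /f /= map_polyC /= /horner_eval hornerC mwidenX.
    congr 'X_[_]; rewrite mnmwiden1; congr U_(_)%MM; apply: val_inj => /=.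
    by rewrite /bump leqNgt ltn_ord.
  by exists 'X; rewrite /f /= map_polyX /horner_eval hornerX.
have fD p q : (exists P, f P = p) -> (exists P, f P = q) -> exists P, f P = p + q.
  by move=> [P <-] [Q <-]; exists (P + Q); rewrite rmorphD.
have fM p q : (exists P, f P = p) -> (exists P, f P = q) -> exists P, f P = p * q.
  by move=> [P <-] [Q <-]; exists (P * Q); rewrite rmorphM.
apply: (mpolyind (P := fun q => exists P, f P = q)) => [|c m p _ _ pP].
  by exists 0; rewrite rmorph0.
apply: fD => //; rewrite -mul_mpolyC; apply: (fM); first by exists (c%:MP)%:P.
rewrite mpolyXE_id; apply: (big_ind (fun q => exists P, f P = q)) => //.
  by exists 1; rewrite rmorph1.
move=> i _; elim: (m i) => [|k IHk]; first by exists 1; rewrite rmorph1.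
by rewrite exprS; apply: (fM).
Qed.

Section Noetherian.
Variable R : comNzRingType.
Hypothesis nR : noetherian R.
Implicit Types (K L : R -> Prop).

Lemma noetherian_max (P : (R -> Prop) -> Prop) K0 :
  (forall K, P K -> is_ideal K) -> P K0 ->
  exists K, [/\ P K, sset K0 K & forall L, P L -> sset K L -> sset L K].
Proof.
move=> iP PK0; apply: NNPP => nmax.
pose S := {K | P K /\ sset K0 K}.
have next : forall K : S, exists L : S,
    sset (proj1_sig K) (proj1_sig L) /\ ~ sset (proj1_sig L) (proj1_sig K).
  move=> [K [PK K0K]] /=; apply: NNPP => nL; apply: nmax.
  exists K; split=> // L PL KL; apply: NNPP => LK; apply: nL.
  by exists (exist _ L (conj PL (fun x Kx => KL x (K0K x Kx)))).
have [f fP] := functional_choice _ next.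
pose C n := iter n f (exist _ K0 (conj PK0 (fun x Kx => Kx)) : S).
have [|n|N] := nR (C := fun n => proj1_sig (C n)).
- by move=> n; apply: iP; case: (proj2_sig (C n)).
- by case: (fP (C n)).
- by move=> /(_ N.+1 (leqnSn N)); case: (fP (C N)).
Qed.

Lemma adjl_isum (s : seq R) :
  adjl (@zero_ideal R) s = isum (fun i : 'I_(size s) => s`_i) (@whole R).
Proof.
apply: sset_eq => z.
  apply: adjl_min.
  - by apply: isumP; apply: whole_ideal.
  - by move=> x ->; apply: id0; apply: isumP; apply: whole_ideal.
  - move=> x xs; rewrite -(nth_index 0 xs) -[_`_ _]mul1r.
    have si : (index x s < size s)%N by rewrite index_mem.
    exact: (isum_mem (fun i : 'I_(size s) => s`_i) (Ordinal si)
              (@whole_ideal R) (I : whole 1)).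
apply: isum_min; first by apply: adjlP; apply: zero_ideal_ideal.
move=> i y _; apply: idM; first by apply: adjlP; apply: zero_ideal_ideal.
by apply: adjl_mem; [apply: zero_ideal_ideal|rewrite mem_nth].
Qed.

Lemma noetherian_fg K : is_ideal K -> exists s, K = adjl (@zero_ideal R) s.
Proof.
move=> iK.
pose P L := exists2 s : seq R, L = adjl (@zero_ideal R) s & forall x, x \in s -> K x.
have [|//|L [[s -> sK] _ maxL]] := @noetherian_max P (@zero_ideal R).
- by move=> _ [s -> _]; apply: adjlP; apply: zero_ideal_ideal.
- by exists [::].
exists s; apply: sset_eq => x; last first.
  by apply: adjl_min => // y ->; apply: id0.
move=> Kx; apply: (maxL (adjl (@zero_ideal R) (rcons s x))).
- exists (rcons s x) => // y; rewrite mem_rcons inE => /predU1P[->|] //.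
  exact: sK.
- by rewrite adjl_rcons; apply: sub_adj.
- by rewrite adjl_rcons; apply: adj_mem; apply: adjlP; apply: zero_ideal_ideal.
Qed.

Lemma prime_avoiding K (S : R -> Prop) : is_ideal K -> S 1 ->
  (forall s t, S s -> S t -> S (s * t)) -> (forall s, S s -> ~ K s) ->
  exists P, [/\ is_prime P, sset K P & forall s, S s -> ~ P s].
Proof.
move=> iK S1 SM SK.
have [|//|P [[iP SP] KP maxP]] :=
  @noetherian_max (fun L => is_ideal L /\ forall s, S s -> ~ L s) K.
  by move=> L [].
exists P; split=> //; split=> //; first exact: SP.
move=> x y Pxy; apply: NNPP => /not_or_and[Px Py].
have meet z : ~ P z -> exists2 s, S s & adj P z s.
  move=> Pz; apply: NNPP => nS; apply: Pz; apply: (maxP (adj P z)).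
  - split; first exact: adjP.
    by move=> s Ss Ps; apply: nS; exists s.
  - exact: sub_adj.
  - exact: adj_mem.
have [[s Ss [c Pc]] [t St [c' Pc']]] := (meet _ Px, meet _ Py).
apply: (SP _ (SM _ _ Ss St)).
rewrite (_ : s * t = t * (s - c * x) + c * x * (t - c' * y) + c * c' * (x * y)).
  by apply: idD => //; [apply: idD => //|]; apply: idM.
by ring.
Qed.

End Noetherian.

Lemma mpoly_ring_ind (R : comNzRingType) n (Q : {mpoly R[n]} -> Prop) :
  (forall c, Q c%:MP) -> (forall i, Q 'X_i) ->
  (forall F G, Q F -> Q G -> Q (F + G)) -> (forall F G, Q F -> Q G -> Q (F * G)) ->
  forall F, Q F.
Proof.
move=> QC QX QD QM; apply: mpolyind => [|c m p _ _ Qp].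
  by rewrite -mpolyC0; apply: QC.
apply: (QD) => //; rewrite -mul_mpolyC; apply: (QM) => //.
have Q1 : Q 1 by rewrite -mpolyC1; apply: QC.
rewrite mpolyXE_id; apply: big_ind => // i _.
by elim: (m i) => [|k IHk] //; rewrite exprS; apply: (QM).
Qed.

(** * The Rees algebra and stability of filtrations *)

Section Rees.
Variables (R : comNzRingType) (s : nat) (b : 'I_s -> R).

Definition rees : {mpoly R[s]} -> {poly R} :=
  mmap (@polyC R) (fun i => (b i)%:P * 'X).

HB.instance Definition _ := GRing.RMorphism.copy rees
  (mmap (@polyC R) (fun i => (b i)%:P * 'X)).

Lemma reesC c : rees c%:MP = c%:P. Proof. exact: mmapC. Qed.

Lemma reesX i : rees 'X_i = (b i)%:P * 'X.
Proof. by rewrite /rees mmapX mmap1U. Qed.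

Lemma rees_coef F k : gpow b k (rees F)`_k.
Proof.
move: F k; apply: mpoly_ring_ind => [c|i|F G bF bG|F G bF bG] k.
- by rewrite reesC coefC; case: k => //= k; apply: (id0 (gpowP b k.+1)).
- rewrite reesX coefMX coefC; case: k => [|[|k]] //=; first exact: gpow1.
  exact: (id0 (gpowP b k.+2)).
- by rewrite rmorphD coefD; apply: idD => //; apply: gpowP.
- rewrite rmorphM coefM; apply: id_sum => [|i _]; first exact: gpowP.
  by rewrite -{1}(subnKC (ltn_ord i : i <= k)%N); apply: gpowM.
Qed.

Lemma rees_lift k u : gpow b k u -> exists F, rees F = u%:P * 'X^k.
Proof.
elim: k u => [|k IH] u /=; first by exists u%:MP; rewrite reesC mulr1.
move=> [g bg ->].
have [h hE] := functional_choice _ (fun i => IH _ (bg i)).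
exists (\sum_i h i * 'X_i); rewrite rmorph_sum rmorph_sum mulr_suml.
apply: eq_bigr => i _; rewrite rmorphM /= hE reesX rmorphM exprSr.
by rewrite mulrACA.
Qed.

End Rees.

Section FiniteGeneration.
Variables (R : comNzRingType) (s : nat) (b : 'I_s -> R) (N : R -> Prop).
Hypotheses (nR : noetherian R) (iN : is_ideal N).
Implicit Types (K L : R -> Prop).

Fixpoint up K j : R -> Prop :=
  if j is j'.+1 then ideal_add (isum b (up K j')) N else K.

Lemma upP K j : is_ideal K -> is_ideal (up K j).
Proof.
by elim: j K => //= j IH K iK; apply: ideal_addP => //; apply: isumP; apply: IH.
Qed.

Lemma up_le K L j : sset K L -> sset (up K j) (up L j).
Proof.
elim: j => //= j IH KL; apply: ideal_add_le => //; apply: isum_le; exact: IH.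
Qed.

Lemma upS K j : up K j.+1 = up (up K 1) j.
Proof. by elim: j => //= j <-. Qed.

(* The ideals of R[X] whose degree-k part maps into M k for k <= q, and into the
   submodule generated by M q for k > q, form an increasing chain. *)
Lemma rees_module_stable (M : nat -> R -> Prop) :
  (forall q, is_ideal (M q)) -> (forall q, sset N (M q)) ->
  (forall q, sset (M q) (ideal_add (gpow b q) N)) ->
  (forall q j z, M q z -> M q.+1 (z * b j)) ->
  exists q0, forall q, (q0 <= q)%N -> sset (M q.+1) (ideal_add (isum b (M q)) N).
Proof.
move=> iM NM MJ bM.
have upM q : sset (up (M q) 1) (M q.+1).
  by apply: ideal_add_sub => //; apply: isum_min => // j z; apply: bM.
pose W q k := if (k <= q)%N then M k else up (M q) (k - q).
have iW q k : is_ideal (W q k) by rewrite /W; case: ifP => // _; apply: upP.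
have WS q k : sset (isum b (W q k)) (W q k.+1).
  rewrite /W; case: (ltngtP k q) => kq.
  - by apply: isum_min => // j z; apply: bM.
  - by move=> z bz; rewrite subSn ?(ltnW kq) //=; apply: ideal_addl.
  - by rewrite kq subSnn; move=> z bz /=; apply: ideal_addl.
have WM q k j z u : W q k z -> gpow b j u -> W q (k + j)%N (z * u).
  move=> Wz; elim: j u => [|j IH] u /=; first by move=> _; rewrite addn0; apply: idMr.
  move=> [g bg ->]; rewrite addnS; apply: WS; exists (fun i => z * g i) => [i|].
    exact: IH.
  by rewrite mulr_sumr; apply: eq_bigr => i _; rewrite mulrA.
have Wq q k : sset (W q k) (W q.+1 k).
  rewrite /W; case: (ltngtP k q.+1) => [|qk|->].
  - by rewrite ltnS => ->.
  - rewrite leqNgt (ltnW qk) /= -(subnSK (ltnW qk)) upS.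
    exact: up_le.
  - by rewrite ltnn subSnn.
pose P q (F : {mpoly R[s]}) := forall k, W q k (rees b F)`_k.
have [q|q F PF k|Q stab] := @noetherian_mpoly _ s nR P.
- split=> [k|F G PF PG k|F G PG k].
  + by rewrite rmorph0 coef0; apply: id0.
  + by rewrite rmorphD coefD; apply: idD.
  + rewrite rmorphM coefMr; apply: id_sum => // i _.
    rewrite mulrC -{1}(subnKC (ltn_ord i : i <= k)%N).
    by apply: WM => //; apply: rees_coef.
- exact: Wq.
have leP q q' : (q <= q')%N -> sset (P q) (P q').
  move=> /subnK <-; elim: (q' - q)%N => [|j IH] F PF //.
  by rewrite addSn => k; apply: Wq; apply: IH.
exists Q => q Qq g Mg; have [u [v [bu Nv gE]]] := MJ _ _ Mg.
have Mu : M q.+1 u by rewrite -[u](addrK v) -gE; apply: idB => //; apply: NM.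
have [F FE] := rees_lift bu.
have PF : P q.+1 F.
  move=> k; rewrite FE coefCM coefXn; case: eqP => [->|_] /=.
    by rewrite mulr1 /W leqnn.
  by rewrite mulr0; apply: id0.
(* F lies in the ideal of index q + 1, hence by stability in that of index Q and so in that of index
   q, whose part of degree q + 1 is b M_q + N. *)
have := leP _ _ Qq _ (stab _ (leqW Qq) _ PF) q.+1.
rewrite FE coefCM coefXn eqxx mulr1 /W ltnn subSnn gE => Wu.
have iU : is_ideal (ideal_add (isum b (M q)) N).
  by apply: ideal_addP => //; apply: isumP.
by apply: (idD iU) => //; apply: ideal_addr => //; apply: isumP.
Qed.

End FiniteGeneration.

Section Filtration.
Variables (R : comNzRingType) (s : nat) (b : 'I_s -> R) (N : R -> Prop).
Hypothesis (iN : is_ideal N).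

Definition fil n : R -> Prop := ideal_add (gpow b n) N.

Lemma filP n : is_ideal (fil n).
Proof. by apply: ideal_addP => //; apply: gpowP. Qed.

Lemma gpow_fil n : sset (gpow b n) (fil n).
Proof. exact: ideal_addl. Qed.

Lemma sub_fil n : sset N (fil n).
Proof. by apply: ideal_addr; apply: gpowP. Qed.

Lemma fil_le n k : (n <= k)%N -> sset (fil k) (fil n).
Proof. by move=> nk; apply: ideal_add_le => //; apply: gpow_le. Qed.

Lemma filM n k x y : fil n x -> fil k y -> fil (n + k) (x * y).
Proof.
move=> [u [v [bu Nv ->]]] [u' [v' [bu' Nv' ->]]].
exists (u * u'), (u * v' + v * (u' + v')); split; last by ring.
  exact: gpowM.
by apply: idD => //; [apply: idM|apply: idMr].
Qed.

Lemma filX n k x : fil n x -> fil (n * k) (x ^+ k).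
Proof.
move=> bx; elim: k => [|k IH]; last by rewrite exprS mulnS; apply: filM.
by rewrite muln0; apply: gpow_fil.
Qed.

End Filtration.

(** * Ratliff-Rush closure and generic elements *)

Section RatliffRush.
Variables (R : comNzRingType) (r s : nat) (a : 'I_r -> R) (b : 'I_s -> R).
Variable N : R -> Prop.
Hypotheses (nR : noetherian R) (iN : is_ideal N).

(** Multiplication by u embeds the colon ideals Q_n = (b^n + N) : b as a filtration inside b^n + N,
    so [rees_module_stable] applies: for f in Q_(n+1) one gets u f = sum_i u h_i b_i modulo N with
    h_i in Q_n. Cancelling u puts f in b Q_n + N, which lies in b^n + N. *)
Lemma ratliff_rush1 u : gpow b 1 u -> nzd N u -> exists n0, forall n, (n0 <= n)%N ->
  forall f, (forall i, fil b N n.+1 (f * b i)) -> fil b N n f.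
Proof.
move=> [c _ uE] uN.
pose Q n f := forall i, fil b N n (f * b i).
have iQ n : is_ideal (Q n).
  split=> [i|f g Qf Qg i|e f Qf i]; have iF := filP b iN n.
  - by rewrite mul0r; apply: id0.
  - by rewrite mulrDl; apply: idD.
  - by rewrite -mulrA; apply: idM.
pose M n g := exists2 f, Q n f & N (g - u * f).
have [n|n z Nz|n g [f Qf Nf]|n j z [f Qf Nf]|n0 stab] :=
  @rees_module_stable _ _ b _ nR iN M.
- split.
  + by exists 0; [apply: (id0 (iQ n))|rewrite mulr0 subr0; apply: id0].
  + move=> g g' [f Qf Nf] [f' Qf' Nf']; exists (f + f'); first exact: (idD (iQ n)).
    by rewrite mulrDr opprD addrACA; apply: idD.
  + move=> e g [f Qf Nf]; exists (e * f); first exact: (idM (iQ n)).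
    by rewrite mulrCA -mulrBr; apply: idM.
- by exists 0; [apply: (id0 (iQ n))|rewrite mulr0 subr0].
- apply: (idBl (filP b iN n)) (sub_fil b n Nf).
  rewrite uE mulr_suml; apply: id_sum; first exact: filP.
  by move=> i _; rewrite mulrAC -mulrA; apply: idM; [apply: filP|apply: Qf].
- exists (f * b j); last by rewrite mulrA -mulrBl; apply: idMr.
  move=> i; rewrite mulrAC -addn1; apply: filM => //.
  by apply: gpow_fil => //; apply: gpow1.
exists n0 => n nn f Qf.
have [_ [v [[g Mg ->] Nv fE]]] : ideal_add (isum b (M n)) N (u * f).
  by apply: stab => //; exists f => //; rewrite subrr; apply: id0.
have [h hP] : exists h : 'I_s -> R, forall i, Q n (h i) /\ N (g i - u * h i).
  by apply: (functional_choice (fun i h => Q n h /\ N (g i - u * h))) => i;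
    have [h Qh Nh] := Mg i; exists h.
have : N (f - \sum_i h i * b i).
  apply: uN; rewrite mulrBr fE mulr_sumr addrAC -sumrB.
  apply: idD => //; apply: id_sum => // i _.
  by rewrite mulrA -mulrBl; apply: idMr => //; case: (hP i).
move=> Nf; apply: (idBl (filP b iN n)) (sub_fil b n Nf).
apply: id_sum; first exact: filP.
by move=> i _; case: (hP i) => /(_ i).
Qed.

Definition reduces c := forall n, (c <= n)%N -> sset (gpow b n.+1) (isum a (gpow b n)).

Lemma reduces_ind c E z L : reduces c -> is_ideal L ->
  (forall u v, gpow a E u -> gpow b c v -> L (u * v)) -> gpow b (c + E) z -> L z.
Proof.
move=> rc; elim: E z L => [|E IH] z L iL uvL.
  by rewrite addn0 => bz; rewrite -[z]mul1r; apply: uvL.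
rewrite addnS => /(rc _ (leq_addr _ _))[g bg ->]; apply: id_sum => // i _.
suff : colon L (a i) (g i) by rewrite /colon mulrC.
apply: IH (bg i); first exact: colonP.
move=> u v au bv; rewrite /colon mulrA; apply: uvL => //.
by rewrite mulrC; apply: isum_mem => //; apply: gpowP.
Qed.

(** Only multiples by powers of a need to be tested, because b^(c+E) is contained in a^E b^c. *)
Lemma ratliff_rush c u : gpow b 1 u -> nzd N u -> reduces c ->
  exists n0, forall n E f, (n0 <= n)%N ->
  (forall v, gpow a E v -> fil b N (n + E) (f * v)) -> fil b N n f.
Proof.
move=> bu uN rc; have [n0 rr] := ratliff_rush1 bu uN.
have rrE n E f : (n0 <= n)%N ->
    (forall v, gpow b E v -> fil b N (n + E) (f * v)) -> fil b N n f.
  move=> nn; elim: E => [|E IH] fv.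
    by rewrite -[f]mulr1 -[n]addn0; apply: fv.
  apply: IH => v bv; apply: rr => [|i]; first exact: leq_trans (leq_addr _ _).
  rewrite -addnS -mulrA; apply: fv; apply: isum_mem => //; exact: gpowP.
exists n0 => n E f nn fv; apply: (rrE n (c + E)) => // z bz.
suff : colon (fil b N (n + (c + E))) f z by [].
apply: reduces_ind rc _ _ bz; first by apply: colonP; apply: filP.
move=> w v aw bv; rewrite /colon mulrA [(c + E)%N]addnC addnA.
by apply: filM => //; [apply: fv|apply: gpow_fil].
Qed.

End RatliffRush.

Section Monomials.
Variables (R : comNzRingType) (r : nat) (a : 'I_r -> R).

Lemma mmap1D (m1 m2 : 'X_{1..r}) : mmap1 a (m1 + m2)%MM = mmap1 a m1 * mmap1 a m2.
Proof.
by rewrite /mmap1 -big_split; apply: eq_bigr => i _; rewrite mnmDE exprD.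
Qed.

Lemma gpow_monomial (m : 'X_{1..r}) : gpow a (mdeg m) (mmap1 a m).
Proof.
rewrite /mmap1 mdegE; apply: (big_ind2 (fun x n => gpow a n x)) => //.
  by move=> x n y k; apply: gpowM.
by move=> i _; have := gpowX (m i) (gpow1 a i); rewrite mul1n.
Qed.

Lemma gpow_monomial_ind E L z : is_ideal L ->
  (forall m : 'X_{1..r}, mdeg m = E -> L (mmap1 a m)) -> gpow a E z -> L z.
Proof.
elim: E z L => [|E IH] z L iL mL.
  move=> _; rewrite -[z]mulr1; apply: idM => //.
  by rewrite -(mmap11 a); apply: mL; rewrite mdeg0.
move=> [g ag ->]; apply: id_sum => // i _.
suff : colon L (a i) (g i) by rewrite /colon mulrC.
apply: IH (ag i); first exact: colonP.
move=> m mE; rewrite /colon -(mmap1U a i) -mmap1D; apply: mL.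
by rewrite mdegD mdeg1 mE.
Qed.

Definition graded (K : nat -> R -> Prop) :=
  (forall q, is_ideal (K q)) /\ (forall q i z, K q z -> K q.+1 (z * a i)).

Lemma gradedM K q j z v : graded K -> K q z -> gpow a j v -> K (q + j)%N (z * v).
Proof.
move=> [iK aK] Kz; elim: j v => [|j IH] v /=.
  by move=> _; rewrite addn0; apply: idMr.
move=> [g ag ->]; rewrite mulr_sumr addnS; apply: id_sum => // i _.
by rewrite mulrA; apply: aK; apply: IH.
Qed.

(** A monomial of degree r D + 1 in r variables is divisible by the D-th power of one of them. *)
Lemma graded_pigeonhole K n D f v : graded K ->
  (forall l, K (n + D)%N (f * a l ^+ D)) -> gpow a (r * D).+1 v ->
  K (n + (r * D).+1)%N (f * v).
Proof.
move=> gK fD av; have [iK _] := gK.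
suff : colon (K (n + (r * D).+1)%N) f v by [].
apply: gpow_monomial_ind av; first exact: colonP.
move=> m mE; rewrite /colon.
have [l Dl] : exists l, (D <= m l)%N.
  apply: NNPP => nl; have : (mdeg m <= r * D)%N.
    rewrite mdegE -[r in X in (_ <= X)%N]card_ord -sum_nat_const; apply: leq_sum => i _.
    by apply: ltnW; rewrite ltnNge; apply/negP => Di; apply: nl; exists i.
  by rewrite mE ltnn.
have mD : m = (U_(l) *+ D + (m - U_(l) *+ D))%MM.
  rewrite addmC submK //; apply/mnm_lepP => i; rewrite mulmnE mnm1E.
  by case: eqP => [<-|_]; rewrite ?mul1n ?mul0n.
have am : mmap1 a (U_(l) *+ D)%MM = a l ^+ D.
  rewrite /mmap1 (bigD1 l) //= mulmnE mnm1E eqxx mul1n big1 ?mulr1 // => i li.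
  by rewrite mulmnE mnm1E eq_sym (negPf li).
rewrite mD mmap1D am mulrA.
have -> : (r * D).+1 = (D + mdeg (m - U_(l) *+ D)%MM)%N.
  by rewrite -mE {1}mD mdegD mdegMn mdeg1 mul1n.
by rewrite addnA; apply: gradedM => //; apply: gpow_monomial.
Qed.

End Monomials.

Lemma fil_graded (R : comNzRingType) r s (a : 'I_r -> R) (b : 'I_s -> R) N :
  is_ideal N -> (forall i, gpow b 1 (a i)) -> graded a (fil b N).
Proof.
move=> iN ab; split=> [q|q i z bz]; first exact: filP.
by rewrite -addn1; apply: filM => //; apply: gpow_fil.
Qed.

Section Generic.
Variables (R : comNzRingType) (r : nat) (a : 'I_r -> R).
Local Notation T := {mpoly R[r]}.

Definition gx : T := \sum_i (a i)%:MP * 'X_i.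

Lemma mcoeffMXU (F : T) i k :
  (F * 'X_i)@_k = if k i == 0%N then 0 else F@_(k - U_(i))%MM.
Proof.
case: eqP => [ki|/eqP ki]; last first.
  by rewrite -{1}(submK (_ : (U_(i) <= k)%MM)) ?lep1mP // addmC mcoeffMX.
apply: memN_msupp_eq0; rewrite (perm_mem (msuppMX F U_(i)%MM)).
apply/negP => /mapP[k' _ kE]; move: ki.
by rewrite kE mnmDE mnm1E eqxx.
Qed.

Lemma mcoeff_gx (F : T) k :
  (gx * F)@_k = \sum_i a i * (if k i == 0%N then 0 else F@_(k - U_(i))%MM).
Proof.
rewrite /gx mulr_suml raddf_sum /=; apply: eq_bigr => i _.
by rewrite -mulrA mcoeffCM [_ * F]mulrC mcoeffMXU.
Qed.

(** Descending induction on the exponent of z_l, in the manner of Dedekind-Mertens. The coefficient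
    of [gx * F] at m' + U_l is a_l F_(m') plus terms whose F-coefficients have a larger
    z_l-exponent; beyond [msize F] all coefficients vanish. Each step costs one factor a_l and gains
    one degree of K. *)
Lemma gx_coef_pow K n (F : T) l m : graded a K -> ext (K n.+1) (gx * F) ->
  K (n + msize F)%N (F@_m * a l ^+ msize F).
Proof.
move=> gK xF; have [iK aK] := gK.
suff H e (m' : 'X_{1..r}) : (msize F <= m' l + e)%N -> K (n + e)%N (F@_m' * a l ^+ e).
  by apply: H; rewrite leq_addl.
elim: e m' => [|e IH] m' le.
  rewrite (memN_msupp_eq0 (_ : m' \notin msupp F)) ?mul0r; first exact: id0.
  apply: msize_mdeg_ge; rewrite addn0 in le; apply: leq_trans le _.
  by rewrite mdegE (bigD1 l) //= leq_addr.
have := xF (m' + U_(l))%MM; rewrite mcoeff_gx (bigD1 l) //= mnmDE mnm1E eqxx.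
rewrite addn1 /= addmK; set S := (X in _ + X) => Kc.
have KS : K (n + e.+1)%N (S * a l ^+ e).
  rewrite /S mulr_suml; apply: id_sum => // i il; case: ifP => _.
    by rewrite mulr0 mul0r; apply: id0.
  rewrite mulrAC -mulrA mulrC addnS; apply: (aK); rewrite mulrC; apply: IH.
  by rewrite mnmBE mnmDE !mnm1E eqxx (negPf il) subn0 addn1 addSnnS.
have KSc : K (n + e.+1)%N ((a l * F@_m' + S) * a l ^+ e).
  rewrite addnS -addSn; apply: (gradedM gK) => //.
  by have := gpowX e (gpow1 a l); rewrite mul1n.
rewrite exprS mulrCA mulrA; apply: (idDl (iK _) KS).
by rewrite addrC -mulrDl.
Qed.

Lemma gx_coef K n (F : T) m v : graded a K -> ext (K n.+1) (gx * F) ->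
  gpow a (r * msize F).+1 v -> K (n + (r * msize F).+1)%N (F@_m * v).
Proof.
by move=> gK xF; apply: graded_pigeonhole => // l; apply: gx_coef_pow.
Qed.

(** The coefficient bound applied to the constant filtration N: a power of u multiplies each
    coefficient of F into N and can be cancelled. *)
Lemma gx_nzd N u : is_ideal N -> gpow a 1 u -> nzd N u -> nzd (ext N) gx.
Proof.
move=> iN au uN F xF m.
have gN : graded a (fun=> N) by split=> // q i z Nz; apply: idMr.
apply: (nzdX (n := (r * msize F).+1) uN); rewrite mulrC.
apply: (gx_coef (n := 0) m gN) => //.
by have := gpowX (r * msize F).+1 au; rewrite mul1n.
Qed.

End Generic.

(** * Asymptotic normality *)

Section AlmostIntegral.
Variables (R : comNzRingType) (s : nat) (b : 'I_s -> R) (N : R -> Prop).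
Hypothesis iN : is_ideal N.

Definition almost n c f := forall i u, gpow b c u -> fil b N (n * i) (u * f ^+ i).

(* Closedness of J^n + N under almost integrality over J^n modulo N: a form of
   integral closedness that passes to polynomial rings coefficientwise. *)
Definition almost_closed n := forall c f, almost n c f -> fil b N n f.

Lemma almostB n c f g : almost n c f -> fil b N n g -> almost n c (f - g).
Proof.
move=> fc gn i u bu; rewrite exprDn mulr_sumr; apply: id_sum; first exact: filP.
move=> j _; rewrite mulrnAr -mulr_natl.
apply: idM; first exact: filP.
rewrite mulrA -{1}(subnK (ltn_ord j : j <= i)%N) mulnDr; apply: filM => //.
  exact: fc.
by apply: filX => //; apply: idN => //; apply: filP.
Qed.

End AlmostIntegral.

Section DefsIdeals.
Variable R : comNzRingType.
Implicit Types (K L : R -> Prop).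

Lemma ideal_mulP K L : is_ideal L -> is_ideal (ideal_mul K L).
Proof.
move=> iL; split.
- by exists 0%N, (fun=> 0), (fun=> 0); rewrite big_ord0.
- move=> _ _ [k [x [y [xy ->]]]] [l [x' [y' [xy' ->]]]].
  exists (k + l)%N, (fun i => if (i < k)%N then x i else x' (i - k)%N),
    (fun i => if (i < k)%N then y i else y' (i - k)%N); split.
    by move=> i ikl; case: ltnP => [/xy //|ki]; apply: xy'; lia.
  rewrite big_split_ord /=; congr (_ + _); apply: eq_bigr => i _.
    by rewrite ltn_ord.
  by rewrite ltnNge leq_addr addKn.
- move=> a _ [k [x [y [xy ->]]]]; exists k, x, (fun i => a * y i); split.
    by move=> i /xy[Kx Ly]; split=> //; apply: idM.
  by rewrite mulr_sumr; apply: eq_bigr => i _; rewrite mulrCA.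
Qed.

Lemma ideal_mul_mem K L x y : K x -> L y -> ideal_mul K L (x * y).
Proof.
by move=> Kx Ly; exists 1%N, (fun=> x), (fun=> y); rewrite big_ord1.
Qed.

Lemma ideal_mul_min K L M : is_ideal M -> (forall x y, K x -> L y -> M (x * y)) ->
  sset (ideal_mul K L) M.
Proof.
move=> iM KL _ [k [x [y [xy ->]]]]; apply: id_sum => // i _.
by case: (xy i (ltn_ord i)); apply: KL.
Qed.

Lemma ideal_powP K n : is_ideal (ideal_pow K n).
Proof. by elim: n => [|n IH]; [apply: whole_ideal|apply: ideal_mulP]. Qed.

Lemma ideal_pow_gpow s (b : 'I_s -> R) n : ideal_pow (gpow b 1) n = gpow b n.
Proof.
elim: n => //= n IH; apply: sset_eq.
  apply: ideal_mul_min => [|x y bx by_]; first by apply: (gpowP b n.+1).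
  by apply: (gpowM (n := 1)) => //; rewrite -IH.
apply: isum_min => [|i z bz]; first by apply: ideal_mulP; apply: ideal_powP.
by rewrite mulrC; apply: ideal_mul_mem; [apply: gpow1|rewrite IH].
Qed.

Lemma gpow_ideal_pow s (b : 'I_s -> R) n k :
  sset (gpow b (n * k)) (ideal_pow (gpow b n) k).
Proof.
elim: k => [|k IH] //=; rewrite mulnS => x.
apply: gpow_add_ind; first by apply: ideal_mulP; apply: ideal_powP.
by move=> u v bu bv; apply: ideal_mul_mem => //; apply: IH.
Qed.

End DefsIdeals.

Section NormalAlmostClosed.
Variables (R : comNzRingType) (s : nat) (b : 'I_s -> R).
Hypothesis nR : noetherian R.

(* The ideals E q are the graded pieces of the Rees algebra with f adjoined in
   degree n; they are stable by [rees_module_stable], and stability in degree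
   n * (k + 1) is an equation of integral dependence. *)
Lemma integrally_closed_almost n u : (0 < n)%N -> gpow b 1 u ->
  nzd (@zero_ideal R) u -> integrally_closed (gpow b n) ->
  almost_closed b (@zero_ideal R) n.
Proof.
move=> n0 bu u0 clos c f fc; have i0 := @zero_ideal_ideal R.
apply: gpow_fil => //; apply: clos.
have {}fc i v : gpow b c v -> gpow b (n * i) (v * f ^+ i).
  by move=> /(fc i)[x [y [bx -> ->]]]; rewrite addr0.
pose w := u ^+ c.
have bw : gpow b c w by have := gpowX c bu; rewrite mul1n.
have w0 : nzd (@zero_ideal R) w by apply: nzdX.
(* The vanishing clause is essential: for q < n i the truncated difference is 0 and would leave g_i
   arbitrary. *)
pose E q z := exists g : nat -> R,
  (forall i, gpow b (q - n * i) (g i) /\ ((q < n * i)%N -> g i = 0)) /\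
  z = \sum_(i < q.+1) g i * f ^+ i.
have iE q : is_ideal (E q).
  split.
  - exists (fun=> 0); split=> [i|]; first by split=> //; apply: id0; apply: gpowP.
    by rewrite big1 // => i _; rewrite mul0r.
  - move=> _ _ [g [gE ->]] [h [hE ->]]; exists (fun i => g i + h i); split=> [i|].
      have [[bg g0] [bh h0]] := (gE i, hE i); split=> [|qi].
        by apply: idD => //; apply: gpowP.
      by rewrite g0 // h0 // addr0.
    by rewrite -big_split; apply: eq_bigr => i _; rewrite mulrDl.
  - move=> e _ [g [gE ->]]; exists (fun i => e * g i); split=> [i|].
      have [bg g0] := gE i; split=> [|qi]; last by rewrite g0 // mulr0.
      by apply: idM => //; apply: gpowP.
    by rewrite mulr_sumr; apply: eq_bigr => i _; rewrite mulrA.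
(* E_q itself need not lie in b^q; multiplying by the nonzerodivisor w = u^c brings it there by
   almost integrality, and [stabE] cancels w again. *)
pose M q z := exists2 y, E q y & z = w * y.
have [q|q _ ->|q _ [_ [g [gE ->]] ->]|q j _ [_ [g [gE ->]] ->]|q0 stab] :=
  @rees_module_stable _ _ b _ nR i0 M.
- split.
  + by exists 0; [apply: (id0 (iE q))|rewrite mulr0].
  + move=> _ _ [y Ey ->] [z Ez ->]; exists (y + z); first exact: (idD (iE q)).
    by rewrite mulrDr.
  + move=> e _ [y Ey ->]; exists (e * y); first exact: (idM (iE q)).
    by rewrite mulrCA.
- by exists 0; [apply: (id0 (iE q))|rewrite mulr0].
- apply: gpow_fil => //; rewrite mulr_sumr; apply: id_sum; first exact: gpowP.
  move=> i _; have [bg g0] := gE i; case: (ltnP q (n * i)) => qi.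
    by rewrite g0 // mul0r mulr0; apply: id0; apply: gpowP.
  by rewrite mulrCA; have := gpowM bg (fc i w bw); rewrite subnK.
- exists ((\sum_(i < q.+1) g i * f ^+ i) * b j); last by rewrite mulrA.
  exists (fun i => g i * b j); split=> [i|].
    have [bg g0] := gE i; split=> [|qi]; last by rewrite g0 ?mul0r // ltnW.
    have [qi|qi] := leqP (n * i) q; last by rewrite g0 // mul0r; apply: id0; apply: gpowP.
    by rewrite subSn //; apply: isum_mem => //; apply: gpowP.
  rewrite [RHS]big_ord_recr /= (proj2 (gE q.+1)) ?mul0r ?addr0.
    by rewrite mulr_suml; apply: eq_bigr => i _; rewrite mulrAC.
  by rewrite leq_pmull.
have stabE q z : (q0 <= q)%N -> E q.+1 z -> isum b (E q) z.
  move=> qq Ez; have [_ [_ [[g Mg ->] -> zE]]] :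
      ideal_add (isum b (M q)) (@zero_ideal R) (w * z) by apply: stab => //; exists z.
  have [h hP] : exists h : 'I_s -> R, forall i, E q (h i) /\ g i = w * h i.
    apply: (functional_choice (fun i h => E q h /\ g i = w * h)) => i.
    by have [h] := Mg i; exists h.
  exists h => [i|]; first by case: (hP i).
  apply/eqP; rewrite -subr_eq0; apply/eqP; apply: w0; apply/eqP.
  rewrite mulrBr zE addr0 subr_eq0 mulr_sumr; apply/eqP.
  by apply: eq_bigr => i _; rewrite (proj2 (hP i)) mulrA.
(* In degree n q0 only the powers f^0, ..., f^q0 occur, and every higher degree arises from it by
   multiplication with b. In degree n q0 + n this expresses f^(q0+1) through lower powers of f, with
   i-th coefficient in b^(n (q0 + 1 - i)). *)
pose B t z := exists g : nat -> R,
  (forall i, (i <= q0)%N -> gpow b (n * q0 + t - n * i) (g i)) /\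
  z = \sum_(i < q0.+1) g i * f ^+ i.
have EB t : sset (E (n * q0 + t)%N) (B t).
  elim: t => [|t IH] z.
    move=> [g [gE ->]]; exists g; split=> [i _|]; first by case: (gE i).
    rewrite addn0 [RHS](big_ord_widen (n * q0).+1 (fun i => g i * f ^+ i)); last first.
      by have := leq_pmull q0 n0; lia.
    rewrite [RHS]big_mkcond; apply: eq_bigr => i _; case: ltnP => // qi.
    by rewrite (proj2 (gE i)) ?mul0r // addn0 ltn_pmul2l.
  rewrite addnS => /stabE[|h Eh ->].
    by have := leq_pmull q0 n0; lia.
  have [g gP] := functional_choice _ (fun j => IH _ (Eh j)).
  exists (fun i => \sum_j g j i * b j); split=> [i iq|].
    rewrite addnS subSn; last by rewrite (leq_trans _ (leq_addr _ _)) // leq_mul.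
    by exists (fun j => g j i) => // j; case: (gP j) => /(_ i iq).
  under [RHS]eq_bigr do rewrite mulr_suml.
  rewrite exchange_big /=; apply: eq_bigr => j _.
  rewrite (proj2 (gP j)) mulr_suml; apply: eq_bigr => i _.
  by rewrite mulrAC.
have [g [gP gE]] : B n (f ^+ q0.+1).
  apply: EB; exists (fun i => if i == q0.+1 then 1 else 0); split=> [i|].
    case: eqP => [->|_]; last by split=> //; apply: id0; apply: gpowP.
    by rewrite -mulnSr subnn ltnn.
  have qn : (q0.+1 < (n * q0 + n).+1)%N by rewrite ltnS -mulnSr leq_pmull.
  rewrite (bigD1 (Ordinal qn)) //= eqxx mul1r big1 ?addr0 // => i iq.
  by rewrite (_ : (i == q0.+1 :> nat) = false) ?mul0r //; apply/negbTE.
exists q0.+1, (fun i => - g (q0.+1 - i)%N); split=> //; split.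
  move=> i /andP[i0' iq]; apply: gpow_ideal_pow; apply: idN; first exact: gpowP.
  have := gP (q0.+1 - i)%N; rewrite -mulnSr -mulnBr subKn //; apply; lia.
rewrite gE big_add1 /= big_mkord (reindex_inj rev_ord_inj) /= -big_split /=.
by rewrite big1 // => i _; rewrite mulNr subrr.
Qed.

End NormalAlmostClosed.

Section PolynomialExtension.
Variables (R : comNzRingType) (s r : nat) (b : 'I_s -> R) (N : R -> Prop).
Hypothesis iN : is_ideal N.
Local Notation T := {mpoly R[r]}.
Local Notation bT := (fun i => (b i)%:MP : T).

Lemma ext_fil n : ext (fil b N n) = fil bT (ext N) n.
Proof. by rewrite /fil ext_add ?ext_gpow //; apply: gpowP. Qed.

Lemma almost_const (N' : T -> Prop) n c (F : T) : is_ideal N' ->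
  (forall i u, gpow b c u -> fil bT N' (n * i) (u%:MP * F ^+ i)) ->
  almost bT N' n c F.
Proof.
move=> iN' H i u; rewrite -ext_gpow => bu.
rewrite [u]mpolyE mulr_suml; apply: id_sum => [|m _]; first exact: filP.
rewrite -mul_mpolyC mulrAC; apply: idMr; first exact: filP.
exact: H.
Qed.

(** The leading coefficient of u F^i is u times the i-th power of that of F, so leading coefficients
    inherit almost integrality. The leading term can then be subtracted; induction on the number of
    monomials. *)
Lemma ext_almost_closed n : almost_closed b N n -> almost_closed bT (ext N) n.
Proof.
move=> closN c F; have : exists k, (size (msupp F) <= k)%N by exists (size (msupp F)).
case=> k; elim: k F => [|k IH] F.
  rewrite leqn0 size_eq0 msupp_eq0 => /eqP -> _.
  by apply: id0; apply: filP; apply: extP.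
move=> Fk Fc; have [->|F0] := eqVneq F 0; first by apply: id0; apply: filP; apply: extP.
have lc : fil b N n (mleadc F).
  apply: (closN c) => i u bu.
  have : fil bT (ext N) (n * i) (u%:MP * F ^+ i).
    by apply: Fc; rewrite -ext_gpow extC //; apply: gpowP.
  by rewrite -ext_fil => /(_ (mlead F *+ i)%MM); rewrite mcoeffCM mleadcX.
have lF : fil bT (ext N) n (mleadc F *: 'X_[mlead F]).
  by rewrite -ext_fil => m; rewrite mcoeffZ; apply: idMr => //; apply: filP.
apply: (idBl (filP bT (extP r iN) n) lF); apply: IH.
  rewrite (perm_size (msupp_rem F (mlead F))) size_rem ?mlead_supp //.
  by rewrite -ltnS (leq_trans _ Fk) // prednK //; case: (msupp F) (mlead_supp F0).
by apply: almostB => //; apply: extP.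
Qed.

End PolynomialExtension.

(** * Homogeneous components and asymptotic normality modulo a generic element *)

Section Degree.
Variables (R : comNzRingType) (r : nat).
Local Notation T := {mpoly R[r]}.

Lemma mmap_congr (S : comNzRingType) (f : {rmorphism R -> S}) (h h' : 'I_r -> S) L :
  is_ideal L -> (forall i, L (h i - h' i)) -> forall F : T, L (mmap f h F - mmap f h' F).
Proof.
move=> iL hh; apply: mpoly_ring_ind => [c|i|F G|F G] /=.
- by rewrite !mmapC subrr; apply: id0.
- by rewrite !mmapX !mmap1U.
- by rewrite !mmapD opprD addrACA; apply: idD.
rewrite !rmorphM /= => LF LG.
set x := mmap f h F in LF *; set x' := mmap f h' F in LF *.
set y := mmap f h G in LG *; set y' := mmap f h' G in LG *.
rewrite (_ : _ - _ = x * (y - y') + y' * (x - x')); last by ring.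
by apply: idD => //; apply: idM.
Qed.

Lemma mmap1_scale (S : comNzRingType) (h : 'I_r -> S) c (m : 'X_{1..r}) :
  mmap1 (fun i => c * h i) m = c ^+ mdeg m * mmap1 h m.
Proof.
rewrite /mmap1 mdegE expr_sum -big_split /=.
by apply: eq_bigr => i _; rewrite exprMn.
Qed.

(* [homc F] records the homogeneous components of F as the coefficients of a
   polynomial in a new variable. *)
Definition homc : T -> {poly T} :=
  mmap (polyC \o @mpolyC r R) (fun i => 'X * ('X_i)%:P).

HB.instance Definition _ := GRing.RMorphism.copy homc
  (mmap (polyC \o @mpolyC r R) (fun i => 'X * ('X_i)%:P)).

Lemma homcC c : homc c%:MP = (c%:MP)%:P. Proof. exact: mmapC. Qed.

Lemma homcX m : homc 'X_[m] = 'X^(mdeg m) * ('X_[m])%:P.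
Proof.
rewrite /homc mmapX mmap1_scale; congr (_ * _).
by rewrite mpolyXE_id rmorph_prod; apply: eq_bigr => i _; rewrite rmorphXn.
Qed.

Lemma homcZX c m : homc (c *: 'X_[m]) = (c *: 'X_[m])%:P * 'X^(mdeg m).
Proof.
rewrite -mul_mpolyC (rmorphM homc) /= homcC homcX mulrCA.
by rewrite mulrC -polyCM.
Qed.

Lemma homc_coef F k m : ((homc F)`_k)@_m = if mdeg m == k then F@_m else 0.
Proof.
move: F; apply: mpolyind => [|c m' F _ _ IH].
  by rewrite rmorph0 coef0 mcoeff0 if_same.
rewrite (rmorphD homc) /= homcZX coefD coefCM coefXn [LHS]mcoeffD IH.
rewrite [in RHS]mcoeffD.
case: eqP => [->|km'].
  rewrite mulr1 mcoeffZ mcoeffX.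
  case: (eqVneq (mdeg m) (mdeg m')) => // mm.
  by case: (eqVneq m' m) mm => [->|_ _]; rewrite ?eqxx // mulr0 addr0.
rewrite mulr0 mcoeff0 add0r mcoeffZ mcoeffX; case: eqP => // mk.
by case: eqP => [e|_]; [case: km'; rewrite e|rewrite mulr0 add0r].
Qed.

Lemma homc_eq0 F : homc F = 0 -> F = 0.
Proof.
move=> F0; apply/mpolyP => m; have := homc_coef F (mdeg m) m.
by rewrite eqxx => <-; rewrite F0 coef0.
Qed.

Lemma homc_idem F D : homc (homc F)`_D = ((homc F)`_D)%:P * 'X^D.
Proof.
apply/polyP => k; apply/mpolyP => m; rewrite homc_coef coefCM coefXn.
case: (eqVneq k D) => [->|kD].
  by rewrite mulr1 !homc_coef; case: eqP.
rewrite mulr0 mcoeff0 homc_coef; case: eqP => // ->.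
by rewrite (negPf kD).
Qed.

Lemma ext_homc K F k : is_ideal K -> ext K F -> ext K (homc F)`_k.
Proof. by move=> iK KF m; rewrite homc_coef; case: ifP => // _; apply: id0. Qed.

Lemma coef_top_mul (S : comNzRingType) (P Q : {poly S}) D E :
  (size P <= D.+1)%N -> (size Q <= E.+1)%N -> (P * Q)`_(D + E) = P`_D * Q`_E.
Proof.
move=> sP sQ; rewrite coefM.
have DE : (D < (D + E).+1)%N by rewrite ltnS leq_addr.
rewrite (bigD1 (Ordinal DE)) //= addKn big1 ?addr0 // => i iD.
have {}iD : (i != D :> nat) by [].
case: (ltngtP i D) iD => // iD _.
  by rewrite [Q`__](leq_sizeP _ _ sQ) ?mulr0 //; lia.
by rewrite [P`__](leq_sizeP _ _ sP) ?mul0r.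
Qed.

Lemma coef_top_exp (S : comNzRingType) (P : {poly S}) D i :
  (size P <= D.+1)%N -> (P ^+ i)`_(D * i) = P`_D ^+ i /\ (size (P ^+ i) <= (D * i).+1)%N.
Proof.
move=> sP; elim: i => [|i [IH sI]]; first by rewrite muln0 coef1 size_poly1.
rewrite !exprS mulnS coef_top_mul // IH; split=> //.
by apply: leq_trans (size_polyMleq _ _) _; lia.
Qed.

End Degree.

Section Bertini.
Variables (R : comNzRingType) (r s : nat) (a : 'I_r -> R) (b : 'I_s -> R).
Variable N : R -> Prop.
Hypotheses (iN : is_ideal N) (ab : forall i, gpow b 1 (a i)).
Local Notation T := {mpoly R[r]}.
Local Notation aT := (fun i => (a i)%:MP : T).
Local Notation bT := (fun i => (b i)%:MP : T).
Local Notation N' := (adj (ext N) (gx a)).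

Lemma homc_gx : homc (gx a) = (gx a)%:P * 'X.
Proof.
rewrite /gx rmorph_sum rmorph_sum mulr_suml; apply: eq_bigr => i _.
by rewrite rmorphM /= homcC homcX mdeg1 rmorphM /= -mulrA [_ * 'X]mulrC.
Qed.

Lemma filN' n : fil bT N' n = adj (ext (fil b N n)) (gx a).
Proof. by rewrite ext_fil // /fil adj_add. Qed.

Let iN' : is_ideal N'. Proof. by apply: adjP; apply: extP. Qed.

Lemma fil_homc n F k : fil bT N' n F -> exists H w,
  ext (fil b N n) (homc H)`_k /\ (homc F)`_k = (homc H)`_k + w * gx a.
Proof.
rewrite filN' => -[w Hw]; exists (F - w * gx a), (homc w * 'X)`_k.
split; first by apply: ext_homc => //; apply: filP.
have e : homc (w * gx a) = homc w * 'X * (gx a)%:P.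
  by rewrite (rmorphM (@homc R r)) /= homc_gx mulrA mulrAC.
by rewrite (rmorphB (@homc R r)) /= e coefB coefMC subrK.
Qed.

(* On z-homogeneous polynomials of degree D the substitution [elimvar l] is
   multiplication by a_l ^ D modulo [gx a], and it kills [gx a]. *)
Definition elimvar (l : 'I_r) : T -> T := mmap (@mpolyC r R)
  (fun i => if i == l then - \sum_(j | j != l) (a j)%:MP * 'X_j else (a l)%:MP * 'X_i).

HB.instance Definition _ l := GRing.RMorphism.copy (elimvar l)
  (mmap (@mpolyC r R) (fun i => if i == l then - \sum_(j | j != l) (a j)%:MP * 'X_j
     else (a l)%:MP * 'X_i)).

Lemma elimvarC l c : elimvar l c%:MP = c%:MP. Proof. exact: mmapC. Qed.

Lemma elimvar_gx l : elimvar l (gx a) = 0.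
Proof.
rewrite /gx rmorph_sum (bigD1 l) //= rmorphM /= /elimvar mmapC mmapX mmap1U eqxx.
rewrite mulrN mulr_sumr -sumrN -big_split big1 //= => i il.
rewrite rmorphM /= mmapC mmapX mmap1U (negPf il).
by rewrite mulrCA addNr.
Qed.

(** Every variable is sent into the ideal (a), which lies in (b), so a form of degree E gains E
    powers of b. *)
Lemma elimvar_fil l q E (H : T) : ext (fil b N q) (homc H)`_E ->
  ext (fil b N (q + E)) (elimvar l (homc H)`_E).
Proof.
set G := (homc H)`_E => KG; rewrite ext_fil // /elimvar /mmap.
rewrite big_seq; apply: id_sum => [|m mG]; first by apply: filP; apply: extP.
have <- : mdeg m = E.
  apply/eqP; move: mG; rewrite mcoeff_msupp homc_coef; case: ifP => //.
  by rewrite eqxx.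
apply: filM; first exact: extP.
  rewrite -ext_fil // extC; [exact: KG|exact: filP].
apply: gpow_fil; first exact: extP.
apply: (gpow_sub (a := fun i => if i == l then - \sum_(j | j != l) (a j)%:MP * 'X_j
    else (a l)%:MP * 'X_i)); last exact: gpow_monomial.
have abT j : gpow bT 1 (a j)%:MP by rewrite -ext_gpow extC //; apply: (gpowP b 1).
have i1 := gpowP bT 1.
move=> i; case: ifP => _; last exact: (idMr i1).
by apply: (idN i1); apply: (id_sum i1) => j _; apply: (idMr i1).
Qed.

(** Scaling all variables by a_l multiplies a form of degree D by a_l^D; this substitution and
    [elimvar l] differ only at z_l, and there by exactly [gx a]. *)
Lemma elimvar_homog l (F : T) D :
  adj (@zero_ideal T) (gx a) ((a l)%:MP ^+ D * (homc F)`_D - elimvar l (homc F)`_D).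
Proof.
set G := (homc F)`_D.
have -> : (a l)%:MP ^+ D * G = mmap (@mpolyC r R) (fun i => (a l)%:MP * 'X_i) G.
  rewrite {1}[G]mpolyE mulr_sumr /mmap big_seq [RHS]big_seq; apply: eq_bigr => m mG.
  have mD : mdeg m = D.
    apply/eqP; move: mG; rewrite mcoeff_msupp homc_coef; case: ifP => //.
    by rewrite eqxx.
  rewrite mmap1_scale mD mmap1_id -mul_mpolyC mulrCA //.
apply: mmap_congr => [|i]; first by apply: adjP; apply: zero_ideal_ideal.
case: eqP => [->|_]; last first.
  by rewrite subrr; apply: id0; apply: adjP; apply: zero_ideal_ideal.
exists 1; rewrite mul1r opprK /gx (bigD1 l (P := predT)) //= subrr.
exact: id0 (@zero_ideal_ideal T).
Qed.

(** Induction on the z-degree D. The top component of u F^i is u G^i, so the top component G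
    inherits almost integrality. The substitution sends u G^i into b^((n+D) i), a gain of D per
    factor that pays for the a_l^D in front of G; hence closedness of N is used in degree n + D. *)
Lemma gx_almost_closed n n0 :
  (forall k, (n <= k)%N -> almost_closed b N k) ->
  (forall k E f, (n0 <= k)%N ->
    (forall v, gpow aT E v -> fil bT N' (k + E) (f * v)) -> fil bT N' k f) ->
  (n0 <= n)%N -> almost_closed bT N' n.
Proof.
move=> closN rr n0n c F.
have : exists D, (size (homc F) <= D)%N by exists (size (homc F)).
case=> D; elim: D F => [|D IH] F.
  rewrite leqn0 size_poly_eq0 => /eqP/homc_eq0 -> _.
  by apply: id0; apply: filP.
move=> sF Fc; pose G := (homc F)`_D.
have topF i u : homc (u%:MP * F ^+ i) = (u%:MP)%:P * (homc F) ^+ i.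
  by rewrite rmorphM /= homcC rmorphXn.
have Gc i u : gpow b c u -> exists H w, ext (fil b N (n * i)) (homc H)`_(D * i) /\
    u%:MP * G ^+ i = (homc H)`_(D * i) + w * gx a.
  move=> bu; have [|H [w [KH e]]] := @fil_homc (n * i) (u%:MP * F ^+ i) (D * i).
    by apply: Fc; rewrite -ext_gpow extC //; apply: gpowP.
  exists H, w; split=> //.
  by rewrite -e topF coefCM (proj1 (coef_top_exp i sF)).
suff GN : fil bT N' n G.
  apply: (idBl (filP bT iN' n) GN); apply: IH; last exact: almostB.
  rewrite rmorphB /= homc_idem; apply/leq_sizeP => j.
  rewrite coefB coefCM coefXn leq_eqVlt => /predU1P[<-|Dj].
    by rewrite eqxx mulr1 subrr.
  by rewrite [(homc F)`_j](leq_sizeP _ _ sF) // (gtn_eqF Dj) mulr0 subr0.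
apply: (rr _ (r * D).+1) => // v av.
apply: (graded_pigeonhole (a := aT)) av => [|l].
  apply: fil_graded => // i.
  by rewrite -ext_gpow extC //; apply: (gpowP b 1).
have : fil bT (ext N) (n + D) (elimvar l G).
  apply: (@ext_almost_closed _ _ _ b N iN (n + D) _ c).
    by apply: closN; apply: leq_addr.
  apply: almost_const => [|i u bu]; first exact: extP.
  have [H [w [KH e]]] := Gc i u bu.
  have -> : u%:MP * elimvar l G ^+ i = elimvar l (homc H)`_(D * i).
    rewrite -[u%:MP](elimvarC l) -(rmorphXn (elimvar l)) -(rmorphM (elimvar l)) e.
    by rewrite (rmorphD (elimvar l)) (rmorphM (elimvar l)) /= elimvar_gx mulr0 addr0.
  by rewrite -ext_fil // mulnDl; apply: elimvar_fil.
move=> GN; rewrite mulrC filN' -ext_fil // in GN *.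
have iA : is_ideal (adj (ext (fil b N (n + D))) (gx a)).
  by apply: adjP; apply: extP; apply: filP.
apply: (@idBl _ _ iA (elimvar l G)); first exact: sub_adj.
apply: (@adj_le _ (@zero_ideal T)); last exact: elimvar_homog.
by move=> z ->; apply: id0; apply: extP; apply: filP.
Qed.

End Bertini.

(** * Generic regular sequences on the associated graded ring *)

Section Exchange.
Variables (R : comNzRingType) (r : nat) (a : 'I_r -> R).
Implicit Types (K N : R -> Prop).

(** Membership of w in the radical of (a) + N. If such a w is a nonzerodivisor modulo N, then (a)
    contains one too. *)
Definition torsion N w := exists e v, gpow a 1 v /\ N (w ^+ e - v).

Lemma torsion_sub N K w : sset N K -> torsion N w -> torsion K w.
Proof. by move=> NK [e [v [av Nv]]]; exists e, v; split=> //; apply: NK. Qed.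

Lemma torsion_nzd N w : is_ideal N -> torsion N w -> nzd N w ->
  exists2 u, gpow a 1 u & nzd N u.
Proof.
move=> iN [e [v [av Nv]]] wN; exists v => // y Ny.
apply: (nzdX (n := e) wN); apply: (idBl iN Ny).
by rewrite -mulrBl; apply: idMr.
Qed.

Lemma torsion_gx_nzd N w : is_ideal N -> torsion N w -> nzd N w ->
  nzd (ext N) (gx a).
Proof. by move=> iN wt /(torsion_nzd iN wt)[u au]; apply: gx_nzd. Qed.

(** Modulo each initial segment of fs the next member of the sequence is a nonzerodivisor in the
    radical of (a), so the generic element is one as well and can be moved to the front. The last f
    serves for the full segment fs and is then given up. *)
Lemma gx_regl N fs f : is_ideal N -> regl N (rcons fs f) ->
  (forall w, w \in rcons fs f -> torsion N w) ->
  regl (ext N) (gx a :: [seq c%:MP | c <- fs]).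
Proof.
move=> iN rN tN.
have : regat (ext N) [seq c%:MP | c <- fs] (gx a).
  elim: fs N iN rN tN => [|g fs IH] N iN /= [gN rN] tN.
    split=> //; apply: torsion_gx_nzd gN => //.
    by apply: tN; rewrite inE.
  split; first by apply: torsion_gx_nzd gN => //; apply: tN; rewrite inE eqxx.
  rewrite -ext_adj //; apply: IH => //; first exact: adjP.
  move=> w wf; apply: (@torsion_sub N); first exact: sub_adj.
  by apply: tN; rewrite inE wf orbT.
move=> xN; split; first by case: (fs) xN => /= [|? ?] [].
apply: regl_swap xN _; first exact: extP.
by apply: ext_regl => //; move/regl_rcons: rN => [].
Qed.

Lemma gx_regl_cat N xs fs f : is_ideal N -> regl N (xs ++ rcons fs f) ->
  (forall w, w \in rcons fs f -> torsion N w) ->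
  regl (ext N) (rcons [seq c%:MP | c <- xs] (gx a) ++ [seq c%:MP | c <- fs]).
Proof.
move=> iN /regl_cat[xN fN] tN; rewrite cat_rcons; apply/regl_cat.
split; first exact: ext_regl.
rewrite -ext_adjl //; apply: gx_regl fN _; first exact: adjlP.
by move=> w /tN; apply: torsion_sub; apply: sub_adjl.
Qed.

End Exchange.

(** * Presentations of the graded ring and the Valabrega-Valla criterion *)

Section GradedPair.
Variables (U V : comNzRingType) (r : nat) (a : 'I_r -> U) (X : 'I_r -> V).

(* V presents the associated graded ring of (a): [rho] is the map to the Rees
   algebra, and [N] the kernel of V -> Gr. *)
Definition gr_pair (rho : V -> {poly U}) (N : V -> Prop) :=
  [/\ forall F k, gpow a k (rho F)`_k,
      forall k u, gpow a k u -> exists F, rho F = u%:P * 'X^k,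
      forall i, rho (X i) = (a i)%:P * 'X
    & forall F, N F <-> forall k, gpow a k.+1 (rho F)`_k].

Definition lift_rho (rho : V -> {poly U}) : {mpoly V[r]} -> {poly {mpoly U[r]}} :=
  mmap (map_poly (@mpolyC r U) \o rho) (fun i => ('X_i)%:P).

End GradedPair.

Section GradedPairExt.
Variables (U V : comNzRingType) (r : nat) (a : 'I_r -> U) (X : 'I_r -> V).
Variables (rho : {rmorphism V -> {poly U}}) (N : V -> Prop).
Local Notation rho' := (@lift_rho U V r rho).

HB.instance Definition _ := GRing.RMorphism.copy rho'
  (mmap (map_poly (@mpolyC r U) \o rho) (fun i => ('X_i)%:P)).

Lemma lift_rhoC c : rho' c%:MP = map_poly (@mpolyC r U) (rho c).
Proof. exact: mmapC. Qed.

Lemma lift_rhoX m : rho' 'X_[m] = ('X_[m])%:P.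
Proof.
rewrite /lift_rho mmapX mpolyXE_id rmorph_prod; apply: eq_bigr => i _.
by rewrite rmorphXn.
Qed.

Lemma lift_rho_coef F k m : ((rho' F)`_k)@_m = (rho F@_m)`_k.
Proof.
move: F; apply: mpolyind => [|c m' F _ _ IH].
  by rewrite rmorph0 coef0 !mcoeff0 rmorph0 coef0.
rewrite (rmorphD rho') /= coefD mcoeffD.
have -> : (rho' (c *: 'X_[m']))`_k = (rho c)`_k *: 'X_[m'].
  rewrite -!mul_mpolyC (rmorphM rho') /= lift_rhoC lift_rhoX coefMC.
  by rewrite coef_map /=.
rewrite IH mcoeffD !mcoeffZ !mcoeffX (rmorphD rho) coefD; congr (_ + _).
by case: eqP => _; rewrite ?mulr1 // !mulr0 rmorph0 coef0.
Qed.

Lemma gr_pair_ext : gr_pair a X rho N ->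
  gr_pair (fun i => (a i)%:MP_[r]) (fun i => (X i)%:MP_[r]) rho' (ext N).
Proof.
move=> [rc rl rX rN]; split.
- by move=> F k; rewrite -ext_gpow => m; rewrite lift_rho_coef.
- move=> k u; rewrite -ext_gpow => au.
  have [h hE] := functional_choice _ (fun m => rl k _ (au m)).
  exists (\sum_(m <- msupp u) h m *: 'X_[m]).
  apply/polyP => j; apply/mpolyP => m.
  rewrite lift_rho_coef mcoeff_sumX ?msupp_uniq // coefCM coefXn.
  case: ifP => mu; first by rewrite hE coefCM coefXn; case: eqP; rewrite ?mulr1 // !mulr0 mcoeff0.
  rewrite rmorph0 coef0; case: eqP; rewrite ?mulr0 ?mcoeff0 // mulr1.
  by rewrite (memN_msupp_eq0 (negbT mu)).
- by move=> i; rewrite lift_rhoC rX rmorphM /= map_polyC map_polyX.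
- move=> F; split=> [NF k|NF m].
    by rewrite -ext_gpow => m; rewrite lift_rho_coef; move: k; apply/rN.
  by apply/rN => k; have := NF k; rewrite -ext_gpow => /(_ m); rewrite lift_rho_coef.
Qed.

Lemma lift_rho_gx : (forall i, rho (X i) = (a i)%:P * 'X) ->
  rho' (gx X) = (gx a)%:P * 'X.
Proof.
move=> rX; rewrite /gx !rmorph_sum mulr_suml; apply: eq_bigr => i _.
rewrite (rmorphM rho') /= lift_rhoC lift_rhoX rX rmorphM /= map_polyC map_polyX /=.
by rewrite rmorphM /= mulrAC.
Qed.

Lemma lift_rho_map xs xV : map rho xV = [seq x%:P * 'X | x <- xs] ->
  map rho' [seq x%:MP | x <- xV] = [seq x%:P * 'X | x <- [seq x%:MP_[r] | x <- xs]].
Proof.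
move=> e; rewrite -!map_comp.
transitivity (map (map_poly (@mpolyC r U)) (map rho xV)).
  by rewrite -map_comp; apply: eq_map => x /=; rewrite lift_rhoC.
rewrite e -map_comp; apply: eq_map => x /=.
by rewrite rmorphM /= map_polyC map_polyX.
Qed.

End GradedPairExt.

Section Lin.
Variable R : comNzRingType.
Implicit Types (K : R -> Prop).

Fixpoint lin (ys : seq R) K z : Prop :=
  if ys is y :: ys' then exists2 g, K g & lin ys' K (z - g * y) else z = 0.

Lemma linP ys K : is_ideal K -> is_ideal (lin ys K).
Proof.
move=> iK; elim: ys => [|y ys IH] /=; first exact: zero_ideal_ideal.
split.
- by exists 0; [apply: id0|rewrite mul0r subr0; apply: (id0 IH)].
- move=> u v [g Kg lu] [h Kh lv]; exists (g + h); first exact: idD.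
  by rewrite mulrDl opprD addrACA; apply: (idD IH).
- move=> c u [g Kg lu]; exists (c * g); first exact: idM.
  by rewrite -mulrA -mulrBr; apply: (idM IH).
Qed.

Lemma lin_mul ys K L c z : (forall g, K g -> L (g * c)) -> lin ys K z -> lin ys L (z * c).
Proof.
move=> KL; elim: ys z => [|y ys IH] z /=; first by move=> ->; rewrite mul0r.
move=> [g Kg lz]; exists (g * c); first exact: KL.
by rewrite mulrAC -mulrBl; apply: IH.
Qed.

(** The list is reversed so that the head, which [lin] peels off, is the last member of the regular
    sequence. *)
Lemma adjl_lin ys K z : is_ideal K ->
  adjl K (rev ys) z <-> exists2 w, lin ys (@whole R) w & K (z - w).
Proof.
move=> iK; elim: ys z => [|y ys IH] z.
  rewrite /rev /=; split=> [Kz|[_ -> ]]; last by rewrite subr0.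
  by exists 0; rewrite ?subr0.
rewrite rev_cons adjl_rcons; split.
  move=> [c /IH[w lw Kw]]; exists (w + c * y).
    by exists c => //; rewrite addrK.
  by rewrite opprD addrA addrAC.
move=> [w /= [g _ lw] Kw]; exists g; apply/IH; exists (w - g * y) => //.
by rewrite opprB addrA subrK.
Qed.

End Lin.

Section ValabregaValla.
Variables (U V : comNzRingType) (r : nat) (a : 'I_r -> U) (X : 'I_r -> V).
Variables (rho : {rmorphism V -> {poly U}}) (N : V -> Prop).
Hypotheses (rhoP : gr_pair a X rho N) (iN : is_ideal N).

Lemma lin_lift ys vs q z : map rho vs = [seq x%:P * 'X | x <- ys] ->
  lin ys (gpow a q) z ->
  exists2 Z, lin vs (@whole V) Z & rho Z = z%:P * 'X^(q.+1).
Proof.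
have [_ rl _ _] := rhoP.
elim: ys vs z => [|y ys IH] [|v vs] z //=.
  by move=> _ ->; exists 0 => //; rewrite rmorph0 mul0r.
move=> [rv rvs] [g ag lz]; have [Z lZ ZE] := IH _ _ rvs lz.
have [G GE] := rl _ _ ag.
exists (Z + G * v).
  by exists G => //; rewrite addrK.
rewrite rmorphD rmorphM /= ZE GE rv exprSr rmorphB rmorphM /=.
by rewrite mulrACA mulrBl [_%:P * _%:P * _]mulrC; ring.
Qed.

Lemma lin_rho ys vs Y : map rho vs = [seq x%:P * 'X | x <- ys] ->
  lin vs (@whole V) Y ->
  (rho Y)`_0 = 0 /\ forall q, lin ys (gpow a q) (rho Y)`_q.+1.
Proof.
have [rc _ _ _] := rhoP.
elim: ys vs Y => [|y ys IH] [|v vs] Y //=.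
  by move=> _ ->; rewrite rmorph0; split=> [|q]; rewrite coef0.
move=> [rv rvs] [G _ lY]; have [e0 eq] := IH _ _ rvs lY.
have YE k : (rho Y)`_k = (rho (Y - G * v))`_k + (if k is k'.+1 then (rho G)`_k' * y else 0).
  rewrite -{1}[Y](subrK (G * v)) rmorphD coefD; congr (_ + _).
  rewrite rmorphM /= rv mulrA coefMX; case: k => //= k.
  by rewrite coefMC.
split; first by rewrite YE e0 addr0.
move=> q; exists (rho G)`_q; first exact: rc.
by rewrite YE addrK.
Qed.

Lemma gpow_of_rho y v : rho v = y%:P * 'X -> gpow a 1 y.
Proof.
have [rc _ _ _] := rhoP => rv; have := rc v 1%N.
by rewrite rv coefMX coefC.
Qed.

(** The hypothesis z in a^(q+2) is a relation among initial forms in Gr. As v is regular modulo vs,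
    the initial form of the coefficient g of y lies in (vs), so g is congruent modulo a^(q+1) to a
    combination of ys. Its product with y is absorbed by the other terms, and induction handles
    them. *)
Lemma vv_step ys vs q z : map rho vs = [seq x%:P * 'X | x <- ys] ->
  regl N (rev vs) -> lin ys (gpow a q) z -> gpow a q.+2 z -> lin ys (gpow a q.+1) z.
Proof.
have [rc rl _ rN] := rhoP.
elim: ys vs z => [|y ys IH] [|v vs] z //=.
move=> [rv rvs]; rewrite rev_cons regl_rcons => -[vsN vN] [g ag lz] az.
have ay := gpow_of_rho rv.
have [Z lZ ZE] := lin_lift rvs lz; have [G GE] := rl _ _ ag.
have [Y lY NY] : exists2 Y, lin vs (@whole V) Y & N (G - Y).
  apply/(adjl_lin _ _ iN); apply: vN; apply/(adjl_lin _ _ iN); exists (- Z).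
    by apply: idN lZ; apply: linP; apply: whole_ideal.
  apply/rN => k; rewrite opprK rmorphD rmorphM /= rv GE ZE.
  rewrite (_ : _ + _ = z%:P * 'X^(q.+1)).
    rewrite coefCM coefXn; case: eqP => [->|_]; first by rewrite mulr1.
    by rewrite mulr0; apply: (id0 (gpowP a k.+1)).
  by rewrite rmorphB rmorphM /= exprS; ring.
have [Y0 Yq] := lin_rho rvs lY.
have ag' : gpow a q.+1 (g - (rho Y)`_q).
  by have /rN/(_ q) := NY; rewrite rmorphB GE coefB coefCM coefXn eqxx mulr1.
exists (g - (rho Y)`_q) => //; apply: (IH vs) => //.
  rewrite mulrBl opprB addrA addrAC; apply: idD => //.
    by apply: linP; apply: gpowP.
  case: (q) Yq Y0 => [_ ->|k Yk _].
    by rewrite mul0r; apply: id0; apply: linP; apply: gpowP.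
  apply: lin_mul (Yk k) => u au; rewrite -addn1; exact: gpowM.
by apply: (idB (gpowP a q.+2)) => //; rewrite -addn1; apply: gpowM.
Qed.

(** Climbing with [vv_step], y f - w can be written on y :: ys with coefficients in a^n. If g is the
    coefficient of y, then y (f - g) lies in (ys), and regularity in U gives f = g modulo (ys). *)
Lemma vv_colon ys y vs n f : map rho vs = [seq x%:P * 'X | x <- y :: ys] ->
  regl N (rev vs) -> nzd (adjl (@zero_ideal U) (rev ys)) y ->
  adjl (gpow a n.+1) (rev ys) (y * f) -> adjl (gpow a n) (rev ys) f.
Proof.
move=> rvs vN yN /(adjl_lin _ _ (gpowP a n.+1))[w lw av].
have i0 := @zero_ideal_ideal U.
have : lin (y :: ys) (gpow a n) (y * f - w).
  have : forall q, (q <= n)%N -> lin (y :: ys) (gpow a q) (y * f - w).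
    elim=> [_|q IH qn].
      exists f => //; rewrite [y * f]mulrC addrAC subrr add0r.
      by apply: idN lw; apply: linP; apply: whole_ideal.
    by apply: vv_step rvs vN _ _; [apply: IH; apply: ltnW|apply: gpow_le av].
  by apply.
move=> [g ag lz].
have lw' : lin ys (@whole U) (y * (f - g)).
  have iL := linP ys (@whole_ideal U).
  rewrite (_ : y * _ = (y * f - w - g * y) + w); last by ring.
  apply: idD => //.
  by have := @lin_mul _ ys (gpow a n) (@whole U) 1 _ (fun _ _ => I) lz; rewrite mulr1.
have : adjl (@zero_ideal U) (rev ys) (f - g).
  by apply: yN; apply/(adjl_lin _ _ i0); exists (y * (f - g)); rewrite ?subrr.
have iA := adjlP (rev ys) (gpowP a n).
move=> fg; apply: (idBl iA (sub_adjl _ ag)); apply: adjl_le fg.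
by move=> x ->; apply: id0; apply: gpowP.
Qed.

End ValabregaValla.

(** * Hilbert functions under generic cuts, and the inductive state *)

Definition nabla (H : nat -> nat) n := (H n - H n.-1)%N.

Definition eventually (P : nat -> Prop) := exists n0, forall n, (n0 <= n)%N -> P n.

Section HilbertStep.
Variables (R : comNzRingType) (r s : nat) (p N : R -> Prop).
Variables (a : 'I_r -> R) (b : 'I_s -> R).
Hypotheses (nR : noetherian R) (pP : is_prime p) (iN : is_ideal N).
Hypotheses (ab : forall i, gpow b 1 (a i)).
Variables (c : nat) (u : R).
Hypotheses (rc : reduces a b c) (au : gpow a 1 u) (uN : nzd N u).
Local Notation T := {mpoly R[r]}.
Local Notation bT := (fun i => (b i)%:MP : T).

(** [gx_coef] controls the coefficients of F only after multiplication by a power of a; Ratliff-Rush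
    removes that power for large n. *)
Lemma gx_colon : eventually (fun n => colon (ext (fil b N n.+1)) (gx a) = ext (fil b N n)).
Proof.
have bu := gpow_sub ab au.
have [n0 rr] := ratliff_rush nR iN bu uN rc; have gK := fil_graded iN ab.
exists n0 => n nn; apply: sset_eq => F.
  move=> xF m; apply: (rr _ (r * msize F).+1) => // v av.
  exact: (gx_coef (n := n) m gK xF av).
move=> KF m; rewrite mcoeff_gx; apply: id_sum => [|i _]; first exact: filP.
case: ifP => _; first by rewrite mulr0; apply: id0; apply: filP.
by rewrite mulrC; case: gK => _; apply.
Qed.

Lemma hilbert_step (H : nat -> nat) :
  eventually (fun n => haslen p (H n) (fil b N n)) ->
  eventually (fun n => haslen (ext p) (nabla H n) (fil bT (adj (ext N) (gx a)) n)).
Proof.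
move=> [n1 Hn]; have [n0 xn] := gx_colon.
exists (maxn n0 n1).+1 => -[|n] //; rewrite ltnS geq_max => /andP[n0n n1n].
have H1 : haslen (@ext R r p) (H n.+1) (ext (fil b N n.+1)).
  by apply: ext_haslen => //; [apply: filP|apply: Hn; apply: leqW].
have H0 : haslen (@ext R r p) (H n) (ext (fil b N n)).
  by apply: ext_haslen => //; [apply: filP|apply: Hn].
have [A [B [HA HB HE]]] :=
  haslen_adj (ext_prime r pP) (gx a) (extP r (filP b iN n.+1)) H1.
rewrite xn // in HA; rewrite filN' // /nabla /= HE -(haslen_inj HA H0).
by rewrite addKn.
Qed.

End HilbertStep.

Lemma torsion_ext (R : comNzRingType) r k (a : 'I_r -> R) N w : is_ideal N ->
  torsion a N w -> torsion (fun i => (a i)%:MP_[k]) (ext N) w%:MP.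
Proof.
move=> iN [e [v [av Nv]]]; exists e, v%:MP; split.
  by rewrite -ext_gpow extC //; apply: (gpowP a 1).
by rewrite -rmorphXn -rmorphB extC.
Qed.

Section States.
Variables (r s : nat).

Definition base_state (U : comNzRingType) (p N : U -> Prop) (a : 'I_r -> U)
    (b : 'I_s -> U) (HI HJ : nat -> nat) :=
  [/\ noetherian U, is_prime p, (forall i, gpow b 1 (a i)) & exists c, reduces a b c] /\
  [/\ eventually (fun n => haslen p (HI n) (fil a N n)),
      eventually (fun n => haslen p (HJ n) (fil b N n))
    & eventually (almost_closed b N)].

(** The elements xV are degree-one lifts of the generic elements xs; ws and fV are the members still
    to be exchanged, in U and in the graded ring. *)
Definition seq_state (U V : comNzRingType) (a : 'I_r -> U) (X : 'I_r -> V)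
    (rho : V -> {poly U}) (NV : V -> Prop) (xs ws : seq U) (xV fV : seq V) :=
  [/\ gr_pair a X rho NV, is_ideal NV & map rho xV = [seq x%:P * 'X | x <- xs]] /\
  [/\ regl (@zero_ideal U) (xs ++ ws), (forall w, w \in ws -> torsion a (@zero_ideal U) w),
      regl NV (xV ++ fV) & (forall f, f \in fV -> torsion X NV f)].

Lemma reduces_ext k (U : comNzRingType) (a : 'I_r -> U) (b : 'I_s -> U) c :
  reduces a b c -> reduces (fun i => (a i)%:MP_[k]) (fun i => (b i)%:MP_[k]) c.
Proof.
move=> rc n cn; rewrite -!ext_gpow -ext_isum; last exact: gpowP.
by apply: ext_le; apply: rc.
Qed.

Lemma gpow1_ext k (U : comNzRingType) (b : 'I_s -> U) x :
  gpow b 1 x -> gpow (fun i => (b i)%:MP_[k]) 1 x%:MP.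
Proof. by move=> bx; rewrite -ext_gpow extC //; apply: (gpowP b 1). Qed.

Lemma base_state_ext (U : comNzRingType) p N (a : 'I_r -> U) (b : 'I_s -> U) HI HJ :
  is_ideal N -> base_state p N a b HI HJ ->
  base_state (ext p) (ext N) (fun i => (a i)%:MP_[r]) (fun i => (b i)%:MP_[r]) HI HJ.
Proof.
move=> iN [[nU pP ab [c rc]] [[n1 hI] [n2 hJ] [n3 cJ]]]; split; split.
- exact: noetherian_mpoly.
- exact: ext_prime.
- by move=> i; apply: gpow1_ext.
- by exists c; apply: reduces_ext.
- exists n1 => n nn; rewrite -ext_fil //; apply: ext_haslen; [done|exact: filP|exact: hI].
- exists n2 => n nn; rewrite -ext_fil //; apply: ext_haslen; [done|exact: filP|exact: hJ].
- by exists n3 => n nn; apply: ext_almost_closed => //; apply: cJ.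
Qed.

(** Two nonzerodivisors occur: u modulo N makes the Hilbert functions drop to their differences, and
    u' modulo the new quotient is what Ratliff-Rush needs there to keep asymptotic normality. *)
Lemma base_state_gx (U : comNzRingType) p N (a : 'I_r -> U) (b : 'I_s -> U) HI HJ u u' :
  is_ideal N -> base_state p N a b HI HJ -> gpow a 1 u -> nzd N u ->
  gpow (fun i => (a i)%:MP_[r]) 1 u' -> nzd (adj (ext N) (gx a)) u' ->
  base_state (ext p) (adj (ext N) (gx a)) (fun i => (a i)%:MP_[r])
    (fun i => (b i)%:MP_[r]) (nabla HI) (nabla HJ).
Proof.
move=> iN [[nU pP ab [c rc]] [hI hJ [n3 cJ]]] au uN au' uN'.
have iN' : is_ideal (adj (ext N) (gx a)) by apply: adjP; apply: extP.
have abT i : gpow (fun i => (b i)%:MP_[r]) 1 (a i)%:MP by apply: gpow1_ext.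
split; split.
- exact: noetherian_mpoly.
- exact: ext_prime.
- exact: abT.
- by exists c; apply: reduces_ext.
- have ra : reduces a a 0 by move=> n _.
  exact: (hilbert_step nU pP iN (gpow1 a) ra au uN hI).
- exact: (hilbert_step nU pP iN ab rc au uN hJ).
- have [n0 rr] := ratliff_rush (noetherian_mpoly (n := r) nU) iN' (gpow_sub abT au') uN'
                    (reduces_ext (k := r) rc).
  exists (maxn n0 n3) => n; rewrite geq_max => /andP[n0n n3n].
  apply: (@gx_almost_closed _ _ _ a b N iN ab n n0) => // k nk.
  by apply: cJ; apply: leq_trans nk.
Qed.

Lemma seq_state_gx (U V : comNzRingType) (a : 'I_r -> U) (X : 'I_r -> V)
    (rho : {rmorphism V -> {poly U}}) NV xs ws w xV fV f :
  seq_state a X rho NV xs (rcons ws w) xV (rcons fV f) ->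
  seq_state (fun i => (a i)%:MP_[r]) (fun i => (X i)%:MP_[r]) (@lift_rho U V r rho)
    (ext NV) (rcons [seq x%:MP | x <- xs] (gx a)) [seq x%:MP | x <- ws]
    (rcons [seq x%:MP | x <- xV] (gx X)) [seq x%:MP | x <- fV].
Proof.
move=> [[rhoP iNV rxs] [rU tU rV tV]].
split; split.
- exact: gr_pair_ext.
- exact: extP.
- rewrite !map_rcons (lift_rho_map r rxs); congr rcons.
  by apply: lift_rho_gx; case: rhoP.
- rewrite -ext_zero; apply: gx_regl_cat rU _ => //; exact: zero_ideal_ideal.
- move=> _ /mapP[x xw ->]; rewrite -ext_zero; apply: torsion_ext.
    exact: zero_ideal_ideal.
  by apply: tU; rewrite mem_rcons inE xw orbT.
- exact: gx_regl_cat rV _.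
- move=> _ /mapP[x xw ->]; apply: torsion_ext => //.
  by apply: tV; rewrite mem_rcons inE xw orbT.
Qed.

(* U carries the generic elements introduced so far: the e elements xs have been
   divided out, so that HI and HJ are the Hilbert functions of I and J on U/(xs)
   localized at p, while the i elements ts have not.  The k elements of ws and fV
   are the members of the original regular sequences of A and Gr_I(A) that have
   not yet been exchanged for generic ones. *)
Definition state e i k (HI HJ : nat -> nat) :=
  exists (U V : comNzRingType) (p : U -> Prop) (a : 'I_r -> U) (b : 'I_s -> U)
    (X : 'I_r -> V) (rho : {rmorphism V -> {poly U}}) (NV : V -> Prop)
    (xs ts ws : seq U) (xV fV : seq V),
  [/\ base_state p (adjl (@zero_ideal U) xs) a b HI HJ,
      seq_state a X rho NV (xs ++ ts) ws xV fV
    & [/\ size xs = e, size ts = i, size ws = k & size fV = k]].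

Lemma seq_state_nzd (U V : comNzRingType) (a : 'I_r -> U) (X : 'I_r -> V)
    (rho : V -> {poly U}) NV xs ws xV fV :
  seq_state a X rho NV xs ws xV fV -> (0 < size ws)%N ->
  exists2 u, gpow a 1 u & nzd (adjl (@zero_ideal U) xs) u.
Proof.
move=> [_ [/regl_cat[_]]]; case: ws => //= w ws [wN _] tU _ _ _.
have iN := adjlP xs (@zero_ideal_ideal U).
apply: (torsion_nzd iN _ wN); apply: (@torsion_sub _ _ _ (@zero_ideal U)).
  exact: sub_adjl.
by apply: tU; rewrite inE eqxx.
Qed.

(** One element is exchanged and another must remain, to supply a nonzerodivisor of (a) modulo the
    new quotient. *)
Lemma state_gx e k HI HJ : state e 0 k.+2 HI HJ -> state e.+1 0 k.+1 (nabla HI) (nabla HJ).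
Proof.
move=> [U [V [p [a [b [X [rho [NV [xs [ts [ws [xV [fV [bs ss]]]]]]]]]]]]]].
move=> [sx st sw sf]; move: st ss => /size0nil ->; rewrite cats0 => ss.
case/lastP: ws => [|ws w] in sw ss *; first by [].
case/lastP: fV => [|fV f] in sf ss *; first by [].
have iN := adjlP xs (@zero_ideal_ideal U).
have [u au uN] := seq_state_nzd ss ltac:(by rewrite sw).
have ss' := seq_state_gx ss.
have [u' au' uN'] : exists2 u', gpow (fun i => (a i)%:MP_[r]) 1 u' &
    nzd (adjl (@zero_ideal {mpoly U[r]}) (rcons [seq x%:MP | x <- xs] (gx a))) u'.
  by apply: seq_state_nzd ss' _; rewrite size_map; move: sw; rewrite size_rcons => -[->].
have NE : adjl (@zero_ideal {mpoly U[r]}) (rcons [seq x%:MP | x <- xs] (gx a)) =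
    adj (ext (adjl (@zero_ideal U) xs)) (gx a).
  by rewrite adjl_rcons ext_adjl ?ext_zero //; apply: zero_ideal_ideal.
exists {mpoly U[r]}, {mpoly V[r]}, (ext p), (fun i => (a i)%:MP), (fun i => (b i)%:MP),
  (fun i => (X i)%:MP), (@lift_rho U V r rho), (ext NV),
  (rcons [seq x%:MP | x <- xs] (gx a)), [::], [seq x%:MP | x <- ws],
  (rcons [seq x%:MP | x <- xV] (gx X)), [seq x%:MP | x <- fV].
rewrite cats0 NE; split=> //.
  by rewrite NE in uN'; apply: base_state_gx bs au uN au' uN'.
split=> //; rewrite ?size_rcons ?size_map //; first by rewrite sx.
  by move: sw; rewrite size_rcons => -[].
by move: sf; rewrite size_rcons => -[].
Qed.

Lemma state_ext e i k HI HJ : state e i k.+1 HI HJ -> state e i.+1 k HI HJ.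
Proof.
move=> [U [V [p [a [b [X [rho [NV [xs [ts [ws [xV [fV [bs ss]]]]]]]]]]]]]].
move=> [sx st sw sf].
case/lastP: ws => [|ws w] in sw ss *; first by [].
case/lastP: fV => [|fV f] in sf ss *; first by [].
have iN := adjlP xs (@zero_ideal_ideal U).
exists {mpoly U[r]}, {mpoly V[r]}, (ext p), (fun i => (a i)%:MP), (fun i => (b i)%:MP),
  (fun i => (X i)%:MP), (@lift_rho U V r rho), (ext NV),
  [seq x%:MP | x <- xs], (rcons [seq x%:MP | x <- ts] (gx a)), [seq x%:MP | x <- ws],
  (rcons [seq x%:MP | x <- xV] (gx X)), [seq x%:MP | x <- fV].
split.
- rewrite -ext_zero -ext_adjl; last exact: zero_ideal_ideal.
  exact: base_state_ext bs.
- by rewrite -rcons_cat -map_cat; apply: seq_state_gx ss.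
- split; rewrite ?size_rcons ?size_map //; first by rewrite st.
    by move: sw; rewrite size_rcons => -[].
  by move: sf; rewrite size_rcons => -[].
Qed.

End States.

(** * The three-dimensional case *)

Section FilterRegular.
Variable R : comNzRingType.
Implicit Types (F : nat -> R -> Prop) (t g : R).

Definition filtration F := (forall n, is_ideal (F n)) /\ forall x, F 0%N x.

Definition raises F t := forall n x, F n x -> F n.+1 (t * x).

(** For a decreasing filtration starting at the whole ring and raised by t, this says that the class
    of t in degree one is a nonzerodivisor on the graded ring of F. *)
Definition fregular F t := forall n f, F n.+1 (t * f) -> F n f.

Definition fadj F t n := adj (F n) t.

Lemma filtration_adj F t : filtration F -> filtration (fadj F t).
Proof.
by move=> [iF F0]; split=> [n|x]; [apply: adjP|apply: sub_adj].
Qed.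

Lemma raises_adj F t g : raises F t -> raises (fadj F g) t.
Proof.
move=> Ft n x [c Fc]; exists (t * c); rewrite -mulrA -mulrBr.
exact: Ft.
Qed.

Lemma fadjC F t g : fadj (fadj F t) g = fadj (fadj F g) t.
Proof. by apply: functional_extensionality => n; apply: adjC. Qed.

(** If g2 f is a multiple of g1^(k+1) modulo the filtration, then f = h g1; cancelling g1 leaves the
    same problem for h and g1^k. *)
Lemma fregular_pow F g1 g2 k : filtration F -> raises F g1 -> raises F g2 ->
  fregular F g1 -> fregular (fadj F g1) g2 -> fregular (fadj F (g1 ^+ k)) g2.
Proof.
move=> [iF F0] F1 F2 r1 r2; elim: k => [|k IH] [|n] f.
- by exists 0; apply: F0.
- by exists f; rewrite expr0 mulr1 subrr; apply: id0.
- by exists 0; apply: F0.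
move=> [c Fc].
have [h Fh] : fadj F g1 n.+1 f.
  by apply: r2; exists (c * g1 ^+ k); rewrite -mulrA -exprSr.
have : fadj F (g1 ^+ k) n.+1 (g2 * h).
  exists c; apply: r1.
  rewrite (_ : g1 * _ = (g2 * f - c * g1 ^+ k.+1) - g2 * (f - h * g1)).
    by apply: idB => //; apply: F2.
  by rewrite exprS; ring.
move=> /IH[c' Fc']; exists c'.
rewrite (_ : f - _ = (f - h * g1) + g1 * (h - c' * g1 ^+ k)).
  by apply: idD => //; apply: F1.
by rewrite exprS; ring.
Qed.

Lemma fregular_swap F g1 g2 : filtration F -> raises F g2 ->
  fregular F g1 -> fregular (fadj F g1) g2 -> fregular (fadj F g2) g1.
Proof.
move=> [iF F0] F2 r1 r2 n f [c Fc].
have [h Fh] : fadj F g1 n c.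
  apply: r2; exists f; rewrite (_ : _ - _ = - (g1 * f - c * g2)); last by ring.
  exact: idN.
exists h; apply: r1.
rewrite (_ : _ * _ = (g1 * f - c * g2) + g2 * (c - h * g1)); last by ring.
by apply: idD => //; apply: F2.
Qed.

(** Write f = h g1 modulo the filtration and cancel g1: the condition on h sits one degree lower.
    Induction on n takes the place of the usual Nakayama argument. *)
Lemma fregular_second F g1 g2 : filtration F -> raises F g1 -> raises F g2 ->
  fregular F g1 -> fregular (fadj F g1) g2 -> fregular F g2.
Proof.
move=> [iF F0] F1 F2 r1 r2; elim=> [|n IH] f Ff; first exact: F0.
have [h Fh] : fadj F g1 n.+1 f by apply: r2; apply: sub_adj.
apply: (idBl (iF _) _ Fh); rewrite mulrC; apply: (F1); apply: IH; apply: r1.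
rewrite (_ : _ * _ = g2 * f - g2 * (f - h * g1)); last by ring.
by apply: idB => //; apply: F2.
Qed.

Lemma fregular_exp F t k n f : fregular F t -> F (n + k)%N (t ^+ k * f) -> F n f.
Proof.
move=> rt; elim: k n f => [|k IH] n f; first by rewrite addn0 expr0 mul1r.
by rewrite exprS -mulrA addnS => /rt; apply: IH.
Qed.

Lemma raises_exp F t k n x : raises F t -> F n x -> F (n + k)%N (t ^+ k * x).
Proof.
move=> Ft Fx; elim: k => [|k IH]; first by rewrite addn0 mul1r.
by rewrite exprS -mulrA addnS; apply: Ft.
Qed.

End FilterRegular.

(** * The Huneke-Itoh argument and the length comparison *)

(** Here h is the quotient of l by q + 1. The summand q on the right, supplied by the multiplier u,
    absorbs the remainder. *)
Lemma order_count (q i l h : nat) : (l <= q.+2 * i)%N -> (h < i)%N ->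
  (l <= q.+1 * h + q)%N ->
  ((2 * q + 3) * i <= q + 2 * (q.+2 * i - l) + l + q * h)%N.
Proof.
move=> lm hi lh.
have e1 : (q.+2 * i = q * i + 2 * i)%N by ring.
have e2 : (q.+1 * h = q * h + h)%N by ring.
have e3 : ((2 * q + 3) * i = 2 * (q * i) + 3 * i)%N by ring.
by rewrite e1 e2 e3 in lm lh *; lia.
Qed.

Section HunekeItoh.
Variables (R : comNzRingType) (r s : nat) (a : 'I_r -> R) (b : 'I_s -> R).
Variable N : R -> Prop.
Hypotheses (iN : is_ideal N) (ab : forall i, gpow b 1 (a i)).
Variables (c0 k n0 : nat).
Hypotheses (rc : reduces a b c0) (clos : forall n, (n0 <= n)%N -> almost_closed b N n).
Hypothesis (n0k : (n0 <= k)%N).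

Lemma fil_ab n : sset (fil a N n) (fil b N n).
Proof. by apply: ideal_add_le => //; apply: gpow_sub. Qed.

Lemma fil_reduces E : sset (fil b N (c0 + E)) (fil a N E).
Proof.
apply: ideal_add_le => // z; apply: (reduces_ind rc); first exact: gpowP.
by move=> u v au _; apply: idMr => //; apply: gpowP.
Qed.

(* If a_1, a_2 have order at least k * q / (q + 1) then expanding
   (t_1^k a_1)^m = (B - t_2^k a_2)^m and cancelling t_1^(k m) modulo a power of
   t_2 improves the order of a_1 to k * (q + 1) / (q + 2). *)
Lemma order_improve t1 t2 a1 a2 q : gpow a 1 t1 -> gpow a 1 t2 ->
  (forall j, fregular (fadj (fil a N) (t2 ^+ j)) t1) ->
  fil b N (2 * k) (t1 ^+ k * a1 + t2 ^+ k * a2) ->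
  fil b N (k * q) (a2 ^+ q.+1) -> fil b N (k * q.+1) (a1 ^+ q.+2).
Proof.
move=> at1 at2 r1 fB f2.
have fP n := filP b iN n; have faP n := filP a iN n.
(* Of the multiplier's order, c0 pays for passing from powers of b to powers of a, and k q for
   rounding l down to a multiple of q + 1. *)
apply: (clos (n := (k * q.+1)%N) _ (c := (c0 + k * q)%N)).
  by rewrite (leq_trans n0k) // leq_pmulr.
move=> i u bu; rewrite -exprM.
set m := (q.+2 * i)%N; set B := _ + _ in fB.
have ft2 j : fil a N j (t2 ^+ j).
  by have := filX iN j (gpow_fil (iN) at2); rewrite mul1n.
have E1 : (t1 ^+ k) ^+ m * a1 ^+ m = \sum_(l < m.+1)
    (B ^+ (m - l) * (- (t2 ^+ k * a2)) ^+ l) *+ 'C(m, l).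
  by rewrite -exprDn -exprMn /B addrK.
have : adj (fil a N (k * (2 * q + 3) * i)) (t2 ^+ (k * (q.+1 * i)))
    (t1 ^+ (k * m) * (u * a1 ^+ m)).
  have iA : is_ideal (adj (fil a N (k * (2 * q + 3) * i)) (t2 ^+ (k * (q.+1 * i)))).
    exact: adjP.
  rewrite (exprM t1) [_ ^+ m * _]mulrCA E1 mulr_sumr; apply: id_sum => // l _.
  rewrite mulrnAr -mulr_natr; apply: idMr => //.
  rewrite exprNn exprMn -exprM [B ^+ _ * _]mulrCA mulrCA; apply: idM => //.
  (* Terms with l >= (q+1) i are multiples of the chosen power of t2. In the others B, t2^k and a2
     contribute the orders 2k (m - l), k l and k q h. *)
  have [ls|ls] := ltnP l (q.+1 * i); last first.
    rewrite (_ : (k * l = k * (q.+1 * i) + k * (l - q.+1 * i))%N); last first.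
      by rewrite -mulnDr subnKC.
    by rewrite exprD; exists (u * (B ^+ (m - l) * (t2 ^+ (k * (l - q.+1 * i)) * a2 ^+ l)));
      rewrite (_ : _ - _ = 0); [apply: id0|ring].
  apply: sub_adj; apply: fil_reduces.
  pose h := (l %/ q.+1)%N.
  have ha : fil b N (k * q * h) (a2 ^+ l).
    rewrite (divn_eq l q.+1) exprD [(_ %/ _ * _)%N]mulnC exprM; apply: (idMr (fP _)).
    by rewrite -/h; apply: filX.
  have ft2b : fil b N (k * l) (t2 ^+ (k * l)) by apply: fil_ab.
  have := filM iN (gpow_fil iN bu) (filM iN (filX iN (m - l) fB) (filM iN ft2b ha)).
  apply: fil_le.
  have hi : (h < i)%N by rewrite ltn_divLR // mulnC.
  have lh : (l <= q.+1 * h + q)%N.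
    by rewrite {1}(divn_eq l q.+1) mulnC leq_add2l -ltnS ltn_mod.
  have lm : (l <= m)%N by rewrite -ltnS ltn_ord.
  have -> : (c0 + k * q + (2 * k * (m - l) + (k * l + k * q * h)) =
      c0 + k * (q + 2 * (m - l) + l + q * h))%N by ring.
  rewrite leq_add2l -mulnA leq_mul2l; apply/orP; right.
  exact: order_count.
(* Cancelling t1^(k m) leaves order k (q+1) i, which is also the order of the remaining multiple of
   t2^(k (q+1) i). *)
rewrite (_ : (k * (2 * q + 3) * i = k * q.+1 * i + k * m)%N); last by rewrite /m; ring.
move=> /(fregular_exp (r1 _)); rewrite mulnA => -[e fe].
apply: fil_ab; apply: (idBl (faP _)) fe.
by apply: idM.
Qed.

Lemma huneke_itoh t1 t2 a1 a2 : gpow a 1 t1 -> gpow a 1 t2 ->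
  (forall j, fregular (fadj (fil a N) (t2 ^+ j)) t1) ->
  (forall j, fregular (fadj (fil a N) (t1 ^+ j)) t2) ->
  fil b N (2 * k) (t1 ^+ k * a1 + t2 ^+ k * a2) ->
  fil b N k a1 /\ fil b N k a2.
Proof.
move=> at1 at2 r1 r2 fB.
have H q : fil b N (k * q) (a1 ^+ q.+1) /\ fil b N (k * q) (a2 ^+ q.+1).
  elim: q => [|q [f1 f2]]; first by rewrite muln0; split; apply: gpow_fil.
  split; first exact: (order_improve at1 at2 r1 fB f2).
  by rewrite addrC in fB; apply: (order_improve at2 at1 r2 fB f1).
suff main x : (forall q, fil b N (k * q) (x ^+ q.+1)) -> fil b N k x.
  by split; apply: main => q; case: (H q).
(* The missing factor b^k in x^(q+1) is supplied by the multiplier, so x is almost integral over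
   b^k. *)
move=> fx; apply: (clos n0k (c := k)) => -[|i] u bu.
  by rewrite muln0; apply: gpow_fil.
by rewrite mulnS; apply: filM => //; apply: gpow_fil.
Qed.

End HunekeItoh.

Section LengthInequality.
Variables (U : comNzRingType) (p N : U -> Prop) (r s : nat).
Variables (a : 'I_r -> U) (b : 'I_s -> U).
Hypotheses (pP : is_prime p) (iN : is_ideal N) (ab : forall i, gpow b 1 (a i)).
Variables (c0 k n0 : nat).
Hypotheses (rc : reduces a b c0) (clos : forall n, (n0 <= n)%N -> almost_closed b N n).
Hypothesis (n0k : (n0 <= k)%N).
Variables (t1 t2 t3 : U).
Hypotheses (at1 : gpow a 1 t1) (at2 : gpow a 1 t2) (at3 : gpow a 1 t3).
Local Notation F := (fil a N).
Local Notation G := (fil b N).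
Hypotheses (r1 : fregular F t1) (r2 : fregular (fadj F t1) t2).
Hypotheses (r3 : fregular (fadj (fadj F t1) t2) t3).
Local Notation y1 := (t1 ^+ k).
Local Notation y2 := (t2 ^+ k).
Local Notation y3 := (t3 ^+ k).

Lemma fil_filtration q (x : 'I_q -> U) : filtration (fil x N).
Proof. by split=> [n|z]; [apply: filP|apply: gpow_fil]. Qed.

Lemma fil_raises t : gpow a 1 t -> raises F t.
Proof.
by move=> at_ n x Fx; rewrite -add1n; apply: filM => //; apply: gpow_fil.
Qed.

Let fF : filtration F. Proof. exact: fil_filtration. Qed.
Let u1 : raises F t1. Proof. exact: fil_raises. Qed.
Let u2 : raises F t2. Proof. exact: fil_raises. Qed.
Let u3 : raises F t3. Proof. exact: fil_raises. Qed.

Let r21 : fregular (fadj F t2) t1. Proof. exact: fregular_swap r1 r2. Qed.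

Let r1k2 j : fregular (fadj F (t1 ^+ j)) t2.
Proof. exact: fregular_pow r1 r2. Qed.

Lemma fregular_12 : fregular (fadj F y1) t2. Proof. exact: r1k2. Qed.

Lemma fregular_123 : fregular (fadj (fadj F y1) y2) t3.
Proof.
apply: fregular_pow (fregular_12) _.
- exact: filtration_adj.
- exact: raises_adj.
- exact: raises_adj.
rewrite fadjC; apply: fregular_pow r21 _.
- exact: filtration_adj.
- exact: raises_adj.
- exact: raises_adj.
by rewrite fadjC.
Qed.

Let r2k1 j : fregular (fadj F (t2 ^+ j)) t1.
Proof. apply: fregular_pow => //; exact: fregular_second r1 r2. Qed.

Let iF n : is_ideal (F n). Proof. exact: filP. Qed.
Let iG n : is_ideal (G n). Proof. exact: filP. Qed.

Let fy n x t : gpow a 1 t -> F n x -> F (n + k)%N (t ^+ k * x).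
Proof. by move=> /fil_raises ut; apply: raises_exp. Qed.

Let gy n x t : gpow a 1 t -> G n x -> G (n + k)%N (t ^+ k * x).
Proof.
move=> at_ Gx; rewrite addnC; apply: filM => //; apply: gpow_fil => //.
by apply: gpow_sub => //; have := gpowX k at_; rewrite mul1n.
Qed.

(** The Koszul comparison is unrolled into successive colon sequences for y1, y2, y3. Regularity
    bounds the colons taken from 3k by ideals at 2k; those taken from 2k contain F_k trivially. *)
Lemma len_upper H1 H2 H3 z : haslen p H1 (F k) -> haslen p H2 (F (k + k)) ->
  haslen p H3 (F (k + k + k)) ->
  haslen p z (adj (adj (adj (F (k + k + k)) y1) y2) y3) -> (z + 3 * H2 <= H3 + 3 * H1)%N.
Proof.
move=> h1 h2 h3 hz.
have [B3 [P3 [b3 p3 E3]]] := haslen_adj pP y1 (iF _) h3.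
have [B2 [P2 [b2 p2 E2]]] := haslen_adj pP y1 (iF _) h2.
have [C3 [Q3 [c3 q3 E3']]] := haslen_adj pP y2 (adjP y1 (iF _)) p3.
have [C2 [Q2 [c2 q2 E2']]] := haslen_adj pP y2 (adjP y1 (iF _)) p2.
have [D [z' [hd hz' E]]] := haslen_adj pP y3 (adjP y2 (adjP y1 (iF _))) q3.
rewrite (haslen_inj hz hz').
have l1 : (H2 <= B3)%N.
  by apply: haslen_leq b3 h2 => x; apply: fregular_exp.
have l2 : (B2 <= H1)%N by apply: haslen_leq h1 b2 => x Fx; apply: fy.
have l3 : (P2 <= C3)%N.
  by apply: haslen_leq c3 p2 => x; apply: (fregular_exp fregular_12).
have l4 : (C2 <= H1)%N.
  by apply: haslen_leq h1 c2 => x Fx; apply: sub_adj; apply: fy.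
have l5 : (Q2 <= D)%N.
  by apply: haslen_leq hd q2 => x; apply: (fregular_exp fregular_123).
lia.
Qed.

(** All inclusions are reversed: colons taken from 3k contain the ideals at 2k trivially, and
    [huneke_itoh] is needed for the two colons taken from 2k. *)
Lemma len_lower H1 H2 H3 z : haslen p H1 (G k) -> haslen p H2 (G (k + k)) ->
  haslen p H3 (G (k + k + k)) ->
  haslen p z (adj (adj (adj (G (k + k + k)) y1) y2) y3) -> (H3 + 3 * H1 <= z + 3 * H2)%N.
Proof.
move=> h1 h2 h3 hz.
have hi x y : G (k + k) (y1 * x + y2 * y) -> G k x /\ G k y.
  rewrite addnn -mul2n; exact: (huneke_itoh iN ab rc clos n0k at1 at2 r2k1 r1k2).
have [B3 [P3 [b3 p3 E3]]] := haslen_adj pP y1 (iG _) h3.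
have [B2 [P2 [b2 p2 E2]]] := haslen_adj pP y1 (iG _) h2.
have [C3 [Q3 [c3 q3 E3']]] := haslen_adj pP y2 (adjP y1 (iG _)) p3.
have [C2 [Q2 [c2 q2 E2']]] := haslen_adj pP y2 (adjP y1 (iG _)) p2.
have [D [z' [hd hz' E]]] := haslen_adj pP y3 (adjP y2 (adjP y1 (iG _))) q3.
rewrite (haslen_inj hz hz').
have adjy t n y x : gpow a 1 t -> adj (G n) y x -> adj (G (n + k)) y (t ^+ k * x).
  move=> at_ [c Gc]; exists (t ^+ k * c); rewrite -mulrA -mulrBr; exact: gy.
have l1 : (B3 <= H2)%N by apply: haslen_leq h2 b3 => x Gx; apply: gy.
have l2 : (H1 <= B2)%N.
  apply: haslen_leq b2 h1 => x Gx; apply: (proj1 (hi x 0 _)).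
  by rewrite mulr0 addr0.
have l3 : (C3 <= P2)%N by apply: haslen_leq p2 c3 => x Gx; apply: adjy.
have l4 : (H1 <= C2)%N.
  apply: haslen_leq c2 h1 => x [c Gx]; apply: (proj2 (hi (- c) x _)).
  by rewrite mulrN [y1 * c]mulrC addrC.
have l5 : (D <= Q2)%N.
  apply: haslen_leq q2 hd => x [c Gx]; exists (y3 * c).
  by rewrite -mulrA -mulrBr; apply: adjy.
lia.
Qed.

Lemma len_compare H1 H2 H3 L1 L2 L3 :
  haslen p H1 (F k) -> haslen p H2 (F (k + k)) -> haslen p H3 (F (k + k + k)) ->
  haslen p L1 (G k) -> haslen p L2 (G (k + k)) -> haslen p L3 (G (k + k + k)) ->
  (L3 + 3 * L1 + 3 * H2 <= H3 + 3 * H1 + 3 * L2)%N.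
Proof.
move=> h1 h2 h3 l1 l2 l3.
have hadj n K y : is_ideal K -> haslen p n K -> exists z, haslen p z (adj K y).
  by move=> iK /(haslen_adj pP y iK)[_ [z [_ hz _]]]; exists z.
have [z1 q1] := hadj _ _ y1 (iF _) h3.
have [z2 q2] := hadj _ _ y2 (adjP y1 (iF _)) q1.
have [z3 q3] := hadj _ _ y3 (adjP y2 (adjP y1 (iF _))) q2.
have [w1 v1] := hadj _ _ y1 (iG _) l3.
have [w2 v2] := hadj _ _ y2 (adjP y1 (iG _)) v1.
have [w3 v3] := hadj _ _ y3 (adjP y2 (adjP y1 (iG _))) v2.
have := len_upper h1 h2 h3 q3; have := len_lower l1 l2 l3 v3.
have : (w3 <= z3)%N.
  by apply: haslen_leq q3 v3; do 3!apply: adj_le; apply: fil_ab.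
lia.
Qed.

End LengthInequality.

(** * The grade of the associated graded ring *)

Section PrimeChains.
Variable R : comNzRingType.
Hypothesis nR : noetherian R.
Implicit Types (K N P M : R -> Prop).

Lemma prime_below P K f : is_prime P -> is_ideal K ->
  (forall s e, ~ P s -> ~ K (s * f ^+ e)) ->
  exists Q, [/\ is_prime Q, sset K Q, sset Q P & ~ Q f].
Proof.
move=> pP iK sK.
pose S x := exists s e, ~ P s /\ x = s * f ^+ e.
have P1 : ~ P 1 by case: pP.
have [|_ _ [s [e [Ps ->]]] [t [e' [Pt ->]]]|_ [s [e [Ps ->]]]|Q [pQ KQ SQ]] :=
  @prime_avoiding R nR K S iK.
- by exists 1, 0%N; rewrite expr0 mulr1.
- exists (s * t), (e + e')%N; rewrite exprD mulrACA; split=> //.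
  exact: (prime_mul_notin pP).
- exact: sK.
exists Q; split=> //.
  move=> x Qx; apply: NNPP => Px; apply: (SQ x) => //.
  by exists x, 0%N; rewrite expr0 mulr1.
by apply: SQ; exists 1, 1%N; rewrite expr1 mul1r.
Qed.

Lemma prime_chain_rcons N C l P : prime_chain N C l -> is_prime P ->
  sstrict (C l) P -> prime_chain N (fun i => if (i <= l)%N then C i else P) l.+1.
Proof.
move=> [NC [pC sC]] pP CP; split; first by [].
split=> [i _|i]; first by case: ifP => // il; apply: pC.
rewrite ltnS => il; rewrite il; case: ltnP => [li|li]; first exact: sC.
by have -> : i = l by apply/eqP; rewrite eqn_leq il.
Qed.

(** As f is regular modulo the preceding elements, some prime below P contains them and avoids f;
    the chain is built downwards from P. *)
Lemma regl_prime_chain N fs P : is_ideal N -> regl N fs -> is_prime P ->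
  sset (adjl N fs) P -> exists C, prime_chain N C (size fs) /\ C (size fs) = P.
Proof.
move=> iN; elim/last_ind: fs P => [|fs f IH] P rN pP NP.
  by exists (fun=> P); split=> //; split.
move: rN; rewrite regl_rcons => -[rN fN].
have iA := adjlP fs iN.
have [|Q [pQ NQ QP Qf]] := @prime_below P (adjl N fs) f pP iA.
  move=> s e Ps; rewrite mulrC => /(nzdX fN) Ns; apply: Ps; apply: NP.
  by rewrite adjl_rcons; apply: sub_adj.
have [C [cC CE]] := IH Q rN pQ NQ.
exists (fun i => if (i <= size fs)%N then C i else P); rewrite size_rcons ltnn.
split=> //; apply: prime_chain_rcons => //; rewrite CE; split=> // PQ.
by apply: Qf; apply: PQ; apply: NP; rewrite adjl_rcons; apply: adj_mem.
Qed.

(** Otherwise a prime below M would contain fs and avoid g, and its chain extended by M would be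
    longer than the height. *)
Lemma height_radical N M fs g : is_ideal N -> is_prime M -> regl N fs ->
  sset (adjl N fs) M -> height N M (size fs) -> M g ->
  exists s e, ~ M s /\ adjl N fs (s * g ^+ e).
Proof.
move=> iN pM rN NM [_ hmax] Mg; apply: NNPP => nse.
have [|P [pP NP PM Pg]] := @prime_below M (adjl N fs) g pM (adjlP fs iN).
  by move=> s e Ms Ns; apply: nse; exists s, e.
have [C [cC CE]] := regl_prime_chain iN rN pP NP.
have CM : sstrict (C (size fs)) M by rewrite CE; split=> // MP; apply: Pg; apply: MP.
have /= := hmax _ _ (prime_chain_rcons cC pM CM); rewrite ltnn.
by move=> H; have : false by apply: H.
Qed.

Lemma lenge_psub p n K L s : is_prime p -> ~ p s -> (forall x, K x -> L (s * x)) ->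
  lenge p n L -> lenge p n K.
Proof.
move=> pP ps; elim: n K L => //= n IH K L KL [g gL gn]; exists g.
  move=> t pt /KL; rewrite mulrA; apply: gL.
  exact: prime_mul_notin.
apply: IH gn => x [c Kc]; exists (s * c).
by rewrite -mulrA -mulrBr; apply: KL.
Qed.

Lemma height_finite_length N M fs : is_ideal N -> is_prime M -> regl N fs ->
  sset (adjl N fs) M -> height N M (size fs) -> exists C, lenle M C (adjl N fs).
Proof.
move=> iN pM rN NM hM; have iA := adjlP fs iN.
have iM : is_ideal M by case: pM.
have [gs gE] := noetherian_fg nR iM.
have [s [e [Ms se]]] : exists s e, ~ M s /\ forall g, g \in gs -> adjl N fs (s * g ^+ e).
  have : forall g, g \in gs -> M g.
    by move=> g gg; rewrite gE; apply: adjl_mem => //; apply: zero_ideal_ideal.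
  elim: (gs) => [_|g l IH Ml]; first by exists 1, 0%N; split=> //; case: pM.
  have [|s [e [Ms se]]] := IH; first by move=> x xl; apply: Ml; rewrite inE xl orbT.
  have [t [e' [Mt te]]] := height_radical iN pM rN NM hM (Ml g (mem_head g l)).
  exists (s * t), (e + e')%N; split; first exact: (prime_mul_notin pM).
  move=> x; rewrite inE exprD mulrACA => /predU1P[->|/se]; first exact: idM.
  exact: idMr.
have i0 := @zero_ideal_ideal R.
exists (e ^ size gs * 1)%N => k /(lenge_psub pM Ms) kk.
suff M1 : lenle M 1 (adjl (@zero_ideal R) gs).
  apply: (lenle_adjlX pM i0 M1 (n := e)); apply: kk => x.
  suff : sset (adjl (@zero_ideal R) [seq g ^+ e | g <- gs]) (colon (adjl N fs) s).
    by apply.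
  apply: adjl_min; first exact: colonP.
    by move=> y ->; apply: id0; apply: colonP.
  by move=> _ /mapP[g gg ->]; apply: se.
rewrite -gE; apply: lenle1 => // g Mg; exists 1; first by case: pM.
by rewrite mul1r.
Qed.

End PrimeChains.

(** * Local rings and the comparison of the two notions of length *)

Section LocalRing.
Variables (A : comNzRingType) (m : A -> Prop).
Hypotheses (nA : noetherian A) (lA : local_ring m).
Implicit Types (K : A -> Prop).

Lemma local_ideal : is_ideal m. Proof. by case: lA => -[]. Qed.

Lemma local_unit s : ~ m s -> exists t, t * s = 1.
Proof.
move=> ms; apply: NNPP => nt.
have iS := adjP s (@zero_ideal_ideal A).
have [|//|Q [[iQ Q1] sQ maxQ]] :=
  @noetherian_max A nA (fun K => is_ideal K /\ ~ K 1) (adj (@zero_ideal A) s).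
- by move=> K [].
- split=> // -[c]; rewrite /zero_ideal => /eqP; rewrite subr_eq0 => /eqP c1.
  by apply: nt; exists c.
apply: ms; apply/(proj2 lA Q); last by apply: sQ; apply: adj_mem; apply: zero_ideal_ideal.
split=> // L iL QL; have [L1|L1] := classic (L 1); [by left|right].
by apply: maxQ.
Qed.

Lemma local_prime : is_prime m.
Proof.
have [[im m1 _] _] := lA; split=> // x y mxy.
apply: NNPP => /not_or_and[/local_unit[u ux] my].
by apply: my; rewrite -[y]mul1r -ux -mulrA; apply: idM.
Qed.

Lemma local_notin K s g : is_ideal K -> ~ m s -> K (s * g) -> K g.
Proof.
move=> iK /local_unit[t ts] Ks.
by rewrite -[g]mul1r -ts -mulrA; apply: idM.
Qed.

Lemma chain_lenge K C l : is_ideal K -> sset K (C 0%N) ->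
  (forall i, (i <= l)%N -> is_ideal (C i)) ->
  (forall i, (i < l)%N -> sstrict (C i) (C i.+1)) -> lenge m l K.
Proof.
elim: l K C => //= l IH K C iK KC iC sC.
have [C01 nC10] := sC 0%N isT.
have [g gC] := not_all_ex_not _ _ nC10; have [C1g C0g] := imply_to_and _ _ gC.
exists g => [s ms Ks|].
  by apply: C0g; apply: KC; apply: local_notin Ks.
apply: (IH _ (C \o succn)); first exact: adjP.
- by apply: adj_min => //; [apply: iC|move=> x /KC/C01].
- by move=> i il; apply: iC.
- by move=> i il; apply: sC.
Qed.

Lemma lenge_chain k K : is_ideal K -> lenge m k K -> exists C,
  [/\ C 0%N = K, forall i, (i <= k)%N -> is_ideal (C i)
    & forall i, (i < k)%N -> sstrict (C i) (C i.+1)].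
Proof.
elim: k K => [|k IH] K iK /=; first by exists (fun=> K).
move=> [g gK gk]; have [C [C0 iC sC]] := IH _ (adjP g iK) gk.
exists (fun i => if i is i'.+1 then C i' else K); split=> // [[|i]|[|i]] //.
- exact: iC.
- move=> _; rewrite C0; split; first exact: sub_adj.
  move=> /(_ g (adj_mem g iK)) Kg; apply: (gK 1); last by rewrite mul1r.
  by case: lA => -[].
- exact: sC.
Qed.

Lemma length_haslen K l : is_ideal K -> length_eq K l -> haslen m l K.
Proof.
move=> iK [[C [C0 [_ [iC sC]]]] lmax]; split.
  by apply: chain_lenge iC sC => // x /C0.
move=> k /(lenge_chain iK)[D [D0 iD sD]].
have [Dw|Dw] := classic (seqv (D k) (@whole A)).
  by apply: (lmax D); split; first by rewrite D0; split.
(* A chain that stops short of the whole ring becomes admissible, and one step longer, by appending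
   it. *)
apply: ltnW; apply: (lmax (fun i => if (i <= k)%N then D i else @whole A)).
split; first by rewrite D0; split.
rewrite ltnn; split; first by split.
split=> [i _|i]; first by case: ifP => [/iD|] // _; apply: whole_ideal.
rewrite ltnS => ik; rewrite ik; case: ltnP => [ik'|ik']; first exact: sD.
split=> // wD; apply: Dw => x; split=> // _.
by have <- : i = k; [apply/eqP; rewrite eqn_leq ik|apply: wD].
Qed.

End LocalRing.

Lemma adjl_mkseq (R : comNzRingType) (N : R -> Prop) x i : is_ideal N ->
  ideal_add N (gen_ideal i x) = adjl N (mkseq x i).
Proof.
move=> iN; elim: i => [|i IH].
  apply: sset_eq => z; last by move=> Nz; exists z, 0; split; rewrite ?addr0 //;
    exists (fun=> 0); rewrite big_ord0.
  by move=> [u [v [Nu [c]]]]; rewrite big_ord0 => -> ->; rewrite addr0.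
rewrite mkseqS adjl_rcons -IH; apply: sset_eq => z.
  move=> [u [_ [Nu [c ->] ->]]]; exists (c i); exists u, (\sum_(j < i) c j * x j).
  split=> //; first by exists c.
  by rewrite big_ord_recr /= addrA addrK.
move=> [e [u [_ [Nu [c ->] zE]]]].
exists u, (\sum_(j < i) c j * x j + e * x i); split=> //.
  exists (fun j => if (j < i)%N then c j else e); rewrite big_ord_recr /= ltnn.
  by congr (_ + _); apply: eq_bigr => j _; rewrite ltn_ord.
by rewrite addrA -zE subrK.
Qed.

Lemma regular_seq_regl (R : comNzRingType) (N Q : R -> Prop) x k : is_ideal N ->
  regular_seq N Q x k -> regl N (mkseq x k).
Proof.
move=> iN [_ xN _]; elim: k xN => // k IH xN.
rewrite mkseqS regl_rcons; split; first by apply: IH => i ik; apply: xN; apply: leqW.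
by move=> y; rewrite -adjl_mkseq //; apply: xN.
Qed.

(** * Growth of Hilbert functions *)

Section Growth.

Lemma nabla_growth j H : eventually (fun n => 0 < iter j nabla H n)%N ->
  exists n1, forall n, ('C(n, j) <= H (n1 + n))%N.
Proof.
elim: j H => [|j IH] H.
  by move=> [n0 Hn]; exists n0 => n; rewrite bin0; apply: Hn; rewrite leq_addr.
rewrite -/(iter j.+1 nabla H) => -[n0 Hn].
have [|n1 Hn1] := IH (nabla H); first by exists n0 => n; rewrite -iterSr; apply: Hn.
exists n1; elim=> [|n IHn] //.
have [nj|jn] := ltnP n.+1 j.+1; first by rewrite bin_small.
have Cj : (0 < 'C(n.+1, j))%N by rewrite bin_gt0 ltnW.
have Cle : ('C(n, j) <= 'C(n.+1, j))%N by apply: leq_bin2l.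
by have := Hn1 n.+1; rewrite /nabla addnS binS /=; lia.
Qed.

Lemma bin_outgrows h D n1 : exists n, (D * (n1 + n) ^ h < 'C(n, h.+1))%N.
Proof.
have fle x k : (x ^ k <= (k.-1 + x) ^_ k)%N.
  case: k => // k; rewrite /=.
  elim: k x => [|k IH] x; first by rewrite expn1 ffactn1.
  rewrite expnS addSn ffactSS; apply: leq_mul; last exact: IH.
  by apply: leqW; rewrite leq_addl.
(* x exceeds n1 + h, so n1 + n <= 2 x for n = h + x; it also exceeds (h+1)! D 2^h, so x^(h+1) beats
   the bound. *)
pose x := (h.+1`! * D * 2 ^ h + n1 + h).+1.
exists (h + x)%N.
rewrite -(ltn_pmul2r (fact_gt0 h.+1)) bin_ffact.
apply: leq_trans (fle x h.+1); rewrite expnS.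
apply: (@leq_ltn_trans (h.+1`! * D * 2 ^ h * x ^ h)).
  rewrite mulnC mulnA -[X in (_ <= X)%N]mulnA -expnMn leq_mul2l; apply/orP; right.
  have [->|h0] := posnP h; first by rewrite !expn0.
  by rewrite leq_exp2r // /x; lia.
by rewrite ltn_pmul2r ?expn_gt0 //; rewrite /x; lia.
Qed.

Definition hilbert_state r k (H : nat -> nat) :=
  exists (U : comNzRingType) (p N : U -> Prop) (a : 'I_r -> U) (ws : seq U),
  [/\ noetherian U, is_prime p, is_ideal N, sset N p & forall i, p (a i)] /\
  [/\ regl N ws, forall w, w \in ws -> torsion a N w, size ws = k
    & eventually (fun n => haslen p (H n) (fil a N n))].

Lemma hilbert_state_step r k H : hilbert_state r k.+1 H -> hilbert_state r k (nabla H).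
Proof.
move=> [U [p [N [a [ws [[nU pP iN Np pa] [rN tN sw hH]]]]]]].
have [u au uN] : exists2 u, gpow a 1 u & nzd N u.
  case: ws sw rN tN => //= w ws _ [wN _] tN.
  by apply: torsion_nzd wN => //; apply: tN; rewrite mem_head.
case/lastP: ws => [|ws w] in sw rN tN *; first by [].
have ip : is_ideal p by case: pP.
exists {mpoly U[r]}, (ext p), (adj (ext N) (gx a)), (fun i => (a i)%:MP),
  [seq x%:MP | x <- ws].
split; split.
- exact: noetherian_mpoly.
- exact: ext_prime.
- by apply: adjP; apply: extP.
- apply: adj_min; [exact: extP|exact: ext_le|].
  apply: id_sum => [|i _]; first exact: extP.
  by apply: (idMr (extP r ip)); apply/extC.
- by move=> i; apply/extC.
- by case: (gx_regl iN rN tN).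
- move=> _ /mapP[x xw ->]; apply: (@torsion_sub _ _ _ (ext N)); first exact: sub_adj.
  by apply: torsion_ext => //; apply: tN; rewrite mem_rcons inE xw orbT.
- by move: sw; rewrite size_rcons size_map => -[].
- have ra : reduces a a 0 by move=> n _.
  exact: (hilbert_step nU pP iN (gpow1 a) ra au uN hH).
Qed.

Lemma hilbert_state_pos r k H : hilbert_state r k H -> eventually (fun n => 0 < H n)%N.
Proof.
move=> [U [p [N [a [ws [[nU pP iN Np pa] [_ _ _ [n0 hH]]]]]]]].
have ip : is_ideal p by case: pP.
exists n0.+1 => -[|n] // nn; apply: (proj2 (hH _ (ltnW nn))); apply: lenge1.
apply: ideal_add_sub => //; apply: isum_min => // i z _.
exact: idM.
Qed.

Lemma hilbert_state_growth r d h D H : hilbert_state r d H ->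
  (forall n, (H n <= D * n ^ h)%N) -> (d <= h)%N.
Proof.
move=> hd HD; rewrite leqNgt; apply/negP => hd'.
have hk : forall j k H', hilbert_state r (j + k) H' -> hilbert_state r k (iter j nabla H').
  elim=> [|j IH] k H' //; rewrite addSn => /hilbert_state_step /IH.
  by rewrite -iterSr.
have := hk h.+1 (d - h.+1)%N H; rewrite subnKC // => /(_ hd)/hilbert_state_pos.
move=> /nabla_growth[n1 Hn1].
have [n] := bin_outgrows h D n1.
by rewrite ltnNge => /negP; apply; apply: leq_trans (Hn1 n) (HD _).
Qed.

End Growth.

(** * The graded ring at its irrelevant maximal ideal *)

Section GradedRing.
Variables (A : comNzRingType) (m I : A -> Prop) (r : nat) (a : 'I_r -> A).
Hypotheses (nA : noetherian A) (lA : local_ring m).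
Hypotheses (mI : m_primary m I) (aI : I = gpow a 1).
Local Notation V := {mpoly A[r]}.
Local Notation X := (fun i => 'X_i : V).

Definition gr_ker (F : V) := forall k, gpow a k.+1 (rees a F)`_k.

Definition irrelevant (F : V) := m F@_0%MM.

Lemma gr_kerP : is_ideal gr_ker.
Proof.
split.
- by move=> k; rewrite rmorph0 coef0; apply: (id0 (gpowP a k.+1)).
- by move=> F G NF NG k; rewrite rmorphD coefD; apply: (idD (gpowP a k.+1)).
- move=> F G NG k; rewrite rmorphM coefM; apply: (id_sum (gpowP a k.+1)) => i _.
  rewrite -{1}(subnKC (ltn_ord i : i <= k)%N) -addnS.
  by apply: gpowM => //; apply: rees_coef.
Qed.

Lemma rees_coef0 (F : V) : (rees a F)`_0 = F@_0%MM.
Proof.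
move: F; apply: mpoly_ring_ind => [c|i|F G|F G].
- by rewrite reesC coefC mcoeffC eqxx mulr1.
- by rewrite reesX coefMX mcoeffX mnm1_eq0.
- by rewrite rmorphD coefD mcoeffD => -> ->.
- by rewrite rmorphM coefM big_ord1 subn0 (rmorphM (mcoeff 0%MM)) => -> ->.
Qed.

Lemma reesXm k : rees a 'X_[k] = (mmap1 a k)%:P * 'X^(mdeg k).
Proof.
rewrite /rees mmapX (mmap1_eq (f2 := fun i => 'X * (a i)%:P)) => [|i]; last first.
  by rewrite mulrC.
rewrite mmap1_scale mulrC; congr (_ * _); rewrite /mmap1 rmorph_prod.
by apply: eq_bigr => i _; rewrite rmorphXn.
Qed.

Lemma pihomog_rees (F : V) k : (pihomog mdeg k F).@[a] = (rees a F)`_k.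
Proof.
move: F; apply: mpolyind => [|c m' F _ _ IH].
  by rewrite pihomog0 meval0 rmorph0 coef0.
rewrite pihomogD mevalD IH rmorphD /= coefD; congr (_ + _).
have -> : rees a (c *: 'X_[m']) = (c * mmap1 a m')%:P * 'X^(mdeg m').
  by rewrite -mul_mpolyC rmorphM /= reesC reesXm mulrA -polyCM.
rewrite linearZ /= pihomogX mevalZ coefCM coefXn eq_sym -mulrA; congr (_ * _).
by case: eqP => _; rewrite ?meval0 ?mevalX ?mulr1 ?mulr0.
Qed.

Lemma gr_kernelE : gr_kernel I a = gr_ker.
Proof.
by apply: sset_eq => F NF k; have := NF k; rewrite pihomog_rees aI ideal_pow_gpow.
Qed.

Lemma I_sub_m x : I x -> m x.
Proof. by move=> Ix; apply/(proj2 mI); exists 1%N; rewrite expr1. Qed.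

Lemma irrelevantP : is_ideal irrelevant.
Proof.
have im := local_ideal lA; rewrite /irrelevant; split.
- by rewrite mcoeff0; apply: id0.
- by move=> F G mF mG; rewrite mcoeffD; apply: idD.
- by move=> F G mG; rewrite (rmorphM (mcoeff 0%MM)); apply: idM.
Qed.

Lemma irrelevantC c : irrelevant c%:MP <-> m c.
Proof. by rewrite /irrelevant mcoeffC eqxx mulr1. Qed.

Lemma irrelevant_prime : is_prime irrelevant.
Proof.
have [im m1 mM] := local_prime nA lA; split; first exact: irrelevantP.
  by rewrite -mpolyC1 irrelevantC.
by move=> F G; rewrite /irrelevant (rmorphM (mcoeff 0%MM)); apply: mM.
Qed.

Lemma irrelevant_maximal : is_maximal irrelevant.
Proof.
have [iP P1 _] := irrelevant_prime; split=> // Q iQ PQ.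
have [QP|QP] := classic (sset Q irrelevant); [by right|left].
have [F QF] := not_all_ex_not _ _ QP; have [{}QF PF] := imply_to_and _ _ QF.
have [t tF] := local_unit nA lA PF.
have : Q (F@_0%MM)%:MP.
  rewrite -[_%:MP](subKr F); apply: idB => //; apply: PQ.
  rewrite /irrelevant mcoeffB mcoeffC eqxx mulr1 subrr.
  by apply: id0; apply: local_ideal lA.
by move=> /(idM iQ t%:MP); rewrite -mpolyCM tF mpolyC1.
Qed.

Lemma gr_ker_irrelevant : sset gr_ker irrelevant.
Proof.
by move=> F /(_ 0%N); rewrite rees_coef0 => aF; apply: I_sub_m; rewrite aI.
Qed.

Lemma mem_gpowX (F : V) : F@_0%MM = 0 -> gpow X 1 F.
Proof.
move=> F0; have iX := gpowP X 1.
rewrite [F]mpolyE big_seq; apply: (id_sum iX) => k kF.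
rewrite -mul_mpolyC; apply: (idM iX).
apply: (@gpow_le _ _ X 1 (mdeg k)).
  rewrite lt0n mdeg_eq0; apply/eqP => k0.
  by move: kF; rewrite k0 mcoeff_msupp F0 eqxx.
by rewrite -(mmap1_id A k); apply: gpow_monomial.
Qed.

(** Some power of f has its constant term in I, and elements of I vanish in degree zero of Gr. *)
Lemma irrelevant_torsion f : irrelevant f -> torsion X gr_ker f.
Proof.
rewrite /irrelevant => /(proj2 mI)[e Ie].
exists e, (f ^+ e - (f@_0%MM ^+ e)%:MP); split.
  by apply: mem_gpowX; rewrite mcoeffB mcoeffC eqxx mulr1 (rmorphXn (mcoeff 0%MM)) subrr.
rewrite subKr => k; rewrite reesC coefC; case: k => [|k] /=.
  by rewrite -[isum _ _]/(gpow a 1) -aI.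
exact: (id0 (gpowP a k.+2)).
Qed.

(** The preimage in V of the ideal of initial forms of K in Gr. *)
Definition initial (K : A -> Prop) (F : V) :=
  forall j, exists c, [/\ K c, gpow a j c & gpow a j.+1 ((rees a F)`_j - c)].

Lemma initialP K : is_ideal K -> is_ideal (initial K).
Proof.
move=> iK; split.
- move=> j; exists 0; rewrite rmorph0 coef0 subr0.
  by split; [exact: id0|exact: (id0 (gpowP a j))|exact: (id0 (gpowP a j.+1))].
- move=> F G KF KG j; have [[c [Kc ac Fc]] [e [Ke ae Ge]]] := (KF j, KG j).
  exists (c + e); split; [exact: idD|exact: (idD (gpowP a j))|].
  by rewrite rmorphD coefD opprD addrACA; apply: (idD (gpowP a j.+1)).
- move=> F G KG j.
  have [c cP] := functional_choice _ KG.
  exists (\sum_(i < j.+1) (rees a F)`_i * c (j - i)%N); split.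
  + by apply: id_sum => // i _; apply: idM => //; case: (cP (j - i)%N).
  + apply: id_sum => [|i _]; first exact: gpowP.
    rewrite -{1}(subnKC (ltn_ord i : i <= j)%N); apply: gpowM; first exact: rees_coef.
    by case: (cP (j - i)%N).
  + rewrite rmorphM coefM -sumrB; apply: (id_sum (gpowP a j.+1)) => i _.
    rewrite -mulrBr -{1}(subnKC (ltn_ord i : i <= j)%N) -addnS.
    by apply: gpowM; [apply: rees_coef|case: (cP (j - i)%N)].
Qed.

Lemma initial_fil n : sset (fil X gr_ker n) (initial (gpow a n)).
Proof.
have iP := initialP (gpowP a n).
apply: ideal_add_sub => // F; last first.
  move=> NF j; exists 0; rewrite subr0; split=> //.
    exact: (id0 (gpowP a n)).
  exact: (id0 (gpowP a j)).
apply: gpow_monomial_ind => // k kn j.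
rewrite mmap1_id reesXm coefCM coefXn; case: eqP => [jk|_].
  exists (mmap1 a k); rewrite mulr1 subrr -{1}kn jk; split.
  - exact: gpow_monomial.
  - exact: gpow_monomial.
  - exact: (id0 (gpowP a (mdeg k).+1)).
exists 0; rewrite mulr0 subr0; split.
- exact: (id0 (gpowP a n)).
- exact: (id0 (gpowP a j)).
- exact: (id0 (gpowP a j.+1)).
Qed.

Lemma lenge_initial k n K : is_ideal K -> sset (gpow a n) K -> lenge m k K ->
  lenge irrelevant k (initial K).
Proof.
elim: k K => //= k IH K iK aK [g gK gk].
have iK' := adjP g iK.
(* The largest order j of an element of K + (g) outside K exists because a^n lies in K. By
   maximality the initial form of u in degree j is new modulo the initial forms of K. *)
have [j [u [K'u au nKu maxj]]] : exists j u, [/\ adj K g u, gpow a j u, ~ K u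
    & forall v, adj K g v -> gpow a j.+1 v -> K v].
  apply: NNPP => nj.
  have all_ j : exists u, [/\ adj K g u, gpow a j u & ~ K u].
    elim: j => [|j [u [K'u au nKu]]].
      exists g; split=> //; first exact: adj_mem.
      move=> Kg; apply: (gK 1); last by rewrite mul1r.
      by case: lA => -[].
    apply: NNPP => nv; apply: nj; exists j, u; split=> // v K'v av.
    by apply: NNPP => nKv; apply: nv; exists v.
  by have [u [_ au]] := all_ n; apply; apply: aK.
have [F FE] := rees_lift au.
exists F => [S mS KS|]; last first.
  apply: lenge_sub (IH _ iK' _ gk); last by move=> x /aK; apply: sub_adj.
  apply: adj_min; first exact: initialP.
    move=> G KG i; have [c [Kc ac Gc]] := KG i.
    by exists c; split=> //; apply: sub_adj.
  move=> i; rewrite FE coefCM coefXn; case: eqP => [->|_].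
    by exists u; rewrite mulr1 subrr; split=> //; apply: (id0 (gpowP a j.+1)).
  exists 0; rewrite mulr0 subr0; split.
  - exact: id0.
  - exact: (id0 (gpowP a i)).
  - exact: (id0 (gpowP a i.+1)).
have [c [Kc ac]] := KS j.
rewrite rmorphM /= FE mulrA coefMXn ltnn subnn coefMC rees_coef0 => sc.
apply: nKu; apply: (local_notin nA lA iK mS).
apply: (idBl iK Kc); apply: maxj => //.
apply: (idB iK'); first exact: idM.
exact: sub_adj.
Qed.

(** Modulo fs the graded ring has finite local length C, and the (e n)-th powers of fs are initial
    forms of a^n. Hence A/a^n has length at most (e n)^h C, where h is the size of fs. *)
Lemma gr_growth fs : regl gr_ker fs -> (forall f, f \in fs -> irrelevant f) ->
  height gr_ker irrelevant (size fs) ->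
  exists D, forall n, lenle m (D * n ^ size fs) (gpow a n).
Proof.
move=> rN Mf hM; have iN := gr_kerP; have pM := irrelevant_prime.
have NM : sset (adjl gr_ker fs) irrelevant.
  by apply: adjl_min Mf; [apply: irrelevantP|apply: gr_ker_irrelevant].
have [C CM] := height_finite_length (noetherian_mpoly (n := r) nA) iN pM rN NM hM.
have [e fe] : exists e, forall f, f \in fs -> fil X gr_ker 1 (f ^+ e).
  move: Mf; elim: (fs) => [_|f l IH Mf]; first by exists 0%N.
  have [|e le] := IH; first by move=> x xl; apply: Mf; rewrite inE xl orbT.
  have [e' [v [Xv Nv]]] := irrelevant_torsion (Mf f (mem_head f l)).
  exists (e + e')%N => x; have iX := filP X iN 1.
  rewrite inE exprD => /predU1P[->|/le]; last exact: (idMr iX).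
  apply: (idM iX); exists v, (f ^+ e' - v); split=> //.
  by rewrite addrC subrK.
exists (e ^ size fs * C)%N => n k kn.
have := lenle_adjlX pM iN CM (n := (e * n)%N).
rewrite expnMn mulnAC; apply.
apply: lenge_sub (lenge_initial (gpowP a n) (fun x ax => ax) kn).
apply: adjl_min; first by apply: initialP; apply: gpowP.
  by move=> F NF; apply: initial_fil; apply: sub_fil.
move=> _ /mapP[f ff ->]; apply: initial_fil; rewrite exprM.
by have := filX iN n (fe f ff); rewrite mul1n.
Qed.

End GradedRing.

Import Order.TTheory Num.Theory.

(** * Hilbert polynomials *)

Section HilbertPolynomial.
Implicit Types (e : nat -> int) (d n : nat).

Definition hpoly e d n : int :=
  \sum_(i < d.+1) (-1) ^+ i * e i * ('C(n + d - i, d - i))%:Z.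

Lemma hpoly_nabla e d n : hpoly e d.+1 n.+1 - hpoly e d.+1 n = hpoly e d n.+1.
Proof.
rewrite /hpoly big_ord_recr [X in _ - X]big_ord_recr /= subnn !bin0.
rewrite opprD addrACA subrr addr0 -sumrB; apply: eq_bigr => i _.
have id : (i <= d)%N by rewrite -ltnS ltn_ord.
rewrite -mulrBr; congr (_ * _); rewrite subSn //.
have -> : (n.+1 + d.+1 - i = (n + (d - i).+1).+1)%N by lia.
have -> : (n + d.+1 - i = n + (d - i).+1)%N by lia.
have -> : (n.+1 + d - i = n + (d - i).+1)%N by lia.
by rewrite binS PoszD addrC addKr.
Qed.

Lemma bin3 x : (6 * 'C(x.+2, 3) = x * x.+1 * x.+2)%N.
Proof.
by have := bin_ffact x.+2 3; rewrite !ffactSS ffactn1 (_ : 3`! = 6) //; lia.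
Qed.

Lemma bin2' x : (2 * 'C(x.+1, 2) = x * x.+1)%N.
Proof. by have := bin_ffact x.+1 2; rewrite !ffactSS ffactn1 (_ : 2`! = 2) //; lia. Qed.

Lemma hpoly3 e x : 6 * hpoly e 3 x = e 0%N * ((x.+1)%:Z * (x.+2)%:Z * (x.+3)%:Z)
  - 3 * e 1%N * ((x.+1)%:Z * (x.+2)%:Z) + 6 * e 2 * (x.+1)%:Z - 6 * e 3.
Proof.
rewrite /hpoly !big_ord_recr big_ord0 /= subn0.
have -> : (x + 3 = x.+3)%N by lia.
have -> : (x.+3 - 1 = x.+2)%N by lia.
have -> : (x.+3 - 2 = x.+1)%N by lia.
have -> : (3 - 1 = 2)%N by [].
have -> : (3 - 2 = 1)%N by [].
have <- : 6 * ('C(x.+3, 3))%:Z = (x.+1)%:Z * (x.+2)%:Z * (x.+3)%:Z.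
  by rewrite -!PoszM -bin3.
have <- : 2 * ('C(x.+2, 2))%:Z = (x.+1)%:Z * (x.+2)%:Z.
  by rewrite -!PoszM -bin2'.
by rewrite subnn bin0 bin1; ring.
Qed.

Lemma cubic_lead_ge0 (c0 c1 c2 c3 : int) n0 :
  (forall x, (n0 <= x)%N -> 0 <= c0 * x%:Z ^+ 3 + c1 * x%:Z ^+ 2 + c2 * x%:Z + c3) ->
  0 <= c0.
Proof.
move=> pos; rewrite leNgt; apply/negP => c0lt.
pose M := (`|c1| + `|c2| + `|c3|)%N.
have := pos (n0 + M + 1)%N; rewrite -addnA leq_addr => /(_ isT).
rewrite leNgt => /negP; apply.
have [y yE] : exists y : int, y = (n0 + (M + 1))%:Z by exists (n0 + (M + 1))%:Z.
rewrite -yE.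
have My : `|c1|%:Z + `|c2|%:Z + `|c3|%:Z + 1 <= y by rewrite yE /M; lia.
have l1 : c1 <= `|c1|%:Z by lia.
have l2 : c2 <= `|c2|%:Z by lia.
have l3 : c3 <= `|c3|%:Z by lia.
move: (`|c1|%N) (`|c2|%N) (`|c3|%N) l1 l2 l3 My => k1 k2 k3 l1 l2 l3 My.
have y1 : 1 <= y by lia.
nia.
Qed.

(** The predecessors come from the convention of [hpoly], whose value at n is the length for the
    power n + 1. *)
Lemma third_difference e k : (0 < k)%N ->
  hpoly e 3 (k + k + k).-1 - 3 * hpoly e 3 (k + k).-1 + 3 * hpoly e 3 k.-1 =
  e 0%N * k%:Z ^+ 3 - e 3.
Proof.
case: k => // k _.
apply: (@mulfI _ (6 : int)) => //.
have -> : (k.+1 + k.+1 + k.+1).-1 = (3 * k + 2)%N by lia.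
have -> : (k.+1 + k.+1).-1 = (2 * k + 1)%N by lia.
rewrite mulrDr mulrBr [6 * (3 * _)]mulrCA [6 * (3 * hpoly _ _ k)]mulrCA !hpoly3 /=.
have -> : (3 * k + 2).+1%:Z = 3 * k%:Z + 3 by lia.
have -> : (3 * k + 2).+2%:Z = 3 * k%:Z + 4 by lia.
have -> : (3 * k + 2).+3%:Z = 3 * k%:Z + 5 by lia.
have -> : (2 * k + 1).+1%:Z = 2 * k%:Z + 2 by lia.
have -> : (2 * k + 1).+2%:Z = 2 * k%:Z + 3 by lia.
have -> : (2 * k + 1).+3%:Z = 2 * k%:Z + 4 by lia.
have -> : k.+1%:Z = k%:Z + 1 by lia.
have -> : k.+2%:Z = k%:Z + 2 by lia.
have -> : k.+3%:Z = k%:Z + 3 by lia.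
by ring.
Qed.

Lemma hpoly_lead_le e e' c n0 :
  (forall x, (n0 <= x)%N -> hpoly e 3 x <= hpoly e' 3 (x + c)) -> e 0%N <= e' 0%N.
Proof.
move=> le; rewrite -subr_ge0.
pose C := c%:Z.
(* q1, q2, q3 are the lower coefficients in x of six times the difference of the two polynomials;
   the leading one is e'_0 - e_0. *)
pose q1 := e' 0%N * (3 * C + 6) - 3 * e' 1%N - (6 * e 0%N - 3 * e 1%N).
pose q2 := e' 0%N * (3 * C ^+ 2 + 12 * C + 11) - 3 * e' 1%N * (2 * C + 3) + 6 * e' 2
  - (11 * e 0%N - 9 * e 1%N + 6 * e 2).
pose q3 := e' 0%N * ((C + 1) * (C + 2) * (C + 3)) - 3 * e' 1%N * ((C + 1) * (C + 2))
  + 6 * e' 2 * (C + 1) - 6 * e' 3 - (6 * e 0%N - 6 * e 1%N + 6 * e 2 - 6 * e 3).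
apply: (@cubic_lead_ge0 _ q1 q2 q3 n0) => x /le.
rewrite -(@ler_pM2l _ (6 : int)) // !hpoly3 -subr_ge0; congr (is_true (_ <= _)).
have -> : (x + c).+1%:Z = x%:Z + C + 1 by rewrite /C; lia.
have -> : (x + c).+2%:Z = x%:Z + C + 2 by rewrite /C; lia.
have -> : (x + c).+3%:Z = x%:Z + C + 3 by rewrite /C; lia.
have -> : x.+1%:Z = x%:Z + 1 by lia.
have -> : x.+2%:Z = x%:Z + 2 by lia.
have -> : x.+3%:Z = x%:Z + 3 by lia.
by rewrite /q1 /q2 /q3; ring.
Qed.

End HilbertPolynomial.

(** [vv_colon] applied to the segment P followed by t, whose degree-one lifts form a regular
    sequence on the graded ring. *)
Lemma seq_state_fregular r (U V : comNzRingType) (a : 'I_r -> U) (X : 'I_r -> V)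
    (rho : {rmorphism V -> {poly U}}) NV P t Q ws xV fV :
  seq_state a X rho NV (P ++ t :: Q) ws xV fV ->
  gpow a 1 t /\ fregular (fun n => adjl (gpow a n) P) t.
Proof.
move=> [[rhoP iNV rxs] [rU _ rV _]].
have rP : map rho (take (size P) xV) = [seq x%:P * 'X | x <- P].
  by rewrite map_take rxs -map_take take_size_cat.
have rQ : map rho (drop (size P) xV) = [seq x%:P * 'X | x <- t :: Q].
  by rewrite map_drop rxs -map_drop drop_size_cat.
move: rP rQ rV; rewrite -{3}(cat_take_drop (size P) xV).
case: (drop _ _) => //= tV QV; move: (take _ _) => PV rP [rt rQ] rV.
split; first exact: (gpow_of_rho rhoP rt).
move=> n f.
have rvs : map rho (tV :: rev PV) = [seq x%:P * 'X | x <- t :: rev P].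
  by rewrite /= rt !map_rev rP.
have := @vv_colon _ _ _ _ _ _ _ rhoP iNV _ _ _ n f rvs; rewrite !rev_cons !revK; apply.
  by move: rV; rewrite -cat_rcons -catA => /regl_cat[].
by move: rU; rewrite -catA => /regl_cat[_ []].
Qed.

Lemma fil_adjl r (U : comNzRingType) (a : 'I_r -> U) xs :
  (fun n => adjl (gpow a n) xs) = fil a (adjl (@zero_ideal U) xs).
Proof.
apply: functional_extensionality => n; rewrite /fil -adjl_add; congr adjl.
apply: sset_eq => x; last by move=> [u [v [au -> ->]]]; rewrite addr0.
by apply: ideal_addl; apply: zero_ideal_ideal.
Qed.

Lemma state_compare r s e HI HJ : state r s e 3 0 HI HJ ->
  eventually (fun k => (HJ (k + k + k) + 3 * HJ k + 3 * HI (k + k) <=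
    HI (k + k + k) + 3 * HI k + 3 * HJ (k + k))%N) /\
  exists c, eventually (fun n => (HI n <= HJ (n + c))%N).
Proof.
move=> [U [V [p [a [b [X [rho [NV [xs [ts [ws [xV [fV [bs ss]]]]]]]]]]]]]].
move=> [sx st _ _]; case: ts st ss => [|t1 [|t2 [|t3 [|]]]] // _ ss.
have [[nU pP ab [c rc]] [[nI hI] [nJ hJ] [n3 cJ]]] := bs.
have iN := adjlP xs (@zero_ideal_ideal U).
have [at1 r1] := seq_state_fregular ss.
have [at2 r2] : gpow a 1 t2 /\ fregular (fun n => adjl (gpow a n) (rcons xs t1)) t2.
  by apply: (@seq_state_fregular _ _ _ _ X rho NV _ _ [:: t3] ws xV fV); rewrite cat_rcons.
have [at3 r3] : gpow a 1 t3 /\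
    fregular (fun n => adjl (gpow a n) (rcons (rcons xs t1) t2)) t3.
  by apply: (@seq_state_fregular _ _ _ _ X rho NV _ _ [::] ws xV fV); rewrite !cat_rcons.
split; last first.
  exists c, (maxn nI nJ) => n; rewrite geq_max => /andP[nn nn'].
  apply: haslen_leq (hJ (n + c)%N _) (hI n nn); last by rewrite (leq_trans nn') ?leq_addr.
  by rewrite addnC; apply: fil_reduces.
exists (maxn (maxn nI nJ) n3) => k; rewrite !geq_max => /andP[/andP[kI kJ] k3].
have F1 : fregular (fil a (adjl (@zero_ideal U) xs)) t1 by rewrite -fil_adjl.
have E1 : fadj (fil a (adjl (@zero_ideal U) xs)) t1 =
    fun n => adjl (gpow a n) (rcons xs t1).
  rewrite -fil_adjl; apply: functional_extensionality => n.
  by rewrite adjl_rcons.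
have F2 : fregular (fadj (fil a (adjl (@zero_ideal U) xs)) t1) t2 by rewrite E1.
have F3 : fregular (fadj (fadj (fil a (adjl (@zero_ideal U) xs)) t1) t2) t3.
  rewrite E1 (_ : fadj _ _ = fun n => adjl (gpow a n) (rcons (rcons xs t1) t2)) //.
  by apply: functional_extensionality => n; rewrite adjl_rcons.
apply: (len_compare pP iN ab rc cJ k3 at1 at2 at3 F1 F2 F3).
- exact: hI.
- by apply: hI; rewrite (leq_trans kI) ?leq_addr.
- by apply: hI; rewrite (leq_trans kI) // -addnA leq_addr.
- exact: hJ.
- by apply: hJ; rewrite (leq_trans kJ) ?leq_addr.
- by apply: hJ; rewrite (leq_trans kJ) // -addnA leq_addr.
Qed.

Lemma haslen_nabla r (U : comNzRingType) (p N : U -> Prop) (a : 'I_r -> U) H f g :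
  is_ideal N -> eventually (fun n => haslen p (H n) (fil a N n)) ->
  (forall n, f n.+1 - f n = g n.+1) ->
  eventually (fun n => (H n)%:Z = f n.-1) -> eventually (fun n => (nabla H n)%:Z = g n.-1).
Proof.
move=> iN [n0 hH] fg [n1 Hf]; exists (maxn n0 n1).+2 => -[|[|n]] //.
rewrite !ltnS geq_max => /andP[nn0 nn1].
have le : (H n.+1 <= H n.+2)%N.
  by apply: haslen_leq (hH n.+2 _) (hH n.+1 _); rewrite ?leqW //; apply: fil_le.
by rewrite /nabla /= -subzn // !Hf ?leqW //= fg.
Qed.

Lemma state_reach r s eI eJ j e HI HJ : state r s e 0 (j + 3) HI HJ ->
  eventually (fun n => (HI n)%:Z = hpoly eI (j + 3) n.-1) ->
  eventually (fun n => (HJ n)%:Z = hpoly eJ (j + 3) n.-1) ->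
  exists HI' HJ', [/\ state r s (e + j) 0 3 HI' HJ',
    eventually (fun n => (HI' n)%:Z = hpoly eI 3 n.-1)
    & eventually (fun n => (HJ' n)%:Z = hpoly eJ 3 n.-1)].
Proof.
elim: j e HI HJ => [|j IH] e HI HJ st hI hJ; first by exists HI, HJ; rewrite addn0.
have st' : state r s e.+1 0 (j + 3) (nabla HI) (nabla HJ).
  by move: st; rewrite addSn !addnS addn0; apply: state_gx.
have [bI bJ] : eventually (fun n => (nabla HI n)%:Z = hpoly eI (j + 3) n.-1) /\
    eventually (fun n => (nabla HJ n)%:Z = hpoly eJ (j + 3) n.-1).
  have [U [V [p [a [b [X [rho [NV [xs [ts [ws [xV [fV [bs _]]]]]]]]]]]]]] := st.
  have [_ [lI lJ _]] := bs; have iN := adjlP xs (@zero_ideal_ideal U).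
  split; [apply: (haslen_nabla iN lI) hI|apply: (haslen_nabla iN lJ) hJ] => n;
    exact: hpoly_nabla.
by have [HI' [HJ' H]] := IH _ _ _ st' bI bJ; exists HI', HJ'; rewrite addnS -addSn.
Qed.

Lemma state_e3 r s eI eJ j HI HJ : state r s 0 0 (j + 3) HI HJ ->
  eventually (fun n => (HI n)%:Z = hpoly eI (j + 3) n.-1) ->
  eventually (fun n => (HJ n)%:Z = hpoly eJ (j + 3) n.-1) -> eI 3 <= eJ 3.
Proof.
move=> st hI hJ.
have [HI' [HJ' [st' [nI bI] [nJ bJ]]]] := state_reach st hI hJ.
(* The three members left over are exchanged for t_1, t_2, t_3, which are not divided out. *)
have [[n0 cmp] [c [n1 lead]]] := state_compare (state_ext (state_ext (state_ext st'))).
have e0 : eI 0%N <= eJ 0%N.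
  apply: (@hpoly_lead_le _ _ c (maxn n1 (maxn nI nJ))) => x.
  rewrite !geq_max => /and3P[x1 xI xJ].
  rewrite -[x in hpoly eI 3 x]/(x.+1.-1) -[(x + c)%N]/((x.+1 + c).-1) -bI ?leqW //.
  rewrite -bJ; last by rewrite addSn leqW // (leq_trans xJ) ?leq_addr.
  by rewrite lez_nat; apply: lead; apply: leqW.
pose k := (maxn n0 (maxn nI nJ)).+1.
have [k0 kI kJ] : [/\ n0 <= k, nI <= k & nJ <= k]%N by rewrite /k; split; lia.
have kk3 n : (n <= k -> n <= k + k + k)%N by lia.
have kk2 n : (n <= k -> n <= k + k)%N by lia.
have := cmp k k0.
have := bI _ kI; have := bI _ (kk2 _ kI); have := bI _ (kk3 _ kI).
have := bJ _ kJ; have := bJ _ (kk2 _ kJ); have := bJ _ (kk3 _ kJ).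
have := third_difference eI (isT : (0 < k)%N).
have := third_difference eJ (isT : (0 < k)%N).
have := ler_wpM2r (exprn_ge0 3 (le0z_nat k)) e0.
move: (hpoly eI 3 _) (hpoly eI 3 _) (hpoly eI 3 _) => i1 i2 i3.
move: (hpoly eJ 3 _) (hpoly eJ 3 _) (hpoly eJ 3 _) => j1 j2 j3.
move: (HI' _) (HI' _) (HI' _) (HJ' _) (HJ' _) (HJ' _) => *.
lia.
Qed.

Theorem theorem4p1 (A : comNzRingType) (m I J : A -> Prop) (d : nat)
    (eI eJ : nat -> int) :
  noetherian A -> local_ring m -> CM_local m d -> (3 <= d)%N ->
  m_primary m I -> m_primary m J -> sset I J -> reduction I J ->
  Gr_CM I -> asymptotically_normal J ->
  hilb_coeffs I d eI -> hilb_coeffs J d eJ ->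
  eI 3%N <= eJ 3%N.
Proof.
move=> nA lA [_ [[w wreg] _]] d3 mI mJ IJ [_ [c0 red]] [r [a [genI cmI]]] [nn nJ] hI hJ.
have [iI iJ] : is_ideal I /\ is_ideal J by case: mI; case: mJ.
have i0 := @zero_ideal_ideal A; have pm := local_prime nA lA.
have aI : I = gpow a 1.
  apply: sset_eq => x; first by move=> /genI[c ->]; exists c.
  by move=> [c _ ->]; apply/genI; exists c.
have [gs gE] := noetherian_fg nA iJ.
pose b (i : 'I_(size gs)) := gs`_i.
have bJ : J = gpow b 1 by rewrite gE adjl_isum.
have ab i : gpow b 1 (a i) by rewrite -bJ; apply: IJ; rewrite aI; apply: gpow1.
have rc : reduces a b c0.
  move=> n cn; rewrite -(ideal_pow_gpow b n.+1) -bJ => x /(red n cn).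
  apply: ideal_mul_min; first by apply: isumP; apply: gpowP.
  move=> u v; rewrite {1}aI bJ ideal_pow_gpow => -[g _ ->] bv.
  exists (fun i => g i * v) => [i|]; first by apply: idM => //; apply: gpowP.
  by rewrite mulr_suml; apply: eq_bigr => i _; rewrite mulrAC.
have rw := regular_seq_regl i0 wreg.
have tw x : x \in mkseq w d -> torsion a (@zero_ideal A) x.
  move=> /mapP[i]; rewrite mem_iota => /andP[_ id] ->.
  have [wm _ _] := wreg; have /(proj2 mI)[e We] := wm i id.
  by exists e, (w i ^+ e); rewrite -aI subrr.
have [u au uN] : exists2 u, gpow a 1 u & nzd (@zero_ideal A) u.
  case: (mkseq w d) (size_mkseq w d) rw tw => [|x l] /=; first by move: d3 => /[swap] <-.
  by move=> _ [xN _] tw; apply: (torsion_nzd i0 _ xN); apply: tw; rewrite mem_head.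
have filE q (y : 'I_q -> A) n : fil y (@zero_ideal A) n = gpow y n.
  by rewrite -[@zero_ideal A]/(adjl (@zero_ideal A) [::]) -fil_adjl.
have hilb K q (y : 'I_q -> A) e : K = gpow y 1 -> hilb_coeffs K d e ->
    exists H, eventually (fun n => haslen m (H n) (fil y (@zero_ideal A) n)) /\
      eventually (fun n => (H n)%:Z = hpoly e d n.-1).
  move=> KE [n0 hK].
  have {}hK n : exists l, (n0 <= n)%N ->
      length_eq (ideal_pow K n.+1) l /\ l%:Z = hpoly e d n.
    have [nn0|nn0] := leqP n0 n; last by exists 0%N.
    by have [l lP] := hK n nn0; exists l.
  (* [hilb_coeffs] measures the power n + 1 at n; the shift indexes lengths by the power itself. *)
  have [H HP] := functional_choice _ hK; exists (H \o predn).
  split; exists n0.+1 => -[|n] // nn0; have [lH eH] := HP n nn0; last exact: eH.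
  rewrite filE; apply: length_haslen => //; first exact: gpowP.
  by move: lH; rewrite KE ideal_pow_gpow.
have [HI [lI pI]] := hilb _ _ _ _ aI hI.
have [HJ [lJ pJ]] := hilb _ _ _ _ bJ hJ.
have pV := irrelevant_prime r nA lA.
have NE := gr_kernelE aI.
have [h [hM [[f freg] _]]] : exists h, height (gr_ker a) (irrelevant m (r := r)) h /\
    grade (gr_ker a) (irrelevant m (r := r)) h.
  rewrite -NE; apply: cmI; first exact: irrelevant_maximal.
  by rewrite NE; apply: (gr_ker_irrelevant mI aI).
have iNV := gr_kerP a.
have rf := regular_seq_regl iNV freg.
have Mf x : x \in mkseq f h -> irrelevant m x.
  move=> /mapP[i]; rewrite mem_iota => /andP[_ ih] ->.
  by case: freg => fm _ _; apply: fm.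
(* Gr may have been given a regular sequence of another length h; this bound allows it to be cut to
   d elements, one for each member of the sequence in A. *)
have dh : (d <= h)%N.
  have [|D HD] := gr_growth nA lA mI aI rf Mf; first by rewrite size_mkseq.
  rewrite size_mkseq in HD.
  have [n0 lI'] := lI.
  apply: (@hilbert_state_growth r d h D (fun n => if (n0 <= n)%N then HI n else 0%N)).
    exists A, m, (@zero_ideal A), a, (mkseq w d); split; split=> //.
    - by move=> x ->; apply: id0; apply: local_ideal lA.
    - by move=> i; apply: (I_sub_m mI); rewrite aI; apply: gpow1.
    - exact: size_mkseq.
    - by exists n0 => n nn0; rewrite nn0; apply: lI'.
  move=> n; case: ifP => // nn0; apply: HD.
  by have [] := lI' n nn0; rewrite filE.
pose fV := take d (mkseq f h).
have : state r (size gs) 0 0 d HI HJ.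
  exists A, {mpoly A[r]}, m, a, b, (fun i => 'X_i), (rees a), (gr_ker a),
    [::], [::], (mkseq w d), [::], fV.
  split; last by rewrite size_mkseq size_takel // size_mkseq.
  - split; split=> //; first by exists c0.
    (* The bound 1 secures n > 0, required by [integrally_closed_almost]. *)
    exists (maxn nn 1) => n; rewrite geq_max => /andP[nn0 n0].
    apply: (integrally_closed_almost nA n0 (gpow_sub ab au) uN).
    by have := nJ n nn0; rewrite bJ ideal_pow_gpow.
  - split; split=> //=.
    + split=> //; [exact: rees_coef|exact: rees_lift|exact: reesX].
    + by move: rf; rewrite -{1}(cat_take_drop d (mkseq f h)) => /regl_cat[].
    + by move=> x /mem_take/Mf; apply: (irrelevant_torsion mI aI).
rewrite -(subnK d3) in pI pJ *; move=> st.
exact: (state_e3 st pI pJ).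
Qed.
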